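(* Let $\delta>0$ and $k\ge 0$ be fixed real numbers. Suppose that $X,D\to\infty$ with $X\ll(\log D)^{2-\delta}$. Then $$\frac{1}{D^{*}}\sum_{0<d\leq D}{}^{\flat}\ P_{X}(\chi_{8d})^{k}\sim a_{k,Sp}\,(e^{\gamma}\log X)^{k(k+1)/2}.$$
   Context: The sum $\sum^{\flat}_{0<d\le D}$ runs over odd, positive, square-free integers $d\le D$, and $D^{*}$ is the number of such $d$ in $(0,D]$. For such $d$, $\chi_{8d}$ denotes the real primitive Dirichlet character of conductor $8d$ with $\chi_{8d}(-1)=1$ (i.e. the Kronecker symbol $\left(\frac{8d}{\cdot}\right)$). For real $X\ge 2$, $$P_{X}(\chi_{8d})=\exp\bigg(\sum_{2\le n\leq X}\frac{\Lambda(n)\chi_{8d}(n)}{n^{1/2}\log n}\bigg),$$ where $\Lambda$ is von Mangoldt's function. $\gamma$ is Euler's constant. The constant $a_{k,Sp}$ is $$a_{k,Sp}=2^{-k(k+2)/2}\prod_{p\geq3}\frac{(1-\frac{1}{p})^{k(k+1)/2}}{1+\frac{1}{p}}\bigg(\frac{(1-\frac{1}{\sqrt{p}})^{-k}+(1+\frac{1}{\sqrt{p}})^{-k}}{2}+\frac{1}{p}\bigg),$$ the product being over odd primes $p$. *)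

(* Defs.v *)
From HB Require Import structures.
From mathcomp Require Import all_boot all_order all_algebra.
From mathcomp Require Import all_classical all_reals all_analysis.
Set Implicit Arguments.
Unset Strict Implicit.
Unset Printing Implicit Defensive.
Import Order.TTheory GRing.Theory Num.Theory.
Import numFieldNormedType.Exports.
Local Open Scope ring_scope.

(* In particular squarefree 0 = false. *)
Definition squarefree (n : nat) : bool :=
  [forall m : 'I_n.+1, (m ^ 2 %| n)%N ==> (m == 1%N :> nat)].

Definition odd_squarefree (d : nat) : bool := odd d && squarefree d.

(* The symbol (a / p) for a prime p, odd or equal to 2. *)
Definition kronecker_prime (a : int) (p : nat) : int :=
  if (p%:Z %| a)%Z then 0
  else if p == 2%N then
    (if ((a %% 8)%Z == 1) || ((a %% 8)%Z == 7) then 1 else -1)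
  else if [exists x : 'I_p, ((x%:Z ^+ 2)%R == a %[mod p%:Z])%Z] then 1
  else -1.

Definition kronecker (a n : int) : int :=
  if n == 0 then (if `|a|%N == 1%N then 1 else 0)
  else (if (n < 0) && (a < 0) then -1 else 1) *
       \prod_(p <- primes `|n|%N) kronecker_prime a p ^+ logn p `|n|%N.

Definition chi_8d (d : nat) (n : int) : int := kronecker (8 * d)%N%:Z n.

(* primes n = [:: p] exactly when n = p ^ m with p prime and m > 0. *)
Definition vonMangoldt (R : realType) (n : nat) : R :=
  if primes n is [:: p] then ln p%:R else 0.

(* For X >= 0 and n : nat, n <= X iff n < (Num.truncn X).+1. *)
Definition PX (R : realType) (X : R) (chi : int -> int) : R :=
  expR (\sum_(2 <= n < (Num.truncn X).+1)
          vonMangoldt R n * (chi n%:Z)%:~R / (Num.sqrt n%:R * ln n%:R)).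

Definition Dstar (R : realType) (D : R) : nat :=
  \sum_(1 <= d < (Num.truncn D).+1 | odd_squarefree d) 1%N.

Definition moment (R : realType) (k X D : R) : R :=
  (Dstar D)%:R^-1 *
  \sum_(1 <= d < (Num.truncn D).+1 | odd_squarefree d) (PX X (chi_8d d)) `^ k.

Definition euler_gamma (R : realType) : R :=
  limn (fun n : nat => \sum_(1 <= i < n.+1) i%:R^-1 - ln n%:R : R).

Definition a_Sp_factor (R : realType) (k : R) (p : nat) : R :=
  (1 - p%:R^-1) `^ (k * (k + 1) / 2) / (1 + p%:R^-1) *
  (((1 - (Num.sqrt p%:R)^-1) `^ (- k) + (1 + (Num.sqrt p%:R)^-1) `^ (- k)) / 2
   + p%:R^-1).

(* The infinite product is the limit of the products over 3 <= p < N. *)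
Definition a_Sp (R : realType) (k : R) : R :=
  2 `^ (- (k * (k + 2) / 2)) *
  limn (fun N : nat => \prod_(3 <= p < N | prime p) a_Sp_factor k p).

(* Main.v *)
(* For odd squarefree d, P_X(chi_{8d})^k is a product over odd primes p <= X of a
   function of chi_{8d}(p) in {0, 1, -1}, hence a polynomial 1 + B_p chi + C_p chi^2.
   Expanding, the mean over d of a monomial a -> chi_{8d}(a) 1_{(d,b)=1} differs from
   its main term (zero unless a = 1) by at most K (ab) D^(-1/8), and trivially by at
   most 2.  Interpolating between the two bounds with a small exponent s, the total
   error is at most D^(-s/8) exp(O(sum_{p <= X} p^(s-1/2))), which tends to 0 because
   X << (log D)^(2-delta).  What remains is a product of local factors over p <= X.
   Since P_X keeps only the prime powers <= X, the factor at sqrt X < p <= X lacks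
   exp(k/(2p)); by Mertens' theorem this accounts for an extra 2^(-k/2), and the rest
   of the product is evaluated with Mertens' third theorem. *)
Require Import Defs.
From HB Require Import structures.
From mathcomp Require Import all_boot all_order all_algebra.
From mathcomp Require Import all_classical all_reals all_analysis.
From mathcomp Require Import ring lra zify.
Set Implicit Arguments.
Unset Strict Implicit.
Unset Printing Implicit Defensive.
Import Order.TTheory GRing.Theory Num.Theory.
Import numFieldNormedType.Exports.
Local Open Scope classical_set_scope.
Local Open Scope ring_scope.

(** * Elementary inequalities and series *)

(** The obstacle is uniformity. The expansion has about 3^(pi(X)) monomials and for most of them a b
    may far exceed every power of D, so the bound with D^(-1/8) alone is useless. After
    interpolation each prime costs only a factor 1 + O(p^(s - 1/2)), and the errors recombine into a
    product. Its logarithm is O(X^(1/2 + s)), obtained by summing over all integers up to X, and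
    this is o(log D) exactly because (2 - delta)(1/2 + s) < 1 for small s. The constant in Mertens'
    third theorem is found without complex analysis: the logarithm of Mertens' product is sampled at
    the powers of 2, compared with harmonic numbers (whence gamma), and its Abel mean is evaluated
    through 1/d <= zeta(1+d) <= 1 + 1/d. A single convergent majorant, m^(-3/2) with sum at most 3,
    controls the sieve, the Mertens sums and the logarithms of the local factors. *)

Lemma ln_le_subr1 (R : realType) (x : R) : 0 < x -> ln x <= x - 1.
Proof.
move=> x0; have := @le_ln1Dx R (x - 1).
by rewrite (_ : 1 + (x - 1) = x); [apply; lra | ring].
Qed.

Lemma ln_ge_1subV (R : realType) (x : R) : 0 < x -> 1 - x^-1 <= ln x.
Proof.
move=> x0; have := @ln_le_subr1 R x^-1; rewrite invr_gt0 lnV ?posrE// => /(_ x0); lra.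
Qed.

Lemma ln_le_sqrt (R : realType) (x : R) : 0 < x -> ln x <= 2 * Num.sqrt x.
Proof.
move=> x0; have s0 : 0 < Num.sqrt x by rewrite sqrtr_gt0.
have e : ln x = 2 * ln (Num.sqrt x).
  by rewrite -[in LHS](sqr_sqrtr (ltW x0)) lnXn// mulr2n; ring.
by have := ln_le_subr1 s0; lra.
Qed.

Lemma cvgn_le_ub (R : realType) (u : nat -> R) (l b : R) (N : nat) :
  u @ \oo --> l -> (forall n, (N <= n)%N -> u n <= b) -> l <= b.
Proof.
move=> ul ub; rewrite leNgt; apply/negP => bl.
have e0 : 0 < l - b by rewrite subr_gt0.
have /cvgrPdist_lt/(_ _ e0)[M _ HM] := ul.
have /= := HM (maxn N M) (leq_maxr _ _).
have := ub _ (leq_maxl N M).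
by move=> h1 h2; have := ler_norm (l - u (maxn N M)); lra.
Qed.

Lemma cvgn_ge_lb (R : realType) (u : nat -> R) (l b : R) (N : nat) :
  u @ \oo --> l -> (forall n, (N <= n)%N -> b <= u n) -> b <= l.
Proof.
move=> ul ub; rewrite -lerN2; apply: (@cvgn_le_ub R (fun n => - u n) _ _ N).
  exact: cvgN.
by move=> n /ub; rewrite lerN2.
Qed.

Lemma cvgn_dist_le (R : realType) (u : nat -> R) (l c b : R) (N : nat) :
  u @ \oo --> l -> (forall n, (N <= n)%N -> `|u n - c| <= b) -> `|l - c| <= b.
Proof.
move=> ul ub; rewrite ler_norml; apply/andP; split.
  rewrite lerBrDr; apply: (cvgn_ge_lb ul) => n /ub; rewrite ler_norml => /andP[]; lra.
rewrite lerBlDr; apply: (cvgn_le_ub ul) => n /ub; rewrite ler_norml => /andP[]; lra.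
Qed.

Lemma cvg_sum_abs_bounded (R : realType) (t : nat -> R) (B : R) :
  (forall n, \sum_(1 <= m < n) `|t m| <= B) ->
  cvgn (fun n => \sum_(1 <= m < n) t m).
Proof.
(* [series] starts at index 0 while the sums here start at 1, so the value at 0 is replaced by 0. *)
move=> hB; pose u k := if k is 0%N then 0 else t k.
have sumE (f : R -> R) (f0 : f 0 = 0) n :
    \sum_(0 <= k < n) f (u k) = \sum_(1 <= m < n) f (t m).
  case: n => [|n]; first by rewrite !big_geq.
  by rewrite big_ltn// /u f0 add0r big_nat [RHS]big_nat; apply: eq_bigr => -[].
rewrite (_ : (fun n => _) = series u); last first.
  by apply/funext => n; rewrite /series /= (sumE id).
apply: normed_cvg; apply: nondecreasing_is_cvgn.
  by apply: nondecreasing_series => n _ _; exact: normr_ge0.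
by exists B => _ [n _ <-]; apply: le_trans (hB n); rewrite -(sumE _ (normr0 _)).
Qed.

(** A discrete integral test: d (m+1)^(-1-d) is at most the decrement of t^(-d) between m and m+1,
    and the decrements telescope. With the matching lower bound of [sum_powR_ge] it locates
    zeta(1+d) between 1/d and 1 + 1/d. *)
Lemma sum_powR_le (R : realType) (d : R) (n : nat) : 0 < d ->
  \sum_(1 <= m < n) m%:R `^ (- (1 + d)) <= 1 + d^-1.
Proof.
move=> d0; case: n => [|[|n]].
- by rewrite big_geq// addr_ge0 ?invr_ge0 ?ltW.
- by rewrite big_geq// addr_ge0 ?invr_ge0 ?ltW.
rewrite big_ltn// powR1 lerD2l.
suff H : forall m : nat, (1 <= m)%N ->
    d * m.+1%:R `^ (- (1 + d)) <= m%:R `^ (- d) - m.+1%:R `^ (- d) :> R.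
  rewrite -(ler_pM2l d0) divff ?gt_eqF// big_add1 /= big_distrr /=.
  apply: (@le_trans _ _ (\sum_(1 <= i < n.+1 )
      ((fun i => - i%:R `^ (- d)) i.+1 - (fun i => - i%:R `^ (- d)) i : R))).
    apply: ler_sum_nat => i /andP[i1 _].
    by have := H _ i1; lra.
  by rewrite telescope_sumr// opprK powR1 gerDr oppr_le0 powR_ge0.
move=> m m1.
have m0 : 0 < m%:R :> R by rewrite ltr0n.
have m0' : 0 < m.+1%:R :> R by rewrite ltr0n.
rewrite lerBrDr opprD powRD; last by apply/implyP => _; rewrite gt_eqF.
rewrite powR_inv1 ?ler0n// mulrA -{2}[_ `^ (- d)]mul1r -mulrDl addrC.
have -> : (m%:R : R) = m.+1%:R * (m%:R / m.+1%:R) by rewrite mulrCA divff ?mulr1 ?gt_eqF.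
rewrite powRM ?divr_ge0// mulrC ler_wpM2l ?powR_ge0//.
rewrite /powR gt_eqF ?divr_gt0//; apply: le_trans (expR_ge1Dx _).
rewrite lerD2l mulNr -mulrN; apply: ler_wpM2l; first exact: ltW.
rewrite lerNr.
apply: (le_trans (ln_le_subr1 _)); first by rewrite divr_gt0.
have -> : m%:R / m.+1%:R = 1 - m.+1%:R^-1 :> R.
  by rewrite -[m%:R](addrK 1) natr1 mulrBl divff ?gt_eqF// mul1r.
by rewrite addrAC subrr add0r.
Qed.

Lemma sum_powR_ge (R : realType) (d : R) (n : nat) : 0 < d -> (0 < n)%N ->
  1 - n%:R `^ (- d) <= d * \sum_(1 <= m < n) m%:R `^ (- (1 + d)).
Proof.
move=> d0 n0; rewrite big_distrr /=.
suff H : forall m : nat, (1 <= m)%N ->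
     m%:R `^ (- d) - m.+1%:R `^ (- d) <= d * m%:R `^ (- (1 + d)) :> R.
  apply: (@le_trans _ _ (\sum_(1 <= i < n)
      ((fun i => - i%:R `^ (- d)) i.+1 - (fun i => - i%:R `^ (- d)) i : R))).
    by rewrite telescope_sumr// opprK powR1 addrC.
  apply: ler_sum_nat => i /andP[i1 _].
  by have := H _ i1; lra.
move=> m m1.
have m0 : 0 < m%:R :> R by rewrite ltr0n.
have m0' : 0 < m.+1%:R :> R by rewrite ltr0n.
rewrite opprD powRD; last by apply/implyP => _; rewrite gt_eqF.
rewrite powR_inv1 ?ler0n// mulrA lerBlDr -lerBlDl -{1}[_ `^ (- d)]mul1r -mulrBl.
have -> : (m.+1%:R : R) = m%:R * (m.+1%:R / m%:R) by rewrite mulrCA divff ?mulr1 ?gt_eqF.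
rewrite powRM ?divr_ge0// mulrC ler_wpM2l ?powR_ge0//.
rewrite /powR gt_eqF ?divr_gt0//; apply: le_trans (expR_ge1Dx _).
rewrite lerD2l mulNr lerN2; apply: ler_wpM2l; first exact: ltW.
apply: (le_trans (ln_le_subr1 _)); first by rewrite divr_gt0.
by rewrite -natr1 mulrDl divff ?gt_eqF// mul1r addrAC subrr add0r.
Qed.

Lemma sum_powR32 (R : realType) (n : nat) :
  \sum_(1 <= m < n) m%:R `^ (- (3 / 2)) <= 3 :> R.
Proof.
have -> : 3 / 2 = 1 + 2^-1 :> R by lra.
by apply: (le_trans (@sum_powR_le R 2^-1 n _)) => //; rewrite invrK; lra.
Qed.

Lemma cvg_sum_powR32 (R : realType) (t : nat -> R) (C : R) :
  (forall m, (1 <= m)%N -> `|t m| <= C * m%:R `^ (- (3 / 2))) ->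
  cvgn (fun n => \sum_(1 <= m < n) t m).
Proof.
move=> ht; apply: (@cvg_sum_abs_bounded R t (C * 3)) => n.
have C0 : 0 <= C.
  by have := ht 1%N isT; rewrite powR1 mulr1; apply: le_trans.
apply: (@le_trans _ _ (C * \sum_(1 <= m < n) m%:R `^ (- (3 / 2)))); last first.
  by rewrite ler_wpM2l// sum_powR32.
rewrite big_distrr /=; apply: ler_sum_nat => m /andP[m1 _].
exact: ht.
Qed.

(** Dominated convergence for sums whose terms and whose length both depend on n. It is needed
    because the factor at p of a truncated Euler product still changes with the truncation point. *)
Lemma tannery (R : realType) (r : nat -> nat -> R) (l : nat -> R) (C : R) :
  (forall n m, (1 <= m <= n)%N -> `|r n m| <= C * m%:R `^ (- (3 / 2))) ->
  (forall m, (1 <= m)%N -> r ^~ m @ \oo --> l m) ->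
  (fun n => \sum_(1 <= m < n.+1) r n m) @ \oo -->
  limn (fun n => \sum_(1 <= m < n) l m).
Proof.
move=> hr hl.
have hlC m : (1 <= m)%N -> `|l m| <= C * m%:R `^ (- (3 / 2)).
  move=> m1; rewrite -[l m]subr0; apply: (cvgn_dist_le (hl m m1) (N := m)).
  by move=> n mn; rewrite subr0 hr// m1.
have cl := cvg_sum_powR32 hlC.
have C0 : 0 <= C.
  by have := hlC 1%N isT; rewrite powR1 mulr1; apply: le_trans.
have cz : cvgn (fun n => \sum_(1 <= m < n) (C * m%:R `^ (- (3 / 2)) : R)).
  apply: (@cvg_sum_powR32 _ _ C) => m m1.
  by rewrite ger0_norm// mulr_ge0// powR_ge0.
apply/cvgrPdist_le => e e0.
have e4 : 0 < e / 4 by rewrite divr_gt0.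
have /cvgrPdist_le/(_ _ e4)[N1 _ HN1] := cl.
have /cvgrPdist_le/(_ _ e4)[N2 _ HN2] := cz.
(* Beyond this cut-off the tails of the limit series and of the majorant are both small; below it
   finitely many terms converge one by one. *)
pose N := (maxn (maxn N1 N2) 1).
have c0 : (fun n => \sum_(1 <= m < N) r n m) @ \oo --> \sum_(1 <= m < N) l m.
  elim: N => [|N' IH].
    by rewrite big_geq// (_ : (fun _ => _) = cst 0); [exact: cvg_cst | apply/funext => n; rewrite big_geq].
  case: N' IH => [|N'] IH.
    by rewrite big_geq// (_ : (fun _ => _) = cst 0); [exact: cvg_cst | apply/funext => n; rewrite big_geq].
  rewrite big_nat_recr//= (_ : (fun _ => _) = (fun n => \sum_(1 <= m < N'.+1) r n m + r n N'.+1)).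
    by apply: cvgD => //; exact: hl.
  by apply/funext => n; rewrite big_nat_recr.
have /cvgrPdist_le/(_ _ e4)[N3 _ HN3] := c0.
exists (maxn N N3) => // n /=; rewrite geq_max => /andP[nN nN3].
have tailz : \sum_(N <= m < n.+1) (C * m%:R `^ (- (3 / 2))) <= e / 2.
  have h1 := HN2 N (leq_trans (leq_maxr _ _) (leq_maxl _ _)).
  have h2 := HN2 n.+1 (leq_trans (leq_trans (leq_maxr _ _) (leq_maxl _ _)) (leqW nN)).
  move: h1 h2 => /=; rewrite (@big_cat_nat _ _ _ N 1 n.+1)/=; last 2 first.
  - by rewrite leq_maxr.
  - by rewrite ltnW.
  by rewrite !ler_norml => /andP[? ?] /andP[? ?]; lra.
have hN1 : `|limn (fun n0 => \sum_(1 <= m < n0) l m) - \sum_(1 <= m < N) l m| <= e / 4.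
  by apply: HN1 => /=; apply: leq_trans (leq_maxl _ _); apply: leq_maxl.
have hN3 := HN3 n nN3.
rewrite (@big_cat_nat _ _ _ N 1 n.+1)/=; last 2 first.
- by rewrite leq_maxr.
- by rewrite ltnW.
have ht : `|\sum_(N <= m < n.+1) r n m| <= e / 2.
  apply: le_trans tailz; apply: (le_trans (ler_norm_sum _ _ _)).
  apply: ler_sum_nat => m /andP[Nm mn].
  by apply: hr; apply/andP; split; [exact: leq_trans (leq_maxr _ _) Nm | rewrite -ltnS].
move: hN1 hN3 ht; rewrite !ler_norml => /andP[? ?] /andP[? ?] /andP[? ?].
by apply/andP; split; lra.
Qed.

(** Mean value theorem along u -> u y: the derivative of ln (1 - u y) plus the partial sum is a
    geometric sum that collapses to the single term -y (u y)^J / (1 - u y). *)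
Lemma ln_series (R : realType) (y : R) (J : nat) : `|y| < 1 ->
  `|- ln (1 - y) - \sum_(1 <= j < J.+1) y ^+ j / j%:R| <= `|y| ^+ J.+1 / (1 - `|y|).
Proof.
move=> y1.
pose f (u : R) := ln (1 - u * y) + \sum_(1 <= j < J.+1) (u * y) ^+ j / j%:R.
have ylt (u : R) : u \in `[0, 1] -> `|u * y| <= `|y|.
  rewrite in_itv/= => /andP[u0 u1]; rewrite normrM ger0_norm//.
  by rewrite ler_piMl.
have pos (u : R) : u \in `[0, 1] -> 0 < 1 - u * y.
  by move=> /ylt h; have := ler_norm (u * y); lra.
pose df u := - y * (u * y) ^+ J / (1 - u * y).
have dS (u : R) : is_derive u 1 (fun u : R => \sum_(1 <= j < J.+1) (u * y) ^+ j / j%:R)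
     (y * \sum_(i < J) (u * y) ^+ i).
  clear; elim: J => [|J' IH].
    rewrite big_ord0 mulr0 (_ : (fun _ => _) = cst 0); first exact: is_derive_cst.
    by apply/funext => z; rewrite big_geq.
  rewrite (_ : (fun u => _) = (fun u => \sum_(1 <= j < J'.+1) (u * y) ^+ j / j%:R) +
     (fun u => (y ^+ J'.+1 / J'.+1%:R) * u ^+ J'.+1)); last first.
    apply/funext => z; rewrite big_nat_recr//= exprMn; congr (_ + _).
    by rewrite /= [RHS]mulrC mulrA.
  rewrite big_ord_recr/= mulrDr; apply: is_deriveD.
  have := @is_deriveZ R R R (fun u => u ^+ J'.+1) (y ^+ J'.+1 / J'.+1%:R) u 1 (J'.+1%:R * u ^+ J').
  rewrite /GRing.scale /=.
  have -> : y ^+ J'.+1 / J'.+1%:R * (J'.+1%:R * u ^+ J') = y * (u * y) ^+ J'.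
    rewrite exprMn exprS mulrA mulfVK ?pnatr_eq0//; ring.
  apply.
  have := @is_deriveX R R id J'.+1 u 1 1 (is_derive_id u 1).
  have -> : (GRing.exp (R:=R))^~ J'.+1 = id ^+ J'.+1 by apply/funext => z; rewrite fctE.
  by rewrite /GRing.scale /= mulr1.
have d (u : R) : u \in `[0, 1] -> is_derive u 1 f (df u).
  move=> u01; rewrite /f /df.
  have -> : - y * (u * y) ^+ J / (1 - u * y) =
     (1 - u * y)^-1 * (- y) + y * \sum_(i < J) (u * y) ^+ i.
    have p0 := pos _ u01.
    have -> : \sum_(i < J) (u * y) ^+ i = (1 - (u * y) ^+ J) / (1 - u * y).
      apply: (mulIf (lt0r_neq0 p0)); rewrite divfK ?lt0r_neq0//.
      by rewrite -[RHS]opprB subrX1; ring.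
    by field; rewrite lt0r_neq0.
  have dl : is_derive u 1 (fun v : R => ln (1 - v * y)) ((1 - u * y)^-1 * - y).
    have d1 : is_derive u 1 (fun v : R => 1 - v * y) (- y).
      have h1 := @is_deriveZ R R R id y u 1 1 (is_derive_id u 1).
      have h2 := is_deriveD (is_derive_cst (1 : R) u 1) (is_deriveN h1).
      move: h2; rewrite /GRing.scale /= mulr1 add0r; congr (is_derive _ _ _ _).
      by apply/funext => z /=; rewrite !fctE /= mulrC.
    have d2 : is_derive (1 - u * y) 1 (@ln R) (1 - u * y)^-1 by exact/is_derive1_ln/pos.
    exact: (@is_derive1_comp R (@ln R) (fun v => 1 - v * y) u _ _ d2 d1).
  exact: is_deriveD dl (dS u).
have d' (x : R) : x \in `]0, 1[ -> is_derive x 1 f (df x).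
  by rewrite in_itv /= => /andP[x0 x1]; apply: d; rewrite in_itv /= !ltW.
have cf : {within `[0, 1], continuous f}.
  apply: derivable_within_continuous => x x01.
  by have := d x x01; move=> /@ex_derive.
have [c c01 Hc] := MVT_segment ler01 d' cf.
have f0 : f 0 = 0.
  rewrite /f mul0r subr0 ln1 add0r big_nat big1// => j /andP[j1 _].
  by case: j j1 => // j _; rewrite exprS !mul0r.
have -> : - ln (1 - y) - \sum_(1 <= j < J.+1) y ^+ j / j%:R = - f 1.
  by rewrite /f !mul1r opprD.
move: Hc; rewrite f0 !subr0 mulr1 => ->; rewrite normrN /df.
rewrite !normrM normrN normfV (ger0_norm (ltW (pos _ c01))) exprS normrX.
have p0 := pos _ c01.
apply: ler_pM => //.
- by rewrite invr_ge0 ltW.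
- by rewrite ler_wpM2l// lerXn2r ?nnegrE ?ylt.
- rewrite lef_pV2 ?posrE//; last by lra.
  by have := ylt _ c01; have := ler_norm (c * y); lra.
Qed.

(** Taking y^3 out of the tail of the exponential series leaves terms bounded by those of exp |y|,
    since (i+3)! >= i!. *)
Lemma expR_taylor2 (R : realType) (y : R) :
  `|expR y - (1 + y + y ^+ 2 / 2)| <= `|y| ^+ 3 * expR `|y|.
Proof.
apply: (cvgn_dist_le (@is_cvg_series_exp_coeff R y) (N := 3)) => n n3.
rewrite -(subnKC n3); move: (n - 3)%N => {n3}n.
rewrite (_ : (3 + n = n.+3)%N)// /series /= !big_nat_recl//= /exp_coeff /=.
rewrite expr0 expr1 fact0 divr1 (_ : 1`! = 1%N)// divr1 (_ : 2`! = 2%N)//.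
rewrite (_ : 1 + (y + (y ^+ 2 / 2 + _)) - _ = \sum_(0 <= i < n) y ^+ i.+3 / i.+3`!%:R); last by ring.
apply: (le_trans (ler_norm_sum _ _ _)).
apply: (@le_trans _ _ (`|y| ^+ 3 * series (exp_coeff `|y|) n)); last first.
  rewrite ler_wpM2l ?exprn_ge0//.
  apply: nondecreasing_cvgn_le; last exact: is_cvg_series_exp_coeff.
  by apply: nondecreasing_series => i _ _; apply: exp_coeff_ge0.
rewrite /series /= big_distrr /=; apply: ler_sum => i _.
rewrite normrM normrX /exp_coeff /= normfV (ger0_norm (ler0n _ _)).
have -> : `|y| ^+ i.+3 = `|y| ^+ 3 * `|y| ^+ i by rewrite -exprD.
rewrite -mulrA; apply: ler_wpM2l; first exact: exprn_ge0.
apply: ler_wpM2l; first exact: exprn_ge0.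
rewrite lef_pV2 ?posrE ?ltr0n ?fact_gt0// ler_nat.
by rewrite fact_smonotone // || (rewrite leq_fact//; lia).
Qed.

(** * Chebyshev's bound and Mertens' first theorem *)

Lemma ln_prod_nat (R : realType) (s : seq nat) (F : nat -> nat) :
  (forall i, (0 < F i)%N) ->
  ln ((\prod_(i <- s) F i)%N%:R : R) = \sum_(i <- s) ln (F i)%:R.
Proof.
move=> F0; elim: s => [|a s IH]; first by rewrite !big_nil ln1.
rewrite !big_cons natrM lnM ?posrE ?ltr0n ?F0 ?IH//.
by rewrite prodn_gt0.
Qed.

Lemma ln_prime_factors (R : realType) (m N : nat) : (0 < m)%N ->
  (forall p, prime p -> (p %| m)%N -> (p <= N)%N) ->
  ln (m%:R : R) = \sum_(1 <= p < N.+1 | prime p) (logn p m)%:R * ln p%:R.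
Proof.
move=> m0 hN; pose M := maxn m N.
have E : ln (m%:R : R) = \sum_(1 <= p < M.+1 | prime p) (logn p m)%:R * ln p%:R.
  rewrite -{1}(partnT m0) (widen_partn (n := m) predT (leq_maxl m N)) -/M.
  rewrite ln_prod_nat; last first.
    by move=> [|i]; [rewrite lognE | rewrite expn_gt0].
  rewrite big_ltn// lognE /= expn0 ln1 add0r [RHS]big_mkcond /=.
  apply: eq_big_nat => -[|i]// _; case: ifP => pi.
    by rewrite natrX lnXn ?ltr0n// mulr_natl.
  by rewrite lognE pi expn0 ln1.
rewrite E (@big_cat_nat _ _ _ N.+1)//=; last by rewrite ltnS leq_maxr.
rewrite [X in _ + X]big_nat_cond [X in _ + X]big1 ?addr0// => p /andP[/andP[Np _] pp].
rewrite lognE pp m0 /=; case: ifP => [pm|]; last by rewrite mul0r.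
by have := hN p pp pm; rewrite leqNgt Np.
Qed.

Lemma prime_dvd_fact_leq (p n : nat) : prime p -> (p %| n`!)%N -> (p <= n)%N.
Proof.
move=> pp; elim: n => [|n IH]; first by rewrite dvdn1 => /eqP p1; rewrite p1 in pp.
by rewrite factS Euclid_dvdM// => /orP[/dvdn_leq->//|/IH/leqW].
Qed.

Lemma ln_fact (R : realType) (n : nat) :
  ln (n`!%:R : R) = \sum_(1 <= p < n.+1 | prime p)
    (\sum_(1 <= k < n.+1) n %/ p ^ k)%N%:R * ln p%:R.
Proof.
rewrite (@ln_prime_factors _ _ n) ?fact_gt0//; last by move=> p; exact: prime_dvd_fact_leq.
by apply: eq_bigr => p pp; rewrite logn_fact.
Qed.

Definition theta (R : realType) (n : nat) : R := \sum_(1 <= p < n.+1 | prime p) ln p%:R.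

Lemma ln_nat_ge0 (R : realType) (n : nat) : 0 <= ln n%:R :> R.
Proof. by case: n => [|n]; [rewrite ln0 | rewrite ln_ge0// ler1n]. Qed.

(** Every prime in (n, 2n] divides the central binomial coefficient, which is at most 2^(2n). *)
Lemma theta_double (R : realType) (n : nat) :
  theta R (2 * n) <= theta R n + (2 * n)%:R * ln 2.
Proof.
have Cpos : (0 < 'C(2 * n, n))%N by rewrite bin_gt0; lia.
have Cle : ('C(2 * n, n) <= 2 ^ (2 * n))%N.
  have -> : (2 ^ (2 * n) = \sum_(i < (2 * n).+1) 'C(2 * n, i))%N.
    rewrite -[2%N]/(1 + 1)%N expnDn; apply: eq_bigr => i _.
    by rewrite !exp1n !muln1.
  have hn : (n < (2 * n).+1)%N by lia.
  by rewrite (bigD1 (Ordinal hn)) //= leq_addr.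
have h1 : ln ('C(2 * n, n)%:R : R) <= (2 * n)%:R * ln 2.
  have : ln ('C(2 * n, n)%:R : R) <= ln ((2 ^ (2 * n))%N%:R).
    by rewrite ler_ln ?posrE ?ltr0n ?expn_gt0// ler_nat.
  by rewrite natrX lnXn// mulr_natl.
rewrite /theta (@big_cat_nat _ _ _ n.+1)//=; last by rewrite ltnS leq_pmull.
rewrite lerD2l; apply: le_trans h1.
rewrite (@ln_prime_factors _ _ (2 * n)%N)//; last first.
  move=> p pp pC; apply: prime_dvd_fact_leq => //.
  have le : (n <= 2 * n)%N by lia.
  by rewrite -(bin_fact le) dvdn_mulr.
rewrite [leRHS](@big_cat_nat _ _ _ n.+1)//=; last by rewrite ltnS leq_pmull.
rewrite -[leLHS]add0r; apply: lerD.
  by apply: sumr_ge0 => p _; rewrite mulr_ge0// ln_nat_ge0.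
rewrite big_nat_cond [leRHS]big_nat_cond; apply: ler_sum => p /andP[/andP[np p2n] pp].
rewrite ler_peMl ?ln_nat_ge0// ler1n logn_gt0 mem_primes pp Cpos /=.
have le : (n <= 2 * n)%N by lia.
have : (p %| (2 * n)`!)%N by rewrite dvdn_fact// prime_gt0//= -ltnS.
rewrite -(bin_fact le) (_ : (2 * n - n = n)%N); last by lia.
rewrite !Euclid_dvdM// => /orP[//|/orP[]] /(prime_dvd_fact_leq pp); rewrite leqNgt np//.
Qed.

Lemma ln2_le1 (R : realType) : ln (2 : R) <= 1.
Proof. by apply: (le_trans (ln_le_subr1 _)) => //; lra. Qed.

Lemma ln2_ge (R : realType) : 2^-1 <= ln (2 : R).
Proof. by apply: (le_trans _ (ln_ge_1subV _)) => //; lra. Qed.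

(** Iterating the doubling bound gives theta(2^k) <= 2^(k+1); rounding n up to a power of 2 costs
    another factor 2. *)
Lemma theta_le (R : realType) (n : nat) : theta R n <= 4 * n%:R.
Proof.
have pow2 k : theta R (2 ^ k) <= (2 ^ k.+1)%N%:R.
  elim: k => [|k IH].
    by rewrite /theta expn0 big_ltn_cond//= big_geq// ler0n.
  rewrite expnS; apply: (le_trans (theta_double _ _)).
  rewrite -expnS; apply: (@le_trans _ _ ((2 ^ k.+1)%:R + (2 ^ k.+1)%:R * 1)).
    by apply: lerD => //; rewrite ler_wpM2l// ln2_le1.
  by rewrite mulr1 -natrD addnn -mul2n -expnS.
have mono m m' : (m <= m')%N -> theta R m <= theta R m'.
  move=> mm; rewrite /theta [leRHS](@big_cat_nat _ _ _ m.+1)//=.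
  by rewrite lerDl sumr_ge0// => i _; exact: ln_nat_ge0.
have [n1|n1] := leqP n 1.
  apply: (@le_trans _ _ 0); last by rewrite mulr_ge0.
  rewrite /theta big_nat_cond big1// => p /andP[/andP[p1 pn] /prime_gt1 pp]; lia.
have /andP[h1 h2] := @up_log_bounds 2 n isT n1.
apply: (le_trans (mono _ _ h2)); apply: (le_trans (pow2 _)).
rewrite -natrM ler_nat.
have : (0 < up_log 2 n)%N by rewrite up_log_gt0.
by case: (up_log 2 n) h1 => // k /= h1 _; rewrite !expnS; lia.
Qed.

Lemma geom_sum_le (R : realFieldType) (y : R) (n : nat) : 0 <= y <= 2^-1 ->
  \sum_(1 <= k < n.+1) y ^+ k <= y + 2 * y ^+ 2.
Proof.
move=> /andP[y0 y1].
(* The bound is strengthened by the next power so that the induction closes for y <= 1/2. *)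
suff H : \sum_(1 <= k < n.+2) y ^+ k <= y + 2 * y ^+ 2 - 2 * y ^+ n.+2.
  have hp : 0 <= y ^+ n.+1 by exact: exprn_ge0.
  have hp2 : 0 <= y ^+ n.+2 by exact: exprn_ge0.
  by move: H; rewrite big_nat_recr//=; lra.
elim: n => [|n IH]; first by rewrite big_nat1 expr1; lra.
rewrite big_nat_recr//= (exprS y n.+2).
have hp : 0 <= y ^+ n.+2 by exact: exprn_ge0.
have : y * y ^+ n.+2 <= 2^-1 * y ^+ n.+2 by exact: ler_wpM2r.
by lra.
Qed.

Lemma ln_fact_ge (R : realType) (n : nat) : n%:R * ln n%:R - n%:R <= ln (n`!%:R : R).
Proof.
elim: n => [|n IH]; first by rewrite mul0r subr0 fact0 ln1.
rewrite factS natrM lnM ?posrE ?ltr0n ?fact_gt0//.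
case: n IH => [|n] IH; first by rewrite !mul1r fact0 !ln1 addr0; lra.
have h : n.+1%:R * (ln n.+2%:R - ln n.+1%:R) <= 1 :> R.
  rewrite -ler_pdivlMl ?ltr0n// mulr1 -ln_div ?posrE ?ltr0n//.
  apply: (le_trans (ln_le_subr1 _)); first by rewrite divr_gt0 ?ltr0n.
  by rewrite -natr1 mulrDl divff// mul1r addrAC subrr add0r.
by move: IH h; rewrite -[n.+2%:R]natr1; lra.
Qed.

Lemma sqrV_le_powR32 (R : realType) (m : nat) : (0 < m)%N ->
  (m%:R^-1) ^+ 2 <= m%:R `^ (- (3 / 2)) :> R.
Proof.
move=> m0; rewrite exprVn -powR_invn ?ler0n//; apply: ler_powR; first by rewrite ler1n.
by lra.
Qed.

Lemma ln_sqrV_le_powR32 (R : realType) (m : nat) : (0 < m)%N ->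
  ln m%:R * (m%:R^-1) ^+ 2 <= 2 * m%:R `^ (- (3 / 2)) :> R.
Proof.
move=> m0; have m0' : 0 < m%:R :> R by rewrite ltr0n.
have -> : m%:R `^ (- (3 / 2)) = Num.sqrt m%:R * (m%:R^-1) ^+ 2 :> R.
  rewrite -powR12_sqrt ?ltW// exprVn -powR_invn ?ltW// -powRD.
    by congr (_ `^ _); lra.
  by apply/implyP => _; rewrite gt_eqF.
by rewrite [leRHS]mulrA; apply: ler_wpM2r; [rewrite exprn_ge0// invr_ge0 | exact: ln_le_sqrt].
Qed.

(** ln n! is computed by Legendre's formula and compared with n ln n. Keeping only the exponent 1
    and losing the fractional parts costs theta(n) <= 4n; keeping all powers costs the convergent
    sum of 4 p^(-3/2), at most 12. Stirling's lower bound adds 1, whence 13. *)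
Lemma mertens1 (R : realType) (n : nat) : (0 < n)%N ->
  `|\sum_(1 <= p < n.+1 | prime p) ln p%:R / p%:R - ln n%:R| <= 13 :> R.
Proof.
move=> n0; have nR : 0 < n%:R :> R by rewrite ltr0n.
pose S := \sum_(1 <= p < n.+1 | prime p) ln p%:R / p%:R : R.
have up : n%:R * S - theta R n <= ln (n`!%:R : R).
  rewrite ln_fact /S /theta big_distrr /= -sumrB; apply: ler_sum => p pp.
  rewrite mulrCA mulrC -[X in _ - X]mul1r -mulrBl.
  apply: ler_wpM2r; first exact: ln_nat_ge0.
  have pR : 0 < p%:R :> R by rewrite ltr0n prime_gt0.
  rewrite big_ltn// natrD expn1; apply: (@le_trans _ _ (n %/ p)%:R); last by rewrite lerDl.
  rewrite lerBlDr ler_pdivrMr// natr1 -natrM ler_nat.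
  by rewrite ltnW// ltn_ceil// prime_gt0.
have lo : ln (n`!%:R : R) <= n%:R * S + n%:R * 12.
  rewrite ln_fact.
  apply: (@le_trans _ _ (\sum_(1 <= p < n.+1 | prime p)
     (n%:R * (ln p%:R / p%:R) + n%:R * (4 * p%:R `^ (- (3 / 2))) : R))); last first.
    rewrite big_split /= -!big_distrr /= lerD2l; apply: ler_wpM2l; first exact: ltW.
    apply: (@le_trans _ _ (4 * \sum_(1 <= p < n.+1) p%:R `^ (- (3 / 2)))).
      rewrite ler_wpM2l// [leLHS]big_mkcond /=; apply: ler_sum => p _.
      by case: ifP => // _; exact: powR_ge0.
    by have := sum_powR32 R n.+1; lra.
  apply: ler_sum => p pp.
  have p0 := prime_gt0 pp.
  have pR : 0 < p%:R :> R by rewrite ltr0n.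
  rewrite -mulrDr.
  apply: (@le_trans _ _ (n%:R * (\sum_(1 <= k < n.+1) (p%:R^-1) ^+ k) * ln p%:R)).
    apply: ler_wpM2r; first exact: ln_nat_ge0.
    rewrite natr_sum big_distrr /=; apply: ler_sum => k _.
    rewrite exprVn -natrX ler_pdivlMr ?ltr0n ?expn_gt0 ?p0//.
    by rewrite -natrM ler_nat leq_trunc_div.
  rewrite -mulrA; apply: ler_wpM2l; first exact: ltW.
  apply: (@le_trans _ _ ((p%:R^-1 + 2 * p%:R^-1 ^+ 2) * ln p%:R)).
    apply: ler_wpM2r; first exact: ln_nat_ge0.
    apply: geom_sum_le; rewrite invr_ge0 ltW//= lef_pV2 ?posrE//.
    by rewrite ler_nat prime_gt1.
  rewrite mulrDl [p%:R^-1 * _]mulrC lerD2l.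
  by have := @ln_sqrV_le_powR32 R _ p0; lra.
have f1 : ln (n`!%:R : R) <= n%:R * ln n%:R.
  rewrite mulr_natl -lnXn// -natrX ler_ln ?posrE ?ltr0n ?fact_gt0 ?expn_gt0 ?n0//.
  rewrite ler_nat fact_prod.
  rewrite -[X in (_ <= _ ^ X)%N](subn1 n.+1) -prod_nat_const_nat.
  by rewrite big_nat [leqRHS]big_nat; apply: leq_prod => i /andP[_]; rewrite ltnS.
have f2 := ln_fact_ge R n.
have th := theta_le R n.
rewrite -/S ler_norml; apply/andP; split.
  have : n%:R * (- 13) <= n%:R * (S - ln n%:R) by lra.
  by rewrite ler_pM2l.
have : n%:R * (S - ln n%:R) <= n%:R * 13 by lra.
by rewrite ler_pM2l.
Qed.

(** * Mertens' second theorem, Euler's constant *)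

Lemma sum_telescope_pred (R : zmodType) (f : nat -> R) (n : nat) :
  \sum_(1 <= m < n.+1) (f m - f m.-1) = f n - f 0%N.
Proof.
elim: n => [|n IH]; first by rewrite big_geq// subrr.
by rewrite big_nat_recr//= IH [LHS]addrC addrA subrK.
Qed.

Lemma ln_nat_unbounded (R : realType) (M : R) :
  exists N : nat, forall n, (N <= n)%N -> M <= ln (n%:R : R).
Proof.
exists (Num.truncn (expR M)).+1 => n Nn.
rewrite -[M]expRK ler_ln ?posrE ?expR_gt0//; last by rewrite ltr0n (leq_trans _ Nn).
apply: ltW; apply: (lt_le_trans (truncnS_gt _)); by rewrite ler_nat.
Qed.

Lemma cvgn_sub (R : realType) (u : nat -> R) (phi : nat -> nat) (l : R) :
  (forall n, (n <= phi n)%N) -> u @ \oo --> l -> (fun n => u (phi n)) @ \oo --> l.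
Proof.
move=> hphi /cvgrPdist_le ul; apply/cvgrPdist_le => e e0.
have [N _ HN] := ul e e0; exists N => // n /= Nn.
by apply: HN => /=; exact: leq_trans (hphi n).
Qed.

Lemma is_cvgn_shift (R : realType) (u : nat -> R) :
  cvgn u -> cvgn (fun n => u n.+1).
Proof. by move=> /cvg_ex[l ul]; apply/cvg_ex; exists l; apply: (cvgn_sub (phi := S)) ul. Qed.

Lemma cvg_inv_ln (R : realType) : (fun n => (ln n%:R)^-1 : R) @ \oo --> 0.
Proof.
apply/cvgrPdist_le => e e0.
have [N HN] := @ln_nat_unbounded R e^-1.
exists N => // n /= /HN h; rewrite sub0r normrN ger0_norm; last by rewrite invr_ge0 ln_nat_ge0.
rewrite -[leRHS]invrK lef_pV2 ?posrE ?invr_gt0//.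
by apply: lt_le_trans h; rewrite invr_gt0.
Qed.

Lemma ln_succ_sub_le (R : realType) (m : nat) : (0 < m)%N ->
  ln m.+1%:R - ln m%:R <= m%:R^-1 :> R.
Proof.
move=> m0; have mR : 0 < m%:R :> R by rewrite ltr0n.
rewrite -ln_div ?posrE ?ltr0n//.
apply: (le_trans (ln_le_subr1 _)); first by rewrite divr_gt0 ?ltr0n.
by rewrite -natr1 mulrDl divff ?gt_eqF// mul1r addrAC subrr add0r.
Qed.

Lemma ln_succ_sub_ge (R : realType) (m : nat) : (0 < m)%N ->
  m.+1%:R^-1 <= ln m.+1%:R - ln m%:R :> R.
Proof.
move=> m0; have mR : 0 < m%:R :> R by rewrite ltr0n.
rewrite -ln_div ?posrE ?ltr0n//.
apply: (le_trans _ (ln_ge_1subV _)); last by rewrite divr_gt0 ?ltr0n.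
have m1 : m.+1%:R != 0 :> R by rewrite pnatr_eq0.
rewrite invf_div; have -> : m%:R / m.+1%:R = 1 - m.+1%:R^-1 :> R.
  by rewrite -[m%:R](addrK 1) natr1 mulrBl divff ?gt_eqF// mul1r.
by rewrite opprB addrC subrK.
Qed.

Lemma invS_le (R : realType) (m : nat) : (0 < m)%N -> m%:R^-1 <= 2 * m.+1%:R^-1 :> R.
Proof.
move=> m0; rewrite ler_pdivlMr ?ltr0n// -ler_pdivlMl ?invr_gt0 ?ltr0n// invrK.
by rewrite -natrM ler_nat; lia.
Qed.

(** Abel summation of ln p / p against the weight 1 / ln m. The error [B] in Mertens' first theorem
    is bounded and the weights decrease, so the summed part converges absolutely; [e] measures how
    far (ln m - ln (m-1)) / ln m is from the increment of ln ln. Only convergence is obtained here;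
    the constant is identified later. *)
Lemma prime_recip_cvg (R : realType) :
  cvgn (fun n => \sum_(1 <= p < n.+1 | prime p) p%:R^-1 - ln (ln n%:R) : R).
Proof.
pose b m : R := (if prime m then ln m%:R / m%:R else 0) - (ln m%:R - ln m.-1%:R).
pose B n : R := \sum_(1 <= m < n.+1) b m.
pose w m : R := (ln m%:R)^-1.
pose t m : R := B m * (w m - w m.+1).
pose e m : R := (ln m%:R - ln m.-1%:R) * w m - (ln (ln m%:R) - ln (ln m.-1%:R)).
have B0 : B 0%N = 0 by rewrite /B big_geq.
have BS n : B n.+1 = B n + b n.+1 by rewrite /B big_nat_recr.
have w0 m : 0 <= w m by rewrite invr_ge0 ln_nat_ge0.
have wm m : (1 < m)%N -> 0 <= w m - w m.+1.
  move=> m1; rewrite subr_ge0 lef_pV2 ?posrE ?ln_gt0 ?ltr1n//; last by rewrite ltnW.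
  by rewrite ler_ln ?posrE ?ltr0n ?ler_nat// ltnW.
have HB n : (0 < n)%N -> `|B n| <= 13.
  move=> n0; have := mertens1 R n0; rewrite /B sumrB.
  by rewrite (sum_telescope_pred (fun m => ln m%:R)) [ln 0%:R]ln0// subr0 -big_mkcond.
have parts n : \sum_(1 <= m < n.+1) b m * w m = B n * w n + \sum_(1 <= m < n) t m.
  elim: n => [|n IH]; first by rewrite !big_geq// B0 mul0r addr0.
  rewrite big_nat_recr//= IH BS; case: n {IH} => [|n].
    by rewrite B0 !big_geq//; ring.
  by rewrite [in RHS]big_nat_recr//= /t; ring.
have ct : cvgn (fun n => \sum_(1 <= m < n) t m).
  apply: (@cvg_sum_abs_bounded _ _ (13 * w 2%N)) => n.
  have H k : \sum_(1 <= m < k.+2) `|t m| <= 13 * (w 2%N - w k.+2).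
    elim: k => [|k IH].
      rewrite big_nat1 /t BS B0 /b /= ln1 [ln 0%:R]ln0// subrr add0r subr0 mul0r normr0.
      by rewrite subrr mulr0.
    rewrite big_nat_recr//= [t _]lock -lock /t normrM [X in _ * X]ger0_norm ?wm//.
    have : `|B k.+2| * (w k.+2 - w k.+3) <= 13 * (w k.+2 - w k.+3).
      by apply: ler_wpM2r; [exact: wm | exact: HB].
    lra.
  case: n => [|[|n]]; [by rewrite big_geq ?mulr_ge0 | by rewrite big_geq ?mulr_ge0 | ].
  by apply: (le_trans (H n)); have := w0 n.+2; lra.
have eb m : (2 < m)%N -> `|e m| <= 16 * m%:R `^ (- (3 / 2)).
  case: m => // m m2.
  apply: (@le_trans _ _ (16 * m.+1%:R^-1 ^+ 2)); last first.
    by rewrite ler_wpM2l// sqrV_le_powR32.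
  rewrite /e /w /=; set v := ln m.+1%:R; set u := ln m%:R.
  have u2 : 2^-1 <= u.
    by apply: (le_trans (ln2_ge R)); rewrite ler_ln ?posrE ?ltr0n ?ler_nat//; lia.
  have uv : u <= v by rewrite ler_ln ?posrE ?ltr0n ?ler_nat//; lia.
  have D : v - u <= 2 * m.+1%:R^-1.
    by apply: (le_trans (ln_succ_sub_le R _)); [lia | apply: invS_le; lia].
  have u0 : 0 < u by lra.
  have v0 : 0 < v by lra.
  have l1 : ln v - ln u <= v / u - 1.
    by rewrite -ln_div ?posrE//; apply: ln_le_subr1; rewrite divr_gt0.
  have l2 : 1 - u / v <= ln v - ln u.
    by rewrite -ln_div ?posrE// -invf_div; apply: ln_ge_1subV; rewrite divr_gt0.
  have e1 : (v - u) / v = 1 - u / v by rewrite mulrBl divff ?gt_eqF.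
  have e2 : v / u - 1 - (1 - u / v) = (v - u) ^+ 2 * (u^-1 * v^-1).
    by field; rewrite !gt_eqF.
  have iu : u^-1 <= 2 by rewrite -[2]invrK lef_pV2 ?posrE ?invr_gt0.
  have iv : v^-1 <= 2 by apply: le_trans iu; rewrite lef_pV2 ?posrE.
  have h3 : u^-1 * v^-1 <= 2 * 2 by apply: ler_pM => //; rewrite invr_ge0 ltW.
  have h4 : (v - u) ^+ 2 <= (2 * m.+1%:R^-1) ^+ 2.
    by rewrite lerXn2r// nnegrE ?subr_ge0// mulr_ge0 ?invr_ge0.
  have h5 : (v - u) ^+ 2 * (u^-1 * v^-1) <= (2 * m.+1%:R^-1) ^+ 2 * (2 * 2).
    by apply: ler_pM => //; rewrite ?exprn_ge0 ?mulr_ge0 ?invr_ge0 ?subr_ge0// ltW.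
  move: h5; rewrite exprMn => h5.
  move: h5 l1 l2 e2; rewrite e1.
  move: ((v - u) ^+ 2 * _) (m.+1%:R^-1 ^+ 2) (u / v) (v / u) (ln v) (ln u) => Q M a c x y h5 l1 l2 e2.
  by rewrite ler_norml; apply/andP; split; lra.
have ce : cvgn (fun n => \sum_(1 <= m < n) e m).
  (* The estimate [eb] starts at m = 3, where ln (m-1) >= ln 2. The term [e 1] vanishes by the
     convention ln 0 = 0, and [e 2] is absorbed into the constant. *)
  apply: (@cvg_sum_powR32 _ _ (16 + `|e 2%N| * 2 `^ (3 / 2))) => -[|[|[|m]]]// _.
  - have l00 : ln (0 : R) = 0 by rewrite ln0.
    have -> : e 1%N = 0.
      rewrite /e ln1 -[(1%N.-1)%:R]/(0 : R) l00 subrr mul0r l00.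
      by rewrite !subrr.
    rewrite normr0 mulr_ge0 ?powR_ge0//.
  - rewrite mulrDl -mulrA -powRD; last by apply/implyP => _.
    by rewrite subrr powRr0 mulr1 lerDr mulr_ge0 ?powR_ge0.
  - apply: (le_trans (eb m.+3 _)) => //; apply: ler_wpM2r; first exact: powR_ge0.
    by rewrite lerDl mulr_ge0 ?powR_ge0.
have -> : (fun n => \sum_(1 <= p < n.+1 | prime p) p%:R^-1 - ln (ln n%:R) : R) =
   (fun n => (B n * w n + \sum_(1 <= m < n) t m) + \sum_(1 <= m < n.+1) e m).
  apply/funext => n; rewrite -parts /e sumrB.
  rewrite (sum_telescope_pred (fun m => ln (ln m%:R))) /= [ln 0%:R]ln0// [ln 0]ln0// subr0.
  rewrite addrA -big_split /=; congr (_ - _); rewrite big_mkcond /=.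
  apply: eq_big_nat => m /andP[m1 _]; rewrite /b -mulrDl subrK /w.
  case: ifP => pm; last by rewrite mul0r.
  by rewrite mulrAC divff ?mul1r// gt_eqF// ln_gt0// ltr1n prime_gt1.
apply: is_cvgD; first apply: is_cvgD.
- have : (fun n => B n * w n) @ \oo --> 0.
    apply/cvgrPdist_le => ep ep0.
    have ep' : 0 < ep / 13 by rewrite divr_gt0.
    have /cvgrPdist_le/(_ _ ep')[N _ HN] := @cvg_inv_ln R.
    exists (maxn N 1) => // n /=; rewrite geq_max => /andP[Nn n1].
    have := HN n Nn; rewrite /= !sub0r !normrN normrM => h.
    have -> : ep = 13 * (ep / 13) by rewrite mulrCA divff// mulr1.
    by apply: ler_pM => //; exact: HB.
  exact: cvgP.
- exact: ct.
- exact: is_cvgn_shift ce.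
Qed.

Lemma Nln_1sub_bounds (R : realType) (y : R) : 0 <= y <= 2^-1 ->
  0 <= - ln (1 - y) - y <= 2 * y ^+ 2.
Proof.
move=> /andP[y0 y1]; have p : 0 < 1 - y by lra.
have h1 := ln_le_subr1 p; have h2 := ln_ge_1subV p.
apply/andP; split; first by lra.
have -> : 2 * y ^+ 2 = (2 * y) * (1 + y) - 2 * y by ring.
have : (1 - y)^-1 <= 1 + y + 2 * y ^+ 2.
  by rewrite -[leLHS]mul1r ler_pdivrMr//; nra.
nra.
Qed.

Definition mertens_sum (R : realType) (n : nat) : R :=
  \sum_(1 <= p < n.+1 | prime p) - ln (1 - p%:R^-1).

Lemma prime_inv_bounds (R : realType) (p : nat) : prime p -> 0 <= (p%:R : R)^-1 <= 2^-1.
Proof.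
move=> pp; rewrite invr_ge0 ler0n /= lef_pV2 ?posrE ?ltr0n ?prime_gt0//.
by rewrite ler_nat prime_gt1.
Qed.

Lemma mertens_sum_cvg (R : realType) :
  cvgn (fun n => mertens_sum R n - ln (ln n%:R)).
Proof.
pose g m : R := if prime m then - ln (1 - m%:R^-1) - m%:R^-1 else 0.
have cg : cvgn (fun n => \sum_(1 <= m < n) g m).
  apply: (@cvg_sum_powR32 _ _ 2) => m m1; rewrite /g; case: ifP => pm; last first.
    by rewrite normr0 mulr_ge0// powR_ge0.
  have /andP[h1 h2] := Nln_1sub_bounds (prime_inv_bounds R pm).
  rewrite ger0_norm//; apply: (le_trans h2); rewrite ler_wpM2l//.
  exact: sqrV_le_powR32.
have -> : (fun n => mertens_sum R n - ln (ln n%:R)) =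
   (fun n => (\sum_(1 <= p < n.+1 | prime p) p%:R^-1 - ln (ln n%:R)) + \sum_(1 <= m < n.+1) g m).
  apply/funext => n; rewrite /g -big_mkcond /= addrAC -big_split /=; congr (_ - _).
  by apply: eq_bigr => p _; rewrite addrC subrK.
apply: is_cvgD; first exact: prime_recip_cvg.
exact: is_cvgn_shift cg.
Qed.

Lemma euler_gamma_cvg (R : realType) :
  (fun n => \sum_(1 <= i < n.+1) i%:R^-1 - ln n%:R : R) @ \oo --> euler_gamma R.
Proof.
rewrite /euler_gamma; pose g m : R := m%:R^-1 - (ln m%:R - ln m.-1%:R).
have cg : cvgn (fun n => \sum_(1 <= m < n) g m).
  apply: (@cvg_sum_powR32 _ _ 2) => m m1; rewrite /g.
  case: m m1 => [|[|m]]// _.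
    by rewrite /= ln1 [ln 0%:R]ln0// subrr subr0 invr1 normr1 powR1 mulr1; lra.
  have h1 := @ln_succ_sub_ge R m.+1 isT; have h2 := @ln_succ_sub_le R m.+1 isT.
  apply: (@le_trans _ _ (2 * m.+2%:R^-1 ^+ 2)); last by rewrite ler_wpM2l// sqrV_le_powR32.
  have h3 : m.+1%:R^-1 - m.+2%:R^-1 = m.+1%:R^-1 * m.+2%:R^-1 :> R.
    rewrite -[m.+2%:R]natr1; have a0 : 0 < (m.+1%:R : R) by rewrite ltr0n.
    set a := m.+1%:R in a0 *; field; apply/andP; split; apply: lt0r_neq0; lra.
  have h4 : m.+1%:R^-1 * m.+2%:R^-1 <= 2 * m.+2%:R^-1 * m.+2%:R^-1 :> R.
    by rewrite ler_wpM2r ?invr_ge0// invS_le.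
  move: h1 h2 h3 h4; rewrite succnK; set u := _.+2%:R^-1; set v := _.+1%:R^-1 => h1 h2 h3 h4.
  by rewrite ler0_norm; lra.
have -> : (fun n => \sum_(1 <= i < n.+1) i%:R^-1 - ln n%:R : R) =
   (fun n => \sum_(1 <= m < n.+1) g m).
  apply/funext => n; rewrite /g sumrB (sum_telescope_pred (fun m => ln m%:R)) [ln 0%:R]ln0//.
  by rewrite subr0.
exact: is_cvgn_shift cg.
Qed.

(** * Finite Euler products and the zeta function near 1 *)

(** What survives the sieve of Eratosthenes by the primes below P. Sieving one prime at a time
    yields the Euler product without appeal to unique factorisation. *)
Definition rough (P m : nat) : bool := [forall q : 'I_P, prime q ==> ~~ (q %| m)%N].

Lemma roughP (P m : nat) :
  reflect (forall q, (q < P)%N -> prime q -> ~~ (q %| m)%N) (rough P m).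
Proof.
apply: (iffP forallP) => [H q qP pq|H q].
  by have := H (Ordinal qP); rewrite /= pq.
by apply/implyP => pq; apply: H.
Qed.

Lemma roughS (P m : nat) :
  rough P.+1 m = rough P m && (prime P ==> ~~ (P %| m)%N).
Proof.
apply/roughP/andP => [H|[/roughP H1 /implyP H2] q].
  split; first by apply/roughP => q qP; apply: H; rewrite ltnS ltnW.
  by apply/implyP => pP; apply: H.
by rewrite ltnS leq_eqVlt => /orP[/eqP->|]; [exact: H2 | exact: H1].
Qed.

Lemma rough_mul (P m : nat) : prime P -> rough P (P * m) = rough P m.
Proof.
move=> pP; apply/roughP/roughP => H q qP pq; have := H q qP pq; rewrite Euclid_dvdM//.
  by apply: contra => ->; rewrite orbT.
move=> /negbTE->; rewrite orbF dvdn_prime2//.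
by apply/negP => /eqP qe; move: qP; rewrite qe ltnn.
Qed.

Lemma rough_lt (P m : nat) : (0 < m)%N -> (m < P)%N -> rough P m -> m = 1%N.
Proof.
move=> m0 mP /roughP H; apply/eqP; rewrite eqn_leq m0 andbT leqNgt; apply/negP => m1.
have := H (pdiv m); rewrite pdiv_prime// pdiv_dvd /=.
by move=> h; have := h (leq_ltn_trans (pdiv_leq m0) mP) isT.
Qed.

Lemma sum_multiples (R : nmodType) (P n : nat) (g : nat -> R) : (0 < P)%N -> g 0%N = 0 ->
  \sum_(1 <= m < (P * n).+1 | (P %| m)%N) g m = \sum_(1 <= m < n.+1) g (P * m)%N.
Proof.
move=> P0 g0; elim: n => [|n IH]; first by rewrite muln0 !big_geq.
rewrite [RHS]big_nat_recr//= -IH (@big_cat_nat _ _ _ (P * n).+1)//=; last first.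
  by rewrite ltnS leq_mul2l leqnSn orbT.
congr (_ + _); rewrite mulnS big_mkcond big_nat_recr /=; last by lia.
have -> : (P %| P + P * n)%N by rewrite dvdn_addr// dvdn_mulr.
rewrite big_nat big1 ?add0r// => m /andP[m1 m2].
case: ifP => // /dvdnP[c cm]; move: m1 m2; rewrite cm => m1 m2.
have c1 : (n < c)%N by move: m1; rewrite mulnC ltn_pmul2r.
have c2 : (c < n.+1)%N by move: m2; rewrite -mulnS mulnC ltn_pmul2l.
by move: c2; rewrite ltnS leqNgt c1.
Qed.

Lemma powRN_cvg0 (R : realType) (d : R) : 0 < d -> 
  (fun n => n%:R `^ (- d) : R) @ \oo --> 0.
Proof.
move=> d0; apply/cvgrPdist_le => e e0.
have [N HN] := @ln_nat_unbounded R (- ln e / d).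
exists (maxn N 1) => // n /=; rewrite geq_max => /andP[/HN h n1].
rewrite sub0r normrN ger0_norm ?powR_ge0// -[leRHS]lnK ?posrE//.
rewrite /powR gt_eqF ?ltr0n// ler_expR mulNr lerNl.
by rewrite -ler_pdivrMl// mulrC.
Qed.

Section EulerProduct.
Context (R : realType) (d : R) (d0 : 0 < d).

Let f (m : nat) : R := m%:R `^ (- (1 + d)).
Let Z (n : nat) : R := \sum_(1 <= m < n.+1) f m.
Let W (P n : nat) : R := \sum_(1 <= m < n.+1 | rough P m) f m.

Let f_ge0 m : 0 <= f m. Proof. exact: powR_ge0. Qed.

Let fM a b : f (a * b)%N = f a * f b.
Proof. by rewrite /f natrM powRM. Qed.

Let f0 : f 0%N = 0.
Proof. by rewrite /f powR0// oppr_eq0 gt_eqF// addr_gt0. Qed.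

Let W_le_Z P n : W P n <= Z n.
Proof.
rewrite /W /Z big_mkcond; apply: ler_sum => m _.
by case: ifP.
Qed.

Let cvgW P : cvgn (W P).
Proof.
apply: nondecreasing_is_cvgn.
  apply/nondecreasing_seqP => n; rewrite /W [leRHS]big_mkcond big_nat_recr//=.
  by rewrite -big_mkcond lerDl; case: ifP.
exists (1 + d^-1) => _ [n _ <-]; apply: (le_trans (W_le_Z _ _)).
exact: sum_powR_le.
Qed.

Let z P : R := limn (W P).

(** Among the P-rough integers the multiples of a prime P are exactly P m with m P-rough, so
    removing them subtracts f(P) times the same sum. *)
Let z_step P : z P.+1 = z P * (if prime P then 1 - f P else 1).
Proof.
have c1 : W P.+1 @ \oo --> z P.+1 by exact: cvgW.
have c0 : W P @ \oo --> z P by exact: cvgW.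
case: ifP => pP; last first.
  rewrite mulr1 /z; congr (limn _); apply/funext => n; apply: eq_bigl => m.
  by rewrite roughS pP andbT.
have P0 := prime_gt0 pP.
(* Limits are taken along P n, where the multiples of P are the P m with m <= n and no rounding
   occurs. *)
have hphi n : (n <= P * n)%N by rewrite leq_pmull.
have c1' := cvgn_sub hphi c1; have c0' := cvgn_sub hphi c0.
have E n : W P.+1 (P * n)%N = W P (P * n)%N - f P * W P n.
  apply/eqP; rewrite eq_sym subr_eq; apply/eqP.
  rewrite /W (bigID (fun m => (P %| m)%N)) /= addrC; congr (_ + _).
    by apply: eq_bigl => m; rewrite roughS pP.
  rewrite [LHS](eq_bigl (fun m => (P %| m)%N && rough P m)); last by move=> m; rewrite andbC.
  rewrite big_mkcondr /=.
  rewrite (@sum_multiples _ P n (fun m => if rough P m then f m else 0))//; last by rewrite f0 if_same.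
  rewrite -big_mkcond big_distrr /=; apply: eq_big => m; first by rewrite rough_mul.
  by rewrite fM.
have c2 : (fun n => W P.+1 (P * n)%N) @ \oo --> z P - f P * z P.
  rewrite (_ : (fun n => _) = (fun n => W P (P * n)%N - f P * W P n)).
    by apply: cvgB => //; apply: cvgMr.
  by apply/funext => n; rewrite E.
have /= -> := cvg_unique _ c1' c2; first by ring.
exact: Rhausdorff.
Qed.

Let z0E : z 0%N = limn Z.
Proof.
rewrite /z; congr (limn _); apply/funext => n; apply: eq_bigl => m.
by apply/roughP => q.
Qed.

Let cvgZ : Z @ \oo --> z 0%N.
Proof.
have e : W 0%N = Z by apply/funext => n; apply: eq_bigl => m; apply/roughP.
by have := @cvgW 0%N; rewrite e z0E.
Qed.

Let z_ge1 P : 1 <= z P.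
Proof.
apply: (cvgn_ge_lb (N := 1) (cvgW (P := P))) => -[|n]// _.
rewrite /W big_mkcond big_ltn//= ifT; last first.
  by apply/roughP => q _ pq; rewrite dvdn1; apply/eqP => q1; rewrite q1 in pq.
rewrite {1}/f powR1 lerDl; apply: sumr_ge0 => m _; by case: ifP.
Qed.

(** Every m with 1 < m < P+2 has a prime factor below P+2, so apart from m = 1 only the tail of the
    zeta series survives. Hence [z] tends to 1 and the Euler product converges to the full sum. *)
Let z_le P : z P.+2 <= 1 + (z 0%N - Z P.+1).
Proof.
have h : (fun n => 1 + (Z n - Z P.+1)) @ \oo --> 1 + (z 0%N - Z P.+1).
  by apply: cvgD; [exact: cvg_cst | apply: cvgB; [exact: cvgZ | exact: cvg_cst]].
rewrite -subr_ge0.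
have h2 : (fun n => 1 + (Z n - Z P.+1) - W P.+2 n) @ \oo --> 1 + (z 0%N - Z P.+1) - z P.+2.
  by apply: cvgB => //; exact: cvgW.
apply: (cvgn_ge_lb (N := P.+1) h2) => n Pn.
rewrite subr_ge0 /W /Z (@big_cat_nat _ _ _ P.+2)//=.
rewrite [X in _ <= 1 + (X - _)](@big_cat_nat _ _ _ P.+2)//=.
rewrite [X in _ <= 1 + X]addrAC subrr add0r; apply: lerD.
  rewrite big_mkcond big_ltn//= big_nat big1 ?addr0.
    by case: ifP; rewrite // /f powR1.
  move=> m /andP[m1 m2]; case: ifP => // /(rough_lt (ltnW m1) m2) m1'; move: m1.
  by rewrite m1'.
by rewrite big_mkcond; apply: ler_sum => m _; case: ifP.
Qed.

Let z0_le : z 0%N <= 1 + d^-1.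
Proof. by apply: (cvgn_le_ub (N := 0) cvgZ) => n _; exact: sum_powR_le. Qed.

Let z0_ge : d^-1 <= z 0%N.
Proof.
have c : (fun n => 1 - n%:R `^ (- d)) @ \oo --> (1 - 0 : R).
  by apply: cvgB; [exact: cvg_cst | exact: powRN_cvg0].
rewrite subr0 in c.
have : 1 <= d * z 0%N.
  apply: (cvgn_le_ub (N := 1) c) => n n1; apply: (le_trans (sum_powR_ge d0 n1)).
  rewrite ler_pM2l//; apply: (cvgn_ge_lb (N := n) cvgZ) => m nm.
  rewrite /Z [leRHS](@big_cat_nat _ _ _ n)//=; last by rewrite ltnW.
  by rewrite lerDl sumr_ge0.
by rewrite -ler_pdivrMl// mulr1.
Qed.

Lemma euler_product_ln : exists2 L : R,
  (fun n => \sum_(1 <= p < n.+1 | prime p) - ln (1 - p%:R `^ (- (1 + d)))) @ \oo --> L &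
  ln (d^-1) <= L <= ln (1 + d^-1).
Proof.
have zpos P : 0 < z P by apply: lt_le_trans (z_ge1 P).
exists (ln (z 0%N)); last first.
  by rewrite !ler_ln ?posrE ?z0_ge ?z0_le ?zpos// ?invr_gt0// addr_gt0// invr_gt0.
have f1 p : prime p -> 0 < 1 - f p.
  move=> pp; rewrite subr_gt0 /f /powR gt_eqF ?ltr0n ?prime_gt0// expR_lt1.
  by rewrite mulNr oppr_lt0 mulr_gt0 ?addr_gt0// ln_gt0// ltr1n prime_gt1.
have E P : ln (z 0%N) = \sum_(1 <= p < P | prime p) - ln (1 - f p) + ln (z P).
  elim: P => [|P IH]; first by rewrite big_geq ?add0r.
  rewrite z_step big_mkcond; case: P IH => [|P] IH; first by rewrite big_geq//= mulr1 add0r.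
  rewrite big_nat_recr//= -big_mkcond /=; case: ifP => pP; last by rewrite mulr1 addr0.
  by rewrite lnM ?posrE ?f1 ?zpos// IH; ring.
have zc : (fun n => z 0%N - Z n) @ \oo --> 0.
  by rewrite -(subrr (z 0%N)); apply: cvgB; [exact: cvg_cst | exact: cvgZ].
apply/cvgrPdist_le => e e0.
have /cvgrPdist_le/(_ _ e0)[N _ HN] := zc.
exists N.+1 => // n /= Nn.
rewrite (E n.+1) addrAC subrr add0r ger0_norm; last by rewrite ln_ge0.
apply: (le_trans (ln_le_subr1 (zpos _))).
case: n Nn => // n Nn; apply: (@le_trans _ _ (z 0%N - Z n.+1)); first by have := z_le n; lra.
have := HN n.+1 (ltnW Nn); rewrite /= sub0r normrN => h; apply: le_trans h; exact: ler_norm.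
Qed.

End EulerProduct.

(** * Mertens' third theorem *)

(** A quantitative form of Abel's theorem. Summation by parts writes the left side as an average of
    c(k) - l with weights x^k - x^(k+1) and a last weight x^N, of total 1; each of the k0 early
    weights is at most 1 - x. *)
Lemma abel_sum_le (R : realType) (c : nat -> R) (l M ep x : R) (k0 N : nat) :
  0 < x < 1 -> (forall k, `|c k - l| <= M) -> (forall k, (k0 <= k)%N -> `|c k - l| <= ep) ->
  (k0 <= N)%N ->
  `|c 0%N + \sum_(1 <= j < N.+1) (c j - c j.-1) * x ^+ j - l| <= M * k0%:R * (1 - x) + ep.
Proof.
move=> /andP[x0 x1] hM he k0N.
have xk k : 0 <= x ^+ k - x ^+ k.+1.
  by rewrite exprS -[X in X - _]mul1r -mulrBl mulr_ge0 ?exprn_ge0 ?subr_ge0// ltW.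
have xk1 k : x ^+ k - x ^+ k.+1 <= 1 - x.
  by rewrite exprS -[X in X - _]mul1r -mulrBl ler_piMr ?subr_ge0 ?exprn_ile1// ltW.
have -> : c 0%N + \sum_(1 <= j < N.+1) (c j - c j.-1) * x ^+ j - l =
    \sum_(0 <= k < N) (c k - l) * (x ^+ k - x ^+ k.+1) + (c N - l) * x ^+ N.
  elim: {k0N} N => [|N IH]; first by rewrite !big_geq// !addr0 add0r expr0 mulr1.
  rewrite [in LHS]big_nat_recr//= [in RHS]big_nat_recr//=.
  rewrite (_ : c 0%N + _ - l = (c 0%N + \sum_(1 <= j < N.+1) (c j - c j.-1) * x ^+ j - l)
    + (c N.+1 - c N) * x ^+ N.+1); last by ring.
  by rewrite IH exprS; ring.
rewrite (@big_cat_nat _ _ _ k0)//=.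
have h1 : `|\sum_(0 <= i < k0) (c i - l) * (x ^+ i - x ^+ i.+1)| <= M * k0%:R * (1 - x).
  apply: (le_trans (ler_norm_sum _ _ _)).
  apply: (@le_trans _ _ (\sum_(0 <= i < k0) M * (1 - x))).
    apply: ler_sum => i _; rewrite normrM; apply: ler_pM => //.
    by rewrite ger0_norm.
  by rewrite sumr_const_nat subn0 -[leLHS]mulr_natr mulrAC.
have h2 : `|\sum_(k0 <= i < N) (c i - l) * (x ^+ i - x ^+ i.+1)| <= ep * (x ^+ k0 - x ^+ N).
  apply: (le_trans (ler_norm_sum _ _ _)).
  apply: (@le_trans _ _ (\sum_(k0 <= i < N) ep * (x ^+ i - x ^+ i.+1))).
    apply: ler_sum_nat => i /andP[ki _]; rewrite normrM; apply: ler_pM => //.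
      exact: he.
    by rewrite ger0_norm.
  rewrite -big_distrr /= (_ : \sum_(k0 <= i < N) _ = x ^+ k0 - x ^+ N)//.
  rewrite (eq_bigr (fun i => - x ^+ i.+1 - (- x ^+ i))); last by move=> i _; ring.
  by rewrite (@telescope_sumr _ _ _ (fun i => - x ^+ i))//; ring.
have h3 : `|(c N - l) * x ^+ N| <= ep * x ^+ N.
  have xN : 0 <= x ^+ N by rewrite exprn_ge0// ltW.
  by rewrite normrM (ger0_norm xN); apply: ler_wpM2r => //; exact: he.
have ep0 : 0 <= ep by apply: le_trans (he k0 _).
have h4 : ep * x ^+ k0 <= ep by rewrite ler_piMr// exprn_ile1// ltW.
apply: (le_trans (ler_normD _ _)); apply: (le_trans (lerD (ler_normD _ _) (lexx _))).
move: h1 h2 h3 h4; lra.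
Qed.

(** The primes in (2^(j-1), 2^j] are those with [up_log 2 p = j]. *)
Lemma mertens_sum_pow2 (R : realType) (x : R) (N : nat) :
  \sum_(1 <= j < N.+1) (mertens_sum R (2 ^ j) - mertens_sum R (2 ^ j.-1)) * x ^+ j =
  \sum_(1 <= p < (2 ^ N).+1 | prime p) - ln (1 - p%:R^-1) * x ^+ up_log 2 p.
Proof.
elim: N => [|N IH].
  by rewrite big_geq// expn0 big_ltn_cond//= big_geq.
rewrite big_nat_recr//= IH.
have le2 : ((2 ^ N).+1 <= (2 ^ N.+1).+1)%N by rewrite ltnS leq_exp2l.
rewrite [RHS](@big_cat_nat _ _ _ (2 ^ N).+1)//=; congr (_ + _).
rewrite /mertens_sum (@big_cat_nat _ _ _ (2 ^ N).+1 1 (2 ^ N.+1).+1)//=.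
rewrite addrAC subrr add0r big_distrl /= big_nat_cond [RHS]big_nat_cond.
apply: eq_bigr => p /andP[/andP[p1 p2] pp]; congr (_ * _ ^+ _).
by rewrite (@up_log_eq 2 N p)// p1 -ltnS.
Qed.

(** Both expressions equal t y to first order and agree at t = 1, which explains the two factors of
    the bound. It is applied with y = 1/p and t = p^(-d). *)
Lemma ln_1sub_mul_bounds (R : realType) (y t : R) : 0 <= y <= 2^-1 -> 0 <= t <= 1 ->
  `|- ln (1 - y) * t - (- ln (1 - t * y))| <= (1 - t) * (2 * y ^+ 2).
Proof.
move=> /andP[y0 y1] /andP[t0 t1].
have ty : 0 <= t * y <= y by rewrite mulr_ge0// ler_piMl.
move: ty => /andP[ty0 ty1].
have p : 0 < 1 - y by lra.
have q : 0 < 1 - t * y by lra.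
have E : - ln (1 - y) * t - (- ln (1 - t * y)) =
   ln ((1 - t * y) / (1 - y)) + (1 - t) * ln (1 - y).
  by rewrite ln_div ?posrE//; ring.
have rp : 0 < (1 - t * y) / (1 - y) by rewrite divr_gt0.
have u1 := ln_le_subr1 rp; have u2 := ln_ge_1subV rp.
have e1 : (1 - t * y) / (1 - y) - 1 = (1 - t) * (y / (1 - y)) by field; rewrite gt_eqF.
have e2 : 1 - ((1 - t * y) / (1 - y))^-1 = (1 - t) * (y / (1 - t * y)).
  by rewrite invf_div; field; rewrite gt_eqF.
have l1 := ln_le_subr1 p; have l2 := ln_ge_1subV p.
have t1' : 0 <= 1 - t by lra.
have a1 : y / (1 - y) <= y + 2 * y ^+ 2.
  by rewrite ler_pdivrMr//; nra.
have a2 : y <= y / (1 - t * y) by rewrite ler_pdivlMr//; nra.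
have a3 : 1 - (1 - y)^-1 = - (y / (1 - y)) by field; rewrite gt_eqF.
have m1 := ler_wpM2l t1' l1; have m2 := ler_wpM2l t1' l2.
have m3 := ler_wpM2l t1' a1; have m4 := ler_wpM2l t1' a2.
rewrite a3 in m2; rewrite e1 in u1; rewrite e2 in u2.
rewrite E; move: u1 u2 m1 m2 m3 m4.
move: (ln ((1 - t * y) / (1 - y))) (ln (1 - y)) (y / (1 - y)) (y / (1 - t * y)) => A B C D.
by move=> *; rewrite ler_norml; apply/andP; split; lra.
Qed.

Lemma le_of_le_addM (R : realFieldType) (a b K : R) : 0 <= K ->
  (forall h, 0 < h <= 1 -> a <= b + K * h) -> a <= b.
Proof.
move=> K0 H; rewrite leNgt; apply/negP => ba.
have K1 : 0 < K + 1 by lra.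
pose h := Num.min 1 ((a - b) / (2 * (K + 1))).
have h0 : 0 < h by rewrite lt_min ltr01 divr_gt0 ?mulr_gt0// subr_gt0.
have h1 : h <= 1 by rewrite ge_min lexx.
have h2 : h <= (a - b) / (2 * (K + 1)) by rewrite ge_min lexx orbT.
have := H h; rewrite h0 h1 => /(_ isT).
move: h2; rewrite ler_pdivlMr ?mulr_gt0// => h2; nra.
Qed.

Section AbelBound.
Context (R : realType) (h : R) (h01 : 0 < h <= 1).

(** The square makes d ln (1 + 1/d) = O(h), by ln y <= 2 sqrt y, so all errors become linear in
    h. *)
Let d := h ^+ 2.
(** With this choice x^j is the value of t^(-d) at t = 2^j, which ties Abel means over dyadic blocks
    to the zeta function at 1 + d. *)
Let x : R := 2 `^ (- d).

Let d01 : 0 < d <= 1.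
Proof.
by move: h01 => /andP[h0 h1]; rewrite exprn_gt0// exprn_ile1// ltW.
Qed.

Let x01 : 0 < x < 1.
Proof.
have /andP[d0 _] := d01.
rewrite powR_gt0//= /x /powR gt_eqF// expR_lt1 mulNr oppr_lt0 mulr_gt0// ln_gt0//; lra.
Qed.

Let onesubx : 1 - x <= d.
Proof.
have /andP[d0 _] := d01.
rewrite /x /powR gt_eqF// lerBlDr -lerBlDl; apply: le_trans (expR_ge1Dx _).
by rewrite mulNr lerD2l lerN2 ler_piMr ?ln2_le1// ltW.
Qed.

(** Since p lies between 2^(j-1) and 2^j for j = [up_log 2 p], replacing x^j by p^(-d) has relative
    error at most 1 - x <= d. Moving p^(-d) inside the logarithm costs O(d ln p / p^2). In total the
    error is at most 2 d L + 12 d, hence at most 8 h + 12 h. *)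
Lemma prime_sum_twist (L : R) (N : nat) :
  (fun n => \sum_(1 <= p < n.+1 | prime p) - ln (1 - p%:R `^ (- (1 + d)))) @ \oo --> L ->
  L <= ln (1 + d^-1) ->
  `|\sum_(1 <= p < (2 ^ N).+1 | prime p) - ln (1 - p%:R^-1) * x ^+ up_log 2 p -
    \sum_(1 <= p < (2 ^ N).+1 | prime p) - ln (1 - p%:R `^ (- (1 + d)))| <= 20 * h.
Proof.
move=> hL Lle; have /andP[d0 d1] := d01; have /andP[x0 x1] := x01.
have /andP[h0 h1] := h01.
pose e (p : nat) : R := - ln (1 - p%:R `^ (- (1 + d))).
have powE p : prime p -> p%:R `^ (- (1 + d)) = p%:R `^ (- d) * p%:R^-1 :> R.
  move=> pp; rewrite opprD powRD; last by apply/implyP => _; rewrite pnatr_eq0 -lt0n prime_gt0.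
  by rewrite powR_inv1 ?ler0n// mulrC.
have t01 p : prime p -> 0 <= (p%:R : R) `^ (- d) <= 1.
  move=> pp; rewrite powR_ge0 /= /powR gt_eqF ?ltr0n ?prime_gt0// expR_le1.
  by rewrite mulNr oppr_le0 mulr_ge0 ?ln_nat_ge0// ltW.
have e_ge p : prime p -> p%:R `^ (- d) * p%:R^-1 <= e p.
  move=> pp; rewrite /e powE//; have /andP[t0 t1] := t01 p pp.
  have /andP[y0 y1] := prime_inv_bounds R pp.
  have hy : 0 <= p%:R `^ (- d) * p%:R^-1 <= 2^-1.
    by rewrite mulr_ge0//= (le_trans _ y1)// ler_piMl.
  by have /andP[+ _] := Nln_1sub_bounds hy; lra.
have e_ge0 p : prime p -> 0 <= e p.
  move=> pp; apply: le_trans (e_ge p pp); rewrite mulr_ge0 ?powR_ge0 ?invr_ge0//.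
have EL n : \sum_(1 <= p < n.+1 | prime p) e p <= L.
  apply: (cvgn_ge_lb (N := n) hL) => m nm.
  rewrite [leRHS](@big_cat_nat _ _ _ n.+1)//= lerDl; apply: sumr_ge0 => p pp; exact: e_ge0.
have term p : prime p -> `|- ln (1 - p%:R^-1) * x ^+ up_log 2 p - e p| <=
    2 * d * e p + 4 * d * p%:R `^ (- (3 / 2)).
  move=> pp; have p0 := prime_gt0 pp; have p1 := prime_gt1 pp.
  have pR : 0 < p%:R :> R by rewrite ltr0n.
  have yb := prime_inv_bounds R pp; have tb := t01 p pp.
  set a := - ln (1 - p%:R^-1).
  have /andP[a1 a2] := Nln_1sub_bounds yb.
  have a0 : 0 <= a by move: a1 yb => + /andP[+ _]; rewrite -/a; lra.
  have a3 : a <= 2 * p%:R^-1.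
    by move: a2 yb; rewrite -/a => a2 /andP[y0 y1]; nra.
  have A : `|a * p%:R `^ (- d) - e p| <= 4 * d * p%:R `^ (- (3 / 2)).
    rewrite /e powE//; apply: (le_trans (ln_1sub_mul_bounds yb tb)).
    have h2 : 1 - p%:R `^ (- d) <= d * ln p%:R.
      rewrite /powR gt_eqF// lerBlDr -lerBlDl; apply: le_trans (expR_ge1Dx _).
      by rewrite mulNr.
    have h3 := @ln_sqrV_le_powR32 R _ p0.
    apply: (@le_trans _ _ (d * ln p%:R * (2 * p%:R^-1 ^+ 2))).
      by apply: ler_wpM2r => //; rewrite mulr_ge0 ?exprn_ge0 ?invr_ge0.
    have := ler_wpM2l (ltW d0) h3; move: (p%:R^-1 ^+ 2) (ln p%:R) (p%:R `^ _) => u v w; lra.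
  have /andP[ul1 ul2] := @up_log_bounds 2 p isT p1.
  have ulpos : (0 < up_log 2 p)%N by rewrite up_log_gt0.
  have xu : x ^+ up_log 2 p = ((2 ^ up_log 2 p)%N%:R) `^ (- d).
    by rewrite /x -powR_mulrn ?powR_ge0// -powRrM mulrC powRrM powR_mulrn// natrX.
  have dN : - d <= 0 by lra.
  have anti u v : 0 < u -> u <= v -> v `^ (- d) <= u `^ (- d) :> R.
    move=> u0 uv; rewrite !powRN lef_pV2 ?posrE ?powR_gt0 ?(lt_le_trans u0)//.
    by apply: ge0_ler_powR => //; rewrite ?nnegrE ?ltW// (lt_le_trans u0).
  have B1 : x ^+ up_log 2 p <= p%:R `^ (- d).
    by rewrite xu; apply: anti => //; rewrite ler_nat.
  have B2 : x * p%:R `^ (- d) <= x ^+ up_log 2 p.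
    rewrite xu /x -powRM//; apply: anti; first by rewrite ltr0n expn_gt0.
    rewrite -natrM ler_nat; move: ul1; case: (up_log 2 p) ulpos => // k _ /= ul1.
    by rewrite expnS leq_mul2l /= ltnW.
  have B : `|a * x ^+ up_log 2 p - a * p%:R `^ (- d)| <= 2 * d * e p.
    rewrite -mulrBr normrM (ger0_norm a0) ler0_norm ?subr_le0// opprB.
    have b3 : p%:R `^ (- d) - x ^+ up_log 2 p <= d * p%:R `^ (- d).
      have := ler_wpM2r (powR_ge0 p%:R (- d)) onesubx; lra.
    apply: (@le_trans _ _ (2 * p%:R^-1 * (d * p%:R `^ (- d)))).
      by apply: ler_pM => //; rewrite subr_ge0.
    by have := ler_wpM2l (ltW d0) (e_ge p pp); lra.
  rewrite (_ : a * _ - e p = (a * x ^+ up_log 2 p - a * p%:R `^ (- d)) + (a * p%:R `^ (- d) - e p)); last by ring.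
  by apply: (le_trans (ler_normD _ _)); exact: lerD.
rewrite -sumrB; apply: (le_trans (ler_norm_sum _ _ _)).
apply: (le_trans (ler_sum _ term)).
rewrite big_split /= -!big_distrr /=.
have s1 := EL (2 ^ N)%N.
have s2 : \sum_(1 <= p < (2 ^ N).+1 | prime p) p%:R `^ (- (3 / 2)) <= 3 :> R.
  apply: le_trans (sum_powR32 R (2 ^ N).+1); rewrite [leLHS]big_mkcond /=.
  by apply: ler_sum => p _; case: ifP => // _; exact: powR_ge0.
have dL : d * L <= 4 * h.
  apply: (@le_trans _ _ (d * (2 * (2 * h^-1)))).
    apply: ler_wpM2l; first exact: ltW.
    apply: (le_trans Lle); apply: (le_trans (ln_le_sqrt _)); first by rewrite addr_gt0 ?invr_gt0.
    apply: ler_wpM2l => //.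
    have hi0 : 0 <= 2 * h^-1 by rewrite mulr_ge0 ?invr_ge0 ?ltW.
    rewrite -[leRHS]ger0_norm// -sqrtr_sqr; apply: ler_wsqrtr.
    rewrite exprMn exprVn -/d.
    have : 1 <= d^-1 by rewrite invr_ge1 // unitfE gt_eqF.
    lra.
  by rewrite /d expr2 (_ : _ * _ * _ = 4 * h * (h / h)); [rewrite divff ?gt_eqF ?mulr1 | ring].
have dh : d <= h by rewrite /d expr2 ler_piMl// ltW.
have := ler_wpM2l (ltW d0) s1; have := ler_wpM2l (ltW d0) s2.
by move: dL dh; rewrite /e; move: (\sum_(_ <= _ < _ | _) _) (\sum_(_ <= _ < _ | _) _) => u v; lra.
Qed.

Lemma neg_ln_series_cvg : (fun N => \sum_(1 <= j < N.+1) x ^+ j / j%:R) @ \oo --> - ln (1 - x).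
Proof.
have /andP[x0 x1] := x01.
have ax : `|x| = x by rewrite ger0_norm// ltW.
have hx : `|x| < 1 by rewrite ax.
have g : (fun n => x ^+ n) @ \oo --> 0 by exact: cvg_expr.
apply/cvgrPdist_le => e e0.
have e1 : 0 < e * (1 - x) by rewrite mulr_gt0// subr_gt0.
have /cvgrPdist_le/(_ _ e1)[N _ HN] := g.
exists N => // n /= Nn; apply: (le_trans (ln_series n hx)); rewrite ax.
rewrite ler_pdivrMr ?subr_gt0//.
have := HN n.+1 (leqW Nn); rewrite /= sub0r normrN ger0_norm// exprn_ge0// ltW//.
Qed.

(** Here exp L plays the role of zeta(1+d), close to 1/d, while 1 - x is close to d ln 2; the two
    singularities cancel. *)
Lemma ln_zeta_near_pole (L : R) : ln (d^-1) <= L <= ln (1 + d^-1) ->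
  `|L + ln (1 - x) - ln (ln 2)| <= h.
Proof.
have /andP[d0 d1] := d01; have /andP[x0 x1] := x01; have /andP[h0 h1] := h01.
move=> /andP[L1 L2].
have l0 : 0 < ln (2 : R) by apply: lt_le_trans (ln2_ge R).
have l1 := ln2_le1 R.
set w := d * ln 2.
have w0 : 0 < w by rewrite mulr_gt0.
have wd : w <= d by rewrite ler_piMr// ltW.
have xE : x = expR (- w) by rewrite /x /powR gt_eqF// mulNr.
have u : 1 - x <= w by rewrite xE; have := expR_ge1Dx (- w); lra.
have lo : w / (1 + w) <= 1 - x.
  have w1 : 0 < 1 + w by rewrite addr_gt0.
  have : x <= (1 + w)^-1.
    by rewrite xE expRN lef_pV2 ?posrE ?expR_gt0// expR_ge1Dx.
  have : w / (1 + w) = 1 - (1 + w)^-1 by field; rewrite gt_eqF.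
  lra.
have x1' : 0 < 1 - x by rewrite subr_gt0.
have s1 : ln (1 - x) <= ln d + ln (ln 2) by rewrite -lnM ?posrE// ler_ln ?posrE.
have s2 : ln d + ln (ln 2) - ln (1 + w) <= ln (1 - x).
  rewrite -lnM ?posrE// -ln_div ?posrE ?addr_gt0// ler_ln ?posrE// divr_gt0// addr_gt0//.
have s3 : ln (1 + w) <= w by apply: le_ln1Dx; lra.
have s4 : ln (1 + d^-1) = ln (1 + d) - ln d.
  rewrite -ln_div ?posrE ?addr_gt0//; congr ln.
  by rewrite mulrDl divff ?gt_eqF// mul1r addrC.
have s5 : ln (1 + d) <= d by apply: le_ln1Dx; lra.
have s6 : ln d^-1 = - ln d by rewrite lnV ?posrE.
have dh : d <= h by rewrite /d expr2 ler_piMl// ltW.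
by rewrite ler_norml; apply/andP; split; lra.
Qed.

End AbelBound.

(** The sequence [c] is the sampled Mertens sum minus the harmonic number, so it tends to L + ln ln
    2 - gamma, with L the unknown limit. Its Abel mean at x = 2^(-d) is, up to O(h), ln zeta(1+d) +
    ln (1 - x), which tends to ln ln 2. By Abel's theorem the two limits agree, so L = gamma. *)
Lemma mertens3 (R : realType) :
  (fun n => mertens_sum R n - ln (ln n%:R)) @ \oo --> euler_gamma R.
Proof.
have /cvg_ex[L hL] := @mertens_sum_cvg R.
suff -> : euler_gamma R = L by [].
pose c (k : nat) : R := mertens_sum R (2 ^ k) - \sum_(1 <= i < k.+1) i%:R^-1.
pose l := L + ln (ln 2) - euler_gamma R.
have l0 : 0 < ln (2 : R) by apply: lt_le_trans (ln2_ge R).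
have hc : c @ \oo --> l.
  have hphi n : (n <= 2 ^ n)%N by rewrite ltnW// ltn_expl.
  have h1 := cvgn_sub hphi hL; have h2 := @euler_gamma_cvg R.
  have h3 : (fun n => (mertens_sum R (2 ^ n) - ln (ln (2 ^ n)%:R)) + ln (ln 2)
     - (\sum_(1 <= i < n.+1) i%:R^-1 - ln n%:R)) @ \oo --> l.
    by apply: cvgB => //; apply: cvgD => //; exact: cvg_cst.
  (* The shift avoids n = 0, where ln ln 2^n = ln n + ln ln 2 fails. *)
  rewrite -cvg_shiftS; rewrite -cvg_shiftS in h3.
  apply: cvg_trans h3; apply: near_eq_cvg; near=> n.
  rewrite /= /c natrX lnXn// -[ln 2 *+ _]mulr_natr lnM ?posrE ?ltr0n//; ring.
have c0 : c 0%N = 0.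
  by rewrite /c /mertens_sum expn0 big_ltn_cond//= !big_geq// subrr.
have [M hM] : exists M, forall k, `|c k - l| <= M.
  have hb : (fun k => c k - l) @ \oo --> l - l by apply: cvgB => //; exact: cvg_cst.
  have /cvg_seq_bounded/pinfty_ex_gt0[M _ HM] := cvgP _ hb.
  by exists M => k; exact: HM.
have M0 : 0 <= M by apply: le_trans (hM 0%N).
have cdiff j : (0 < j)%N -> c j - c j.-1 =
    (mertens_sum R (2 ^ j) - mertens_sum R (2 ^ j.-1)) - j%:R^-1.
  by case: j => // j _; rewrite /c /= big_nat_recr//=; ring.
have key ep : 0 < ep -> `|ln (ln 2) - l| <= ep.
  move=> ep0; have /cvgrPdist_le/(_ _ ep0)[k0 _ Hk0] := hc.
  have he k : (k0 <= k)%N -> `|c k - l| <= ep by move=> /Hk0 /=; rewrite distrC.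
  apply: (@le_of_le_addM _ _ _ (M * k0%:R + 21)); first by rewrite addr_ge0// mulr_ge0.
  move=> h h01; have /andP[h0 h1] := h01.
  have d0 : 0 < h ^+ 2 by rewrite exprn_gt0.
  have [E hE Eb] := euler_product_ln d0.
  pose x : R := 2 `^ (- h ^+ 2).
  have dh : h ^+ 2 <= h by rewrite expr2 ler_piMl// ltW.
  have x01 : 0 < x < 1.
    rewrite powR_gt0//= /x /powR gt_eqF// expR_lt1 mulNr oppr_lt0 mulr_gt0//.
  have x1h : 1 - x <= h.
    apply: le_trans dh.
    rewrite /x /powR gt_eqF// lerBlDr -lerBlDl; apply: le_trans (expR_ge1Dx _).
    by rewrite mulNr lerD2l lerN2 ler_piMr ?ln2_le1// ltW.
  have /andP[_ E2] := Eb.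
  have near_pole := ln_zeta_near_pole h01 Eb.
  have hS := neg_ln_series_cvg h01.
  have hphi n : (n <= 2 ^ n)%N by rewrite ltnW// ltn_expl.
  have hE' := cvgn_sub hphi hE.
  have hD : (fun N => \sum_(1 <= p < (2 ^ N).+1 | prime p) - ln (1 - p%:R `^ (- (1 + h ^+ 2))) -
      \sum_(1 <= j < N.+1) x ^+ j / j%:R) @ \oo --> E - (- ln (1 - x)).
    by apply: cvgB.
  have B : `|E - (- ln (1 - x)) - l| <= (M * k0%:R * (1 - x) + ep) + 20 * h.
    apply: (cvgn_dist_le (N := k0) hD) => N k0N.
    have ab := abel_sum_le x01 hM he k0N.
    have tw := prime_sum_twist h01 N hE E2.
    rewrite c0 add0r in ab.
    have EQ : \sum_(1 <= j < N.+1) (c j - c j.-1) * x ^+ j =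
      \sum_(1 <= p < (2 ^ N).+1 | prime p) - ln (1 - p%:R^-1) * x ^+ up_log 2 p -
      \sum_(1 <= j < N.+1) x ^+ j / j%:R.
      rewrite -mertens_sum_pow2 -sumrB; apply: eq_big_nat => j /andP[j1 _].
      by rewrite cdiff// mulrBl [j%:R^-1 * _]mulrC.
    move: ab tw; rewrite EQ -/x.
    move: (\sum_(1 <= p < (2 ^ N).+1 | prime p) _) => U.
    move: (\sum_(1 <= p < (2 ^ N).+1 | prime p) _) => V.
    move: (\sum_(1 <= j < N.+1) _) => S ab tw.
    rewrite (_ : V - S - l = (U - S - l) - (U - V)); last by ring.
    by apply: (le_trans (ler_normB _ _)); exact: lerD.
  rewrite (_ : ln (ln 2) - l = (E - (- ln (1 - x)) - l) - (E + ln (1 - x) - ln (ln 2))); last by ring.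
  apply: (le_trans (ler_normB _ _)).
  have Mk : M * k0%:R * (1 - x) <= M * k0%:R * h by apply: ler_wpM2l => //; rewrite mulr_ge0.
  by move: B near_pole Mk; rewrite -/x; lra.
have : `|ln (ln 2) - l| <= 0 by apply/ler_addgt0Pr => e e0; rewrite add0r; exact: key.
rewrite normr_le0 subr_eq0 => /eqP; rewrite /l; lra.
Unshelve. all: by end_near.
Qed.

(** * Periodic functions and Legendre symbols *)

Lemma crt_sum (R : comPzRingType) (a b : nat) (u v : nat -> R) :
  coprime a b -> (0 < a)%N -> (0 < b)%N ->
  (forall d, u d = u (d %% a)%N) -> (forall d, v d = v (d %% b)%N) ->
  \sum_(i < a * b) u i * v i = (\sum_(i < a) u i) * (\sum_(i < b) v i).
Proof.
move=> ab a0 b0 hu hv.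
rewrite big_distrlr /= pair_big /=.
pose h (d : 'I_(a * b)) := (Ordinal (ltn_pmod d a0), Ordinal (ltn_pmod d b0)).
have hinj : injective h.
  move=> x y [hx hy]; apply/val_inj => /=.
  have : (x == y %[mod a * b]) by rewrite chinese_remainder// hx hy !eqxx.
  by rewrite !modn_small// => /eqP.
have hbij : bijective h by apply: inj_card_bij => //; rewrite card_prod !card_ord.
rewrite [RHS](reindex h) /=; last exact: onW_bij.
by apply: eq_bigr => i _; rewrite -hu -hv.
Qed.

Lemma coprime_prodr (s : seq nat) (per : nat -> nat) (a : nat) :
  (forall p, p \in s -> coprime a (per p)) -> coprime a (\prod_(p <- s) per p).
Proof.
elim: s => [|q s IH] H; first by rewrite big_nil coprimen1.
rewrite big_cons coprimeMr H ?mem_head//= IH// => p ps.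
by apply: H; rewrite in_cons ps orbT.
Qed.

Lemma crt_prod (R : comPzRingType) (s : seq nat) (per : nat -> nat) (u : nat -> nat -> R) :
  uniq s -> (forall p, (0 < per p)%N) ->
  (forall p q, p \in s -> q \in s -> p != q -> coprime (per p) (per q)) ->
  (forall p d, u p d = u p (d %% per p)%N) ->
  \sum_(i < \prod_(p <- s) per p) \prod_(p <- s) u p i = \prod_(p <- s) \sum_(i < per p) u p i.
Proof.
move=> us per0 cop hu; elim: s us cop => [|q s IH].
  move=> _ _; rewrite !big_nil big_ord_recl big_ord0 big_nil addr0//.
rewrite [uniq _]/= => /andP[qs us] cop.
rewrite !big_cons -IH//; last first.
  by move=> p r ps rs; apply: cop; rewrite in_cons ?ps ?rs orbT.
rewrite -(@crt_sum _ _ _ (u q) (fun i => \prod_(p <- s) u p i))//.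
- by apply: eq_bigr => i _; rewrite big_cons.
- apply: coprime_prodr => p ps; apply: cop; rewrite ?mem_head ?in_cons ?ps ?orbT//.
  by apply: contraNneq qs => ->.
- exact: prodn_gt0.
- move=> d; rewrite [LHS]big_seq [RHS]big_seq; apply: eq_bigr => p ps.
  rewrite [LHS]hu [RHS]hu modn_dvdm//.
  by rewrite (big_rem p ps) /= dvdn_mulr.
Qed.

Lemma periodic_sum (R : realFieldType) (Q z : nat) (F : nat -> R) :
  (0 < Q)%N -> (forall d, F d = F (d %% Q)%N) -> (forall d, `|F d| <= 1) ->
  `|\sum_(0 <= d < z) F d - z%:R * ((\sum_(d < Q) F d) / Q%:R)| <= (2 * Q)%:R.
Proof.
move=> Q0 hF F1; set S := \sum_(d < Q) F d.
have QR : 0 < Q%:R :> R by rewrite ltr0n.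
have SE a : \sum_(0 <= d < a * Q) F d = a%:R * S.
  elim: a => [|a IH]; first by rewrite big_geq// mul0r.
  rewrite (@big_cat_nat _ _ _ (a * Q))//=; last by rewrite leq_mul2r leqnSn orbT.
  rewrite IH mulSn -natr1 mulrDl mul1r; congr (_ + _).
  rewrite -{1}[(a * Q)%N]add0n big_addn addnK big_mkord; apply: eq_bigr => i _.
  by rewrite hF addnC modnMDl modn_small.
have S1 : `|S| <= Q%:R.
  apply: (le_trans (ler_norm_sum _ _ _)).
  apply: (@le_trans _ _ (\sum_(i < Q) 1)); first by apply: ler_sum.
  by rewrite sumr_const card_ord.
have zE := divn_eq z Q.
rewrite {1}zE (@big_cat_nat _ _ _ (z %/ Q * Q))//=; last by rewrite leq_addr.
rewrite SE.
have zR : z%:R = (z %/ Q)%:R * Q%:R + (z %% Q)%:R :> R by rewrite {1}zE natrD natrM.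
have e : z%:R * (S / Q%:R) = (z %/ Q)%:R * S + (z %% Q)%:R * (S / Q%:R).
  by rewrite zR mulrDl; congr (_ + _); rewrite -mulrA [Q%:R * _]mulrC divfK ?gt_eqF.
rewrite e opprD addrACA subrr add0r.
apply: (le_trans (ler_normB _ _)); rewrite mulSn mul1n natrD.
have rQ : (z %% Q)%:R <= Q%:R :> R by rewrite ler_nat ltnW// ltn_pmod.
apply: lerD; last first.
  rewrite normrM [ `|_%:R|]ger0_norm// normrM normfV [ `|Q%:R|]ger0_norm// -[leRHS]mulr1.
  by apply: ler_pM => //; rewrite ?divr_ge0// ler_pdivrMr// mul1r.
apply: (le_trans (ler_norm_sum _ _ _)).
apply: (@le_trans _ _ (\sum_(z %/ Q * Q <= i < z %/ Q * Q + z %% Q) 1)); first by apply: ler_sum.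
by rewrite sumr_const_nat addKn.
Qed.

(** The restriction to odd d discards d = 0, which every l divides. *)
Lemma count_multiples_le (R : realFieldType) (l z : nat) : (0 < l)%N ->
  \sum_(0 <= d < z | odd d) ((l %| d)%N : nat)%:R <= z%:R / l%:R :> R.
Proof.
move=> l0; have lR : 0 < l%:R :> R by rewrite ltr0n.
case: z => [|z]; first by rewrite big_geq// mul0r.
rewrite big_mkcond big_ltn//= add0r.
apply: (@le_trans _ _ (z %/ l)%:R); last first.
  by rewrite ler_pdivlMr// -natrM ler_nat (leq_trans (leq_trunc_div _ _)).
rewrite divn_count_dvd natr_sum; apply: ler_sum => i _.
by case: ifP.
Qed.

Definition legendre (u p : nat) : int := kronecker_prime u%:Z p.

Lemma chi_8d_primeX (d p m : nat) : prime p -> (0 < m)%N ->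
  chi_8d d (p ^ m)%N%:Z = legendre (8 * d) p ^+ m.
Proof.
move=> pp m0; have p0 := prime_gt0 pp.
rewrite /chi_8d /kronecker eqz_nat gtn_eqF ?expn_gt0 ?p0//.
have -> : (((p ^ m)%N : int) < 0) = false by [].
rewrite /= mul1r primesX// primes_prime// big_seq1 pfactorK//.
Qed.

Lemma legendre2 (d : nat) : legendre (8 * d) 2 = 0.
Proof. by rewrite /legendre /kronecker_prime dvdzE /= ifT// dvdn_mulr. Qed.

Lemma legendreE (u p : nat) : prime p -> odd p -> legendre u p =
  if (p %| u)%N then 0 else
  if [exists x : 'I_p, (x ^ 2 == u %[mod p])%N] then 1 else -1.
Proof.
move=> pp op; rewrite /legendre /kronecker_prime dvdzE /=.
case: ifP => // _; have -> : (p == 2)%N = false by apply: contraTF op => /eqP->.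
congr (if _ then _ else _); apply: eq_existsb => x.
by rewrite -[x%:Z ^+ 2]/((x%:Z * x%:Z)) -PoszM !modz_nat eqz_nat mulnn.
Qed.

Lemma legendre_mod (u p : nat) : prime p -> odd p -> legendre u p = legendre (u %% p) p.
Proof.
by move=> pp op; rewrite !legendreE// /dvdn modn_mod.
Qed.

Lemma sqr_mod_eq (p x y : nat) : prime p -> (x < p)%N -> (y < p)%N ->
  (x ^ 2 == y ^ 2 %[mod p])%N = (x == y) || ((x + y)%N == p) || ((x + y)%N == 0)%N.
Proof.
move=> pp; wlog yx : x y / (y <= x)%N => [H xp yp|xp yp].
  have [/H->//|/ltnW/H e] := leqP y x.
  by rewrite eq_sym e// eq_sym addnC.
rewrite eqn_mod_dvd ?leq_exp2r// subn_sqr Euclid_dvdM//.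
apply/orP/orP => [[h|h]|[/orP[]|]].
- left; apply/orP; left; rewrite eqn_leq yx andbT -subn_eq0.
  by have [//|n0] := posnP (x - y); have := dvdn_leq n0 h; lia.
- have [->//|n0] := posnP (x + y); first by right.
  left; apply/orP; right; case/dvdnP: h => -[|[|c]] e; lia.
- by move=> /eqP->; left; rewrite subnn dvdn0.
- by move=> /eqP->; right.
- by move=> /eqP->; right; rewrite dvdn0.
Qed.

(** The number of square roots of u modulo p is 1 plus the symbol: x and p - x are the only roots,
    and they differ because p is odd. Summed over u, each x is counted once, so the symbols sum to
    zero. *)
Lemma legendre_sqr_count (u p : nat) : prime p -> odd p -> (u < p)%N ->
  legendre u p + 1 = (\sum_(x < p) (x ^ 2 == u %[mod p])%N)%N%:Z.
Proof.
move=> pp op up; have p0 := prime_gt0 pp.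
rewrite legendreE//; case: ifP => pu.
  have u0 : u = 0%N by have [//|n0] := posnP u; have := dvdn_leq n0 pu; lia.
  rewrite add0r u0 (bigD1 (Ordinal p0))//= eqxx big1// => x x0.
  rewrite mod0n -/(dvdn p (x ^ 2)) Euclid_dvdX// andbT.
  have xpos : (0 < x)%N by rewrite lt0n.
  by case: (boolP (p %| x)%N) => // /(dvdn_leq xpos); rewrite leqNgt ltn_ord.
case: ifP => [/existsP[x0 /eqP hx0]|]; last first.
  move=> /negbT; rewrite negb_exists => /forallP H.
  by rewrite big1 ?addNr// => x _; rewrite (negbTE (H x)).
have x00 : (0 < x0)%N.
  rewrite lt0n; apply/eqP => x00; move: hx0; rewrite x00 exp0n// mod0n => /esym/eqP.
  by rewrite -/(dvdn p u) pu.
have hp : (p - x0 < p)%N by rewrite ltn_subrL x00.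
have ne : Ordinal hp != x0.
  apply/eqP => /(congr1 val)/= e.
  have : p = (x0 + x0)%N by have := ltn_ord x0; lia.
  by move=> pe; move: op; rewrite pe addnn odd_double.
rewrite (bigD1 x0)//= hx0 eqxx (bigD1 (Ordinal hp))//=.
have -> : ((p - x0) ^ 2 == u %[mod p])%N.
  by rewrite -hx0 sqr_mod_eq ?ltn_ord// subnK ?eqxx ?orbT// ltnW.
rewrite big1// => x /andP[xx0 xp]; rewrite -hx0 sqr_mod_eq ?ltn_ord//.
apply/eqP; rewrite eqb0 !negb_or.
rewrite [(_ == _ :> nat)](negbTE xx0) /= addn_eq0 negb_and -!lt0n x00 orbT andbT.
by apply: contra xp => /eqP e; apply/eqP/val_inj => /=; lia.
Qed.

Lemma legendre_sum (p : nat) : prime p -> odd p -> \sum_(u < p) legendre u p = 0.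
Proof.
move=> pp op; have p0 := prime_gt0 pp.
have : \sum_(u < p) (legendre u p + 1) = p%:Z.
  rewrite (eq_bigr (fun u : 'I_p => (\sum_(x < p) (x ^ 2 == u %[mod p])%N)%N%:Z)); last first.
    by move=> u _; apply: legendre_sqr_count.
  rewrite -(big_morph Posz PoszD (erefl _)) exchange_big /=.
  rewrite (eq_bigr (fun=> 1%N)); first by rewrite sum_nat_const card_ord muln1.
  move=> x _; rewrite (bigD1 (Ordinal (ltn_pmod (x ^ 2) p0)))//= modn_mod eqxx big1// => u ux.
  apply/eqP; rewrite eqb0; apply: contra ux => /eqP e; apply/eqP/val_inj => /=.
  by rewrite e modn_small.
rewrite big_split /= sumr_const card_ord => /eqP.
by rewrite -[_ *+ p]mulr_natl mulr1 natz -subr_eq0 addrK => /eqP.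
Qed.

Lemma legendre8_sum (p : nat) : prime p -> odd p -> \sum_(d < p) legendre (8 * d) p = 0.
Proof.
move=> pp op; have p0 := prime_gt0 pp; apply: etrans (legendre_sum pp op).
pose h (d : 'I_p) := Ordinal (ltn_pmod (8 * d) p0).
have cop : coprime p 8 by rewrite -[8%N]/(2 ^ 3)%N coprime_pexpr// coprimen2.
have hinj : injective h.
  move=> x y /(congr1 val)/= e; apply/val_inj => /=.
  wlog yx : x y e / (y <= x)%N => [H|].
    by have [/H->//|/ltnW/H->] := leqP y x.
  move/eqP: e; rewrite eqn_mod_dvd ?leq_mul2l ?yx ?orbT// -mulnBr Gauss_dvdr// => hd.
  have [|n0] := posnP (x - y); first by lia.
  by have := dvdn_leq n0 hd; have := ltn_ord x; lia.
rewrite [RHS](reindex_inj hinj) /=; apply: eq_bigr => d _.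
by rewrite -legendre_mod.
Qed.

Lemma legendre8_sqr (d p : nat) : prime p -> odd p ->
  legendre (8 * d) p ^+ 2 = (~~ (p %| d)%N)%:R.
Proof.
move=> pp op; rewrite legendreE//.
have cop : coprime p 8 by rewrite -[8%N]/(2 ^ 3)%N coprime_pexpr// coprimen2.
by rewrite Gauss_dvdr//; case: ifP => // _; case: ifP.
Qed.

Lemma legendre_norm (u p : nat) (R : numDomainType) : `|(legendre u p)%:~R| <= 1 :> R.
Proof.
rewrite /legendre /kronecker_prime; case: ifP => _; first by rewrite normr0.
case: ifP => _; first by case: ifP; rewrite ?rmorphN ?normrN normr1.
by case: ifP; rewrite ?rmorphN ?normrN normr1.
Qed.

(** * Sieving squarefree integers *)

Definition oddprime (p : nat) : bool := prime p && odd p.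

(* For an odd prime p, the factor at p of [d squarefree] * chi_{8d}(p)^j is split
   as loc false + loc true, where the second term removes the multiples of p^2
   (if j > 0 then chi_{8d}(p)^j already vanishes there).  The factor at 2 is the
   indicator of odd d. *)
Definition loc (R : realType) (p j : nat) (b : bool) (d : nat) : R :=
  if oddprime p then
    if b then (if j == 0%N then - ((p ^ 2 %| d)%N : nat)%:R else 0)
    else (legendre (8 * d) p)%:~R ^+ j
  else if b then 0 else if p == 2%N then (odd d : nat)%:R else 1.

Definition loc_per (p j : nat) (b : bool) : nat :=
  if oddprime p then
    if j == 0%N then (if b then p ^ 2 else 1)%N else if b then 1%N else p
  else if b then 1%N else if p == 2%N then 2%N else 1%N.

Definition loc_mean (R : realType) (p j : nat) (b : bool) : R :=
  if oddprime p then
    if b then (if j == 0%N then - ((p ^ 2)%N%:R)^-1 else 0)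
    else if j == 0%N then 1 else if j == 1%N then 0 else 1 - p%:R^-1
  else if b then 0 else if p == 2%N then 2^-1 else 1.

(** An upper bound for period^(1/8) kernel^(-7/8), with [loc_per] and [loc_ker]. For the term
    removing multiples of p^2 this is p^(1/4 - 7/4) = p^(-3/2), which is summable; hence the
    interpolation exponent 1/8. *)
Definition loc_wt (R : realType) (p j : nat) (b : bool) : R :=
  if oddprime p then
    if b then (if j == 0%N then p%:R `^ (- (3 / 2)) else 0)
    else if j == 0%N then 1 else p%:R
  else if b then 0 else if p == 2%N then 2 else 1.

Definition loc_ker (p : nat) (b : bool) : nat := if b then (p ^ 2)%N else 1%N.

Lemma loc_per_gt0 p j b : (0 < loc_per p j b)%N.
Proof.
rewrite /loc_per; case: ifP => [/andP[/prime_gt0 p0 _]|_].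
  by case: ifP; case: ifP => //; rewrite expn_gt0 p0.
by case: b => //; case: ifP.
Qed.

Lemma loc_periodic (R : realType) p j b d : loc R p j b d = loc R p j b (d %% loc_per p j b).
Proof.
rewrite /loc /loc_per; case: ifP => [/andP[pp op]|_].
  case: b => //; first by case: ifP => // _; rewrite /dvdn modn_mod.
  case: eqP => [->|_]; first by rewrite !expr0.
  by rewrite legendre_mod// [in RHS]legendre_mod// modnMmr.
case: b => //; case: ifP => // _; by rewrite modn2 oddb.
Qed.

Lemma loc_norm (R : realType) p j b d : `|loc R p j b d| <= 1.
Proof.
rewrite /loc; case: ifP => _; last first.
  by case: b; rewrite ?normr0//; case: ifP => _; rewrite ?normr1//; case: odd; rewrite ?normr0 ?normr1.
case: b.
  by case: ifP => _; rewrite ?normr0// normrN; case: dvdn; rewrite ?normr0 ?normr1.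
by rewrite normrX exprn_ile1// legendre_norm.
Qed.

Lemma loc_meanP (R : realType) p j b : (j < 3)%N ->
  \sum_(d < loc_per p j b) loc R p j b d = (loc_per p j b)%:R * loc_mean R p j b.
Proof.
move=> j3; rewrite /loc_per /loc_mean /loc; case: ifP => [/andP[pp op]|_]; last first.
  case: b; first by rewrite big1// mulr0.
  case: ifP => _; last by rewrite big_ord_recl big_ord0 addr0 mulr1.
  by rewrite !big_ord_recl big_ord0 /= add0r addr0 divff.
have p0 := prime_gt0 pp; have pR : (p%:R : R) != 0 by rewrite pnatr_eq0 -lt0n.
have q0 : (0 < p ^ 2)%N by rewrite expn_gt0 p0.
case: b.
  case: ifP => _; last by rewrite big1// mulr0.
  rewrite mulrN divff ?pnatr_eq0 -?lt0n// (bigD1 (Ordinal q0))//= dvdn0 big1 ?addr0// => i i0.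
  have [pi|_] := boolP (p ^ 2 %| i)%N; last by rewrite oppr0.
  have i1 : (0 < i)%N by rewrite lt0n.
  by have := dvdn_leq i1 pi; rewrite leqNgt ltn_ord.
case: j j3 => [|[|[|j]]]//= _.
- by rewrite big_ord_recl big_ord0 addr0 expr0 mulr1.
- rewrite mulr0 -[RHS](rmorph0 (intr : int -> R)) -(legendre8_sum pp op) rmorph_sum.
  by apply: eq_bigr => i _; rewrite expr1.
- rewrite mulrBr mulr1 divff//.
  rewrite (eq_bigr (fun i : 'I_p => 1 - (i == Ordinal p0)%:R)).
    rewrite sumrB sumr_const card_ord; congr (_ - _).
    by rewrite (bigD1 (Ordinal p0))//= ?eqxx big1 ?addr0// => i /negbTE->.
  move=> i _; rewrite -rmorphXn /= legendre8_sqr//.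
  have -> : (p %| i)%N = (i == Ordinal p0).
    apply/idP/eqP => [pi|->]; last by rewrite dvdn0.
    apply/val_inj => /=; have [//|i0] := posnP i.
    by have := dvdn_leq i0 pi; rewrite leqNgt ltn_ord.
  by case: eqP; rewrite /= ?subrr ?subr0.
Qed.

Lemma loc_per_prime p j b : loc_per p j b != 1%N -> prime p /\ exists e, loc_per p j b = (p ^ e)%N.
Proof.
rewrite /loc_per; case: ifP => [/andP[pp op]|_].
  case: ifP => _; case: b => // _; split=> //; first by exists 2%N.
  by exists 1%N; rewrite expn1.
by case: b => //; have [->|] := eqVneq p 2%N => // _; split=> //; exists 1%N.
Qed.

Lemma loc_per_coprime p j b p' j' b' : p != p' ->
  coprime (loc_per p j b) (loc_per p' j' b').
Proof.
move=> ne; have [->|/loc_per_prime[pp [e ->]]] := eqVneq (loc_per p j b) 1%N; first exact: coprime1n.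
have [->|/loc_per_prime[pp' [e' ->]]] := eqVneq (loc_per p' j' b') 1%N; first exact: coprimen1.
by apply/coprimeXl/coprimeXr; rewrite prime_coprime// dvdn_prime2.
Qed.

Lemma prod_coprime_dvdn (s : seq nat) (g : nat -> nat) (d : nat) : uniq s ->
  (forall p q, p \in s -> q \in s -> p != q -> coprime (g p) (g q)) ->
  (forall p, p \in s -> (g p %| d)%N) -> (\prod_(p <- s) g p %| d)%N.
Proof.
elim: s => [|q s IH]; first by rewrite big_nil dvd1n.
rewrite [uniq _]/= => /andP[qs us] cop H; rewrite big_cons Gauss_dvd.
  rewrite H ?mem_head//= IH//; last by move=> p ps; apply: H; rewrite in_cons ps orbT.
  by move=> p r ps rs; apply: cop; rewrite in_cons ?ps ?rs orbT.
apply: coprime_prodr => p ps; apply: cop; rewrite ?mem_head ?in_cons ?ps ?orbT//.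
by apply: contraNneq qs => ->.
Qed.

Lemma powR_prod (R : realType) (I : Type) (s : seq I) (F : I -> R) (r : R) :
  (forall i, 0 <= F i) -> (\prod_(i <- s) F i) `^ r = \prod_(i <- s) F i `^ r.
Proof.
move=> F0; elim: s => [|i s IH]; first by rewrite !big_nil powR1.
by rewrite !big_cons powRM ?IH// prodr_ge0.
Qed.

Lemma le_geom_mean (R : realType) (x a c r : R) : 0 <= x -> 0 < r < 1 -> x <= a -> x <= c ->
  x <= a `^ r * c `^ (1 - r).
Proof.
move=> x0 /andP[r0 r1] xa xc; have a0 := le_trans x0 xa; have c0 := le_trans x0 xc.
have -> : x = x `^ r * x `^ (1 - r).
  rewrite -powRD; last by rewrite addrC subrK oner_eq0.
  by rewrite addrC subrK powRr1.
by apply: ler_pM; rewrite ?powR_ge0//; apply: ge0_ler_powR; rewrite ?nnegrE//; lra.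
Qed.

Lemma loc_wt_ge0 (R : realType) p j b : 0 <= loc_wt R p j b.
Proof.
rewrite /loc_wt; case: ifP => _; last by case: b => //; case: ifP.
by case: b; case: ifP => //; rewrite powR_ge0.
Qed.

Lemma loc_factor_le (R : realType) (p j : nat) (b : bool) : (b -> oddprime p && (j == 0%N)) ->
  (loc_per p j b)%:R `^ (8^-1) * ((loc_ker p b)%:R^-1) `^ (1 - 8^-1) <= loc_wt R p j b.
Proof.
rewrite /loc_per /loc_wt /loc_ker; case: b => [/(_ isT)/andP[opp ->]|_].
  rewrite opp; have p0 : (0 < p)%N by move: opp => /andP[/prime_gt0].
  have pR : 0 < p%:R :> R by rewrite ltr0n.
  rewrite natrX -powR_mulrn ?(ltW pR)// -powRN -!powRrM -powRD; last by apply/implyP => _; rewrite gt_eqF.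
  by rewrite le_eqVlt; apply/orP; left; apply/eqP; congr (_ `^ _); lra.
have le1 (n : nat) : (0 < n)%N -> (n%:R : R) `^ 8^-1 <= n%:R.
  by move=> n0; apply: ler1_powR; rewrite ?ler1n//; lra.
rewrite invr1 powR1 mulr1; case: ifP => [/andP[/prime_gt0 p0 _]|_].
  by case: ifP => _; [rewrite powR1 | exact: le1].
by case: ifP => _; [exact: (le1 2%N) | rewrite powR1].
Qed.

(** Two bounds for one term of the expansion: 2 Q because the summand has period Q, the product of
    the local periods, and 2 z / l because it is supported on multiples of l, the product of the
    chosen p^2. Their geometric mean with exponents 1/8 and 7/8 is multiplicative in p. *)
Lemma sieve_term (R : realType) (f : nat -> nat) (b : nat -> bool) (z L : nat) :
  (2 < L)%N -> (forall p, (f p < 3)%N) ->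
  `|\sum_(0 <= d < z) \prod_(0 <= p < L) loc R p (f p) (b p) d -
    z%:R * \prod_(0 <= p < L) loc_mean R p (f p) (b p)| <=
  2 * z%:R `^ (1 - 8^-1) * \prod_(0 <= p < L) loc_wt R p (f p) (b p).
Proof.
move=> L2 f3; set s := index_iota 0 L.
have us : uniq s by rewrite iota_uniq.
have W0 : 0 <= \prod_(0 <= p < L) loc_wt R p (f p) (b p).
  by apply: prodr_ge0 => p _; exact: loc_wt_ge0.
(* If some chosen second term of [loc] is identically zero, both sums vanish; otherwise [b p] forces
   p to be an odd prime with f(p) = 0. *)
have [dead|] := boolP (has (fun p => b p && ~~ (oddprime p && (f p == 0%N))) s).
  have /hasP[p ps /andP[bp hp]] := dead.
  have l0 d : loc R p (f p) (b p) d = 0.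
    by rewrite /loc bp; case: ifP hp => //= _ /negbTE->.
  have m0 : loc_mean R p (f p) (b p) = 0.
    by rewrite /loc_mean bp; case: ifP hp => //= _ /negbTE->.
  rewrite (big_rem p ps) /= m0 mul0r mulr0 subr0 big1 ?normr0; last first.
    by move=> d _; rewrite (big_rem p ps) /= l0 mul0r.
  by rewrite mulr_ge0// mulr_ge0// powR_ge0.
move=> /hasPn alive.
have al p : p \in s -> b p -> oddprime p && (f p == 0%N).
  by move=> /alive; rewrite negb_and negbK => /orP[/negbTE->|].
set Q := (\prod_(p <- s) loc_per p (f p) (b p))%N.
have Q0 : (0 < Q)%N by apply: prodn_gt0 => p; exact: loc_per_gt0.
set l := (\prod_(p <- s) loc_ker p (b p))%N.
have l0 : (0 < l)%N.
  rewrite /l big_seq; apply: prodn_cond_gt0 => p ps; rewrite /loc_ker.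
  by case: ifP => // /(al _ ps)/andP[/andP[/prime_gt0 p0 _] _]; rewrite expn_gt0 p0.
have lR : 0 < l%:R :> R by rewrite ltr0n.
pose F d := \prod_(p <- s) loc R p (f p) (b p) d.
have F1 d : `|F d| <= 1.
  rewrite /F; elim/big_ind: _ => [|x y hx hy|p _]; [by rewrite normr1 | | exact: loc_norm].
  by rewrite normrM mulr_ile1.
have Fper d : F d = F (d %% Q)%N.
  apply: eq_big_seq => p ps; rewrite [LHS]loc_periodic [RHS]loc_periodic modn_dvdm//.
  by rewrite /Q (big_rem p ps) /= dvdn_mulr.
have Fmean : (\sum_(d < Q) F d) / Q%:R = \prod_(p <- s) loc_mean R p (f p) (b p).
  have -> := @crt_prod R s (fun p => loc_per p (f p) (b p))
    (fun p d => loc R p (f p) (b p) d) us (fun p => loc_per_gt0 p (f p) (b p))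
    (fun p q _ _ => @loc_per_coprime p (f p) (b p) q (f q) (b q))
    (fun p d => loc_periodic R p (f p) (b p) d).
  rewrite [X in X / _](eq_bigr (fun p => (loc_per p (f p) (b p))%:R * loc_mean R p (f p) (b p))).
    by rewrite big_split /= -natr_prod -/Q mulrAC divff ?mul1r// pnatr_eq0 -lt0n.
  by move=> p _; exact: loc_meanP.
have B1 : `|\sum_(0 <= d < z) F d - z%:R * \prod_(p <- s) loc_mean R p (f p) (b p)| <= 2 * Q%:R.
  by rewrite -Fmean -natrM; exact: periodic_sum.
have s2 : 2%N \in s by rewrite mem_index_iota.
(* The factor at 2 kills the even d, in particular d = 0; this uses that 2 is below L. *)
have Fl d : `|F d| <= if odd d then ((l %| d)%N : nat)%:R else 0.
  case: ifP => od; last first.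
    rewrite /F (big_rem 2%N s2) /= {1}/loc /= od /=.
    by case: (b 2%N); rewrite mul0r normr0.
  have [ld|nld] := boolP (l %| d)%N; first exact: F1.
  have /hasP[p ps /andP[bp np]] : has (fun p => b p && ~~ (p ^ 2 %| d)%N) s.
    apply: contraR nld => /hasPn H; apply: prod_coprime_dvdn => //.
      move=> p q ps qs ne; rewrite /loc_ker.
      case: ifP => [/(al _ ps)/andP[/andP[pp _] _]|_]; last exact: coprime1n.
      case: ifP => [/(al _ qs)/andP[/andP[qq _] _]|_]; last exact: coprimen1.
      by apply/coprimeXl/coprimeXr; rewrite prime_coprime// dvdn_prime2.
    move=> p ps; have := H p ps; rewrite /loc_ker; case: ifP => [bp|]; last by rewrite dvd1n.
    by rewrite negbK.
  rewrite /F (big_rem p ps) /= {1}/loc bp; have /andP[-> ->] := al p ps bp.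
  by rewrite (negbTE np) oppr0 mul0r normr0.
have Ml : `|\prod_(p <- s) loc_mean R p (f p) (b p)| <= l%:R^-1.
  rewrite /l natr_prod -prodfV normr_prod big_seq [leRHS]big_seq; apply: ler_prod => p ps.
  rewrite normr_ge0 /= /loc_mean /loc_ker; case: ifP => opp; last first.
    case: ifP => [/(al _ ps)|_]; first by rewrite opp.
    by rewrite invr1; case: ifP => _; rewrite ger0_norm//; lra.
  case: ifP => [/(al _ ps)/andP[_ ->]|_]; first by rewrite normrN ger0_norm.
  rewrite invr1; case: ifP => _; first by rewrite normr1.
  case: ifP => _; first by rewrite normr0.
  have p1 : p%:R^-1 <= 1 :> R.
    rewrite invf_le1 ?ltr0n ?ler1n; first by move: opp => /andP[/prime_gt0].
    by move: opp => /andP[/prime_gt0].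
  by rewrite ger0_norm ?subr_ge0// lerBlDr lerDl invr_ge0.
have B2 : `|\sum_(0 <= d < z) F d - z%:R * \prod_(p <- s) loc_mean R p (f p) (b p)| <=
    2 * (z%:R * l%:R^-1).
  apply: (le_trans (ler_normB _ _)); rewrite [leRHS]mulr_natl mulr2n; apply: lerD; last first.
    by rewrite normrM ger0_norm// ler_wpM2l.
  apply: (le_trans (ler_norm_sum _ _ _)); apply: le_trans (count_multiples_le _ _ l0).
  by rewrite [leRHS]big_mkcond /=; apply: ler_sum.
have r01 : 0 < (8^-1 : R) < 1 by lra.
apply: (le_trans (le_geom_mean (normr_ge0 _) r01 B1 B2)).
rewrite !powRM ?mulr_ge0// ?invr_ge0// mulrACA -powRD; last by rewrite addrC subrK oner_eq0.
rewrite [8^-1 + _]addrC subrK powRr1// -!mulrA ler_wpM2l// mulrCA ler_wpM2l ?powR_ge0//.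
rewrite /Q /l !natr_prod -prodfV !powR_prod//.
rewrite -big_split /= big_seq [leRHS]big_seq; apply: ler_prod => p ps.
by rewrite mulr_ge0 ?powR_ge0//= loc_factor_le// => bp; exact: al.
Qed.

(** Distributing a product over a sum yields finite functions on ['I_L], while the local data are
    indexed by all naturals; the value [x0] is used from L on. *)
Definition ext_ord (T : Type) (L : nat) (x0 : T) (A : 'I_L -> T) (p : nat) : T :=
  if insub p is Some i then A i else x0.

Lemma ext_ordE (T : Type) (L : nat) (x0 : T) (A : 'I_L -> T) (i : 'I_L) : ext_ord x0 A i = A i.
Proof. by rewrite /ext_ord valK. Qed.

(** Inclusion-exclusion over the sets of primes whose squares are removed. The error of each term is
    a product over p, so the total error is again a product. *)
Lemma sieve_sum (R : realType) (f : nat -> nat) (z L : nat) :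
  (2 < L)%N -> (forall p, (f p < 3)%N) ->
  `|\sum_(0 <= d < z) \prod_(p < L) (loc R p (f p) true d + loc R p (f p) false d) -
    z%:R * \prod_(p < L) (loc_mean R p (f p) true + loc_mean R p (f p) false)| <=
  2 * z%:R `^ (1 - 8^-1) * \prod_(p < L) (loc_wt R p (f p) true + loc_wt R p (f p) false).
Proof.
move=> L2 f3.
have E (g : nat -> bool -> R) : \prod_(p < L) (g p true + g p false) =
    \sum_(A : {ffun 'I_L -> bool}) \prod_(0 <= p < L) g p (ext_ord false A p).
  transitivity (\prod_(p < L) \sum_(b : bool) g p b).
    by apply: eq_bigr => p _; rewrite big_bool.
  rewrite bigA_distr_bigA; apply: eq_bigr => A _; rewrite big_mkord.
  by apply: eq_bigr => i _; rewrite ext_ordE.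
rewrite (eq_bigr (fun d => \sum_(A : {ffun 'I_L -> bool})
   \prod_(0 <= p < L) loc R p (f p) (ext_ord false A p) d)); last first.
  by move=> d _; rewrite (E (fun p b => loc R p (f p) b d)).
rewrite (E (fun p b => loc_mean R p (f p) b)) (E (fun p b => loc_wt R p (f p) b)).
rewrite exchange_big /= big_distrr /= -sumrB big_distrr /=.
apply: (le_trans (ler_norm_sum _ _ _)); apply: ler_sum => A _.
exact: sieve_term.
Qed.

(** * Mean values over odd squarefree integers *)

Definition chiX (R : realType) (p j d : nat) : R :=
  if oddprime p then (legendre (8 * d) p)%:~R ^+ j else 1.

(* The mean of chi_{8d}(p)^j over odd squarefree d. *)
Definition mcoef (R : realType) (p j : nat) : R :=
  if oddprime p then (if j == 0%N then 1 else if j == 1%N then 0 else p%:R / (p%:R + 1)) else 1.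

Definition cond_wt (R : realType) (p j : nat) : R :=
  if oddprime p && (j != 0%N) then p%:R else 1.

(** For j = 0 the two terms add up to 1 minus the indicator of p^2 dividing d; for j > 0 the
    character already vanishes when p divides d. As d < L, every prime whose square divides d occurs
    in the product. *)
Lemma loc_prod_odd_squarefree (R : realType) (f : nat -> nat) (L d : nat) :
  (2 < L)%N -> (d < L)%N ->
  \prod_(p < L) (loc R p (f p) true d + loc R p (f p) false d) =
  if odd_squarefree d then \prod_(p < L) chiX R p (f p) d else 0.
Proof.
move=> L2 dL; case: ifP => [/andP[od /forallP sd]|].
  have d0 : (0 < d)%N by case: d od {dL sd}.
  apply: eq_bigr => p _; rewrite /loc /chiX; case: ifP => [/andP[pp op]|_]; last first.
    by case: ifP => _; rewrite add0r ?od.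
  case: eqP => [f0|_]; last by rewrite add0r.
  suff -> : (p ^ 2 %| d)%N = false by rewrite oppr0 add0r.
  apply/negP => pd; have pd' : (p < d.+1)%N.
    by rewrite ltnS (leq_trans _ (dvdn_leq d0 pd))// -mulnn leq_pmulr// prime_gt0.
  by have := sd (Ordinal pd'); rewrite /= pd /= => /eqP p1; move: pp; rewrite p1.
move=> nosf; have [od|od] := boolP (odd d); last first.
  by rewrite (bigD1 (Ordinal L2))//= /loc /= (negbTE od) addr0 mul0r.
have d0 : (0 < d)%N by case: d od {dL nosf}.
move: nosf; rewrite /odd_squarefree od /= => /negbT; rewrite negb_forall => /existsP[m].
rewrite negb_imply => /andP[md m1].
have m0 : (0 < m)%N by rewrite lt0n; apply: contraTneq md => ->; rewrite exp0n// dvd0n -lt0n.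
have pp : prime (pdiv m) by apply: pdiv_prime; case: (nat_of_ord m) m0 m1 => [|[|]].
have pd : ((pdiv m) ^ 2 %| d)%N by apply: dvdn_trans md; rewrite dvdn_exp2r// pdiv_dvd.
have pd1 : (pdiv m %| d)%N by apply: dvdn_trans pd; rewrite -{1}[pdiv m]expn1 dvdn_exp2l.
have op : odd (pdiv m) by apply: dvdn_odd pd1 od.
have pL : (pdiv m < L)%N by apply: leq_ltn_trans dL; exact: dvdn_leq.
rewrite (bigD1 (Ordinal pL))//= /loc /oddprime pp op /= pd.
case: eqP => [->|/eqP f0]; first by rewrite expr0 addrC subrr mul0r.
by rewrite legendreE// ifT ?dvdn_mull// expr0n (negbTE f0) addr0 mul0r.
Qed.

Definition sqfree_density (R : realType) (L : nat) : R :=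
  \prod_(p < L) (if oddprime p then 1 - ((p ^ 2)%N%:R)^-1 else 1).

Lemma prod_at2 (R : comPzRingType) (L : nat) (c : R) : (2 < L)%N ->
  \prod_(p < L) (if p == 2%N :> nat then c else 1) = c.
Proof.
move=> L2; rewrite (bigD1 (Ordinal L2))//= big1 ?mulr1// => i i2.
by rewrite ifF//; apply/negbTE; apply: contra i2 => /eqP e; apply/eqP/val_inj.
Qed.

(** Taking the density 1 - p^(-2) out of each odd local factor turns the mean 1 - 1/p of the squared
    character into p / (p+1). *)
Lemma loc_mean_prod (R : realType) (f : nat -> nat) (L : nat) :
  (2 < L)%N -> (forall p, (f p < 3)%N) ->
  \prod_(p < L) (loc_mean R p (f p) true + loc_mean R p (f p) false) =
  2^-1 * sqfree_density R L * \prod_(p < L) mcoef R p (f p).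
Proof.
move=> L2 f3; rewrite -{1}(@prod_at2 R L 2^-1 L2) -!big_split /=; apply: eq_bigr => p _.
rewrite /loc_mean /mcoef; case: ifP => [/andP[pp op]|_]; last first.
  by case: ifP => _; rewrite add0r ?mulr1.
have p0 : 0 < (p%:R : R) by rewrite ltr0n prime_gt0.
have -> : (nat_of_ord p == 2%N) = false by apply: contraTF op => /eqP->.
rewrite mul1r.
case: (f p) (f3 p) => [|[|[|j]]]//= _.
- by rewrite addrC mulr1.
- by rewrite addr0 mulr0.
- rewrite add0r natrX; field; apply/andP; split; apply: lt0r_neq0; lra.
Qed.

Lemma prod1D_le_expR (R : realType) (I : Type) (s : seq I) (a : I -> R) :
  (forall i, 0 <= a i) -> \prod_(i <- s) (1 + a i) <= expR (\sum_(i <- s) a i).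
Proof.
move=> a0; rewrite expR_sum; apply: ler_prod => i _.
by rewrite addr_ge0//= expR_ge1Dx.
Qed.

Lemma loc_wt_prod (R : realType) (f : nat -> nat) (L : nat) : (2 < L)%N ->
  \prod_(p < L) (loc_wt R p (f p) true + loc_wt R p (f p) false) <=
  2 * expR 3 * \prod_(p < L) cond_wt R p (f p).
Proof.
move=> L2; pose a (p : 'I_L) : R := if oddprime p then p%:R `^ (- (3 / 2)) else 0.
have a0 p : 0 <= a p by rewrite /a; case: ifP => // _; exact: powR_ge0.
have ea : \prod_(p < L) (1 + a p) <= expR 3.
  apply: (le_trans (prod1D_le_expR _ a0)); rewrite ler_expR.
  apply: le_trans (sum_powR32 R L).
  rewrite -(big_mkord xpredT (fun p => if oddprime p then p%:R `^ (- (3 / 2)) else 0 : R)).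
  case: L L2 {a a0} => // L _; rewrite big_ltn//= add0r; apply: ler_sum => p _.
  by case: ifP => // _; exact: powR_ge0.
have W0 : 0 <= \prod_(p < L) cond_wt R p (f p).
  by apply: prodr_ge0 => p _; rewrite /cond_wt; case: ifP.
apply: (@le_trans _ _ (2 * (\prod_(p < L) (1 + a p)) * \prod_(p < L) cond_wt R p (f p))).
  rewrite -{1}(@prod_at2 R L 2 L2) -!big_split /=; apply: ler_prod => p _.
  rewrite addr_ge0 ?loc_wt_ge0//= /loc_wt /cond_wt /a; case: ifP => [/andP[pp op]|_] /=; last first.
    by rewrite !addr0 mulr1; case: ifP => _; rewrite add0r ?mulr1.
  have -> : (nat_of_ord p == 2%N) = false by apply: contraTF op => /eqP->.
rewrite mul1r.
  case: (f p) => [|j] /=; first by rewrite mulr1 addrC.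
  by rewrite add0r ler_peMl// lerDl powR_ge0.
by apply: ler_wpM2r => //; apply: ler_wpM2l.
Qed.

(** Comparison with the product of 1 - 1/m^2 over all m >= 2, which telescopes and stays above
    1/2. *)
Lemma sqfree_density_ge (R : realType) (L : nat) : 2^-1 <= sqfree_density R L.
Proof.
have H n : \prod_(2 <= p < n.+2) (1 - ((p ^ 2)%N%:R)^-1) = n.+2%:R / (2 * n.+1%:R) :> R.
  elim: n => [|n IH]; first by rewrite big_geq// mulr1 divff.
  rewrite big_nat_recr//= IH natrX.
  have e1 : n.+1%:R = n%:R + 1 :> R by rewrite natr1.
  have e2 : n.+2%:R = n%:R + 2 :> R by rewrite -natr1 e1; ring.
  have e3 : n.+3%:R = n%:R + 3 :> R by rewrite -natr1 e2; ring.
  rewrite e1 e2 e3; have n0 : 0 <= n%:R :> R by [].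
  by field; apply/andP; split; apply: lt0r_neq0; lra.
have inv01 (p : nat) : (1 < p)%N -> 0 <= 1 - ((p ^ 2)%N%:R : R)^-1 <= 1.
  move=> p1; rewrite subr_ge0 lerBlDr lerDl invr_ge0 ler0n andbT invf_le1 ?ltr0n ?ler1n.
    by rewrite expn_gt0 ltnW.
  by rewrite expn_gt0 ltnW.
pose g (p : nat) : R := if oddprime p then 1 - ((p ^ 2)%N%:R)^-1 else 1.
rewrite /sqfree_density -(big_mkord xpredT g).
case: L => [|[|L]].
- by rewrite big_geq//; lra.
- by rewrite big_nat1 /g /=; lra.
rewrite big_ltn// big_ltn// /g /= !mul1r.
apply: (@le_trans _ _ (L.+2%:R / (2 * L.+1%:R))).
  rewrite ler_pdivlMr ?mulr_gt0 ?ltr0n// mulrA mulVf// mul1r ler_nat//.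
rewrite -H big_nat [leRHS]big_nat; apply: ler_prod => p /andP[p1 _].
by have /andP[h1 h2] := inv01 p p1; rewrite h1 /=; case: ifP.
Qed.

(** One factor 2 comes from the interpolated bounds, another from the weight at the prime 2, and exp
    3 bounds the product of 1 + p^(-3/2). *)
Definition sieve_const (R : realType) : R := 4 * expR 3.

Definition osf_count (R : realType) (z : nat) : R := \sum_(0 <= d < z | odd_squarefree d) 1.

Lemma twisted_sum_estimate (R : realType) (f : nat -> nat) (z L : nat) :
  (2 < L)%N -> (z <= L)%N -> (forall p, (f p < 3)%N) ->
  `|\sum_(0 <= d < z | odd_squarefree d) \prod_(p < L) chiX R p (f p) d -
    z%:R * (2^-1 * sqfree_density R L * \prod_(p < L) mcoef R p (f p))| <=
  sieve_const R * z%:R `^ (1 - 8^-1) * \prod_(p < L) cond_wt R p (f p).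
Proof.
move=> L2 zL f3.
have := @sieve_sum R f z L L2 f3; rewrite loc_mean_prod//.
rewrite (_ : \sum_(0 <= d < z) _ = \sum_(0 <= d < z | odd_squarefree d) \prod_(p < L) chiX R p (f p) d); last first.
  rewrite [RHS]big_mkcond /=; apply: eq_big_nat => d /andP[_ dz].
  by rewrite loc_prod_odd_squarefree// (leq_trans dz).
move=> h; apply: (le_trans h).
apply: (@le_trans _ _ (2 * z%:R `^ (1 - 8^-1) * (2 * expR 3 * \prod_(p < L) cond_wt R p (f p)))).
  by rewrite ler_wpM2l ?mulr_ge0 ?powR_ge0// loc_wt_prod.
by rewrite /sieve_const; move: (\prod_(_ < _) _) (_ `^ _) (expR _) => x y w; lra.
Qed.

Lemma osf_count_estimate (R : realType) (z L : nat) : (2 < L)%N -> (z <= L)%N ->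
  `|osf_count R z - z%:R * (2^-1 * sqfree_density R L)| <= sieve_const R * z%:R `^ (1 - 8^-1).
Proof.
move=> L2 zL; have := @twisted_sum_estimate R (fun=> 0%N) z L L2 zL (fun=> isT).
rewrite (eq_bigr (fun=> 1)); last first.
  by move=> d _; apply: big1 => p _; rewrite /chiX expr0 if_same.
rewrite [X in _ * (_ * _ * X)]big1; last by move=> p _; rewrite /mcoef /= if_same.
rewrite [X in _ <= _ * X]big1; last by move=> p _; rewrite /cond_wt andbF.
by rewrite !mulr1.
Qed.

(** The main term is at least z/4 by the bound on the density, and the hypothesis makes the error at
    most z/8. *)
Lemma osf_count_ge (R : realType) (z : nat) : (0 < z)%N ->
  8 * sieve_const R <= z%:R `^ 8^-1 -> z%:R / 8 <= osf_count R z.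
Proof.
move=> z0 hz; have zR : 0 < z%:R :> R by rewrite ltr0n.
have := @osf_count_estimate R z (maxn 3 z); rewrite leq_max /= leq_maxr => /(_ isT isT).
rewrite ler_norml => /andP[h _].
have dens := sqfree_density_ge R (maxn 3 z).
have K0 : 0 <= sieve_const R by rewrite mulr_ge0// expR_ge0.
have e : z%:R `^ 8^-1 * z%:R `^ (1 - 8^-1) = z%:R :> R.
  by rewrite -powRD; [rewrite addrC subrK powRr1// ltW | apply/implyP => _; rewrite gt_eqF].
have h1 := ler_wpM2r (powR_ge0 z%:R (1 - 8^-1)) hz.
rewrite e in h1.
have h2 := ler_wpM2l (ltW zR) dens.
move: h h1 h2; move: (z%:R `^ (1 - 8^-1)) (sqfree_density _ _) (osf_count _ _) => x y w; lra.
Qed.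

Lemma chiX_norm (R : realType) p j d : `|chiX R p j d| <= 1.
Proof.
rewrite /chiX; case: ifP => _; last by rewrite normr1.
by rewrite normrX exprn_ile1// legendre_norm.
Qed.

Lemma mcoef_norm (R : realType) p j : `|mcoef R p j| <= 1.
Proof.
rewrite /mcoef; case: ifP => _; last by rewrite normr1.
case: ifP => _; first by rewrite normr1.
case: ifP => _; first by rewrite normr0.
have p1 : 0 < p%:R + 1 :> R by rewrite natr1 ltr0n.
rewrite ger0_norm; last by rewrite divr_ge0// ltW.
by rewrite ler_pdivrMr// mul1r lerDl.
Qed.

Lemma prod_norm_le1 (R : numDomainType) (I : finType) (F : I -> R) :
  (forall i, `|F i| <= 1) -> `|\prod_i F i| <= 1.
Proof.
move=> F1; elim/big_ind: _ => [|x y hx hy|p _]; [by rewrite normr1 | | exact: F1].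
by rewrite normrM mulr_ile1.
Qed.

Lemma le2_powR (R : realType) (x y s : R) : 0 <= s <= 1 -> 0 <= x -> x <= 2 -> x <= y -> x <= 2 * y `^ s.
Proof.
move=> /andP[s0 s1] x0 x2 xy; have [y1|y1] := lerP 1 y.
  apply: (le_trans x2); rewrite -[leLHS]mulr1 ler_wpM2l//.
  by rewrite -(powRr0 y); apply: ler_powR.
have [y0|y0] := ltrP 0 y; last first.
  have -> : x = 0 by lra.
  by rewrite mulr_ge0 ?powR_ge0.
have : y <= y `^ s by apply: ger1_powR; rewrite ?y0//= ltW.
have := powR_ge0 y s; lra.
Qed.

(** The twisted sum is compared with the count times the main coefficient, so the density cancels.
    The two sieve errors, divided by a count of at least z/8, give the constant 16. The exponent s
    interpolates between this and the trivial bound 2. *)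
Lemma twisted_mean_estimate (R : realType) (f : nat -> nat) (z L : nat) (s : R) :
  0 <= s <= 1 -> (2 < L)%N -> (0 < z <= L)%N -> 8 * sieve_const R <= z%:R `^ 8^-1 ->
  (forall p, (f p < 3)%N) ->
  `|(osf_count R z)^-1 * (\sum_(0 <= d < z | odd_squarefree d) \prod_(p < L) chiX R p (f p) d) -
    \prod_(p < L) mcoef R p (f p)| <=
  2 * ((16 * sieve_const R * z%:R `^ (- 8^-1)) `^ s * \prod_(p < L) cond_wt R p (f p) `^ s).
Proof.
move=> s01 L2 /andP[z0 zL] hz f3; have zR : 0 < z%:R :> R by rewrite ltr0n.
have N8 := osf_count_ge z0 hz.
have N0 : 0 < osf_count R z by apply: lt_le_trans N8; rewrite divr_gt0.
set S := \sum_(0 <= d < z | _) _; set M := \prod_(p < L) mcoef R p (f p).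
set W := \prod_(p < L) cond_wt R p (f p).
have K0 : 0 <= sieve_const R by rewrite mulr_ge0// expR_ge0.
have w1 p j : 1 <= cond_wt R p j.
  by rewrite /cond_wt; case: ifP => // /andP[/andP[/prime_gt0 p0 _] _]; rewrite ler1n.
have W1 : 1 <= W.
  rewrite /W; elim/big_ind: _ => // x y hx hy; rewrite -[1]mulr1; apply: ler_pM => //.
have M1 : `|M| <= 1 by apply: prod_norm_le1 => p; exact: mcoef_norm.
have S1 : `|S| <= osf_count R z.
  apply: (le_trans (ler_norm_sum _ _ _)); apply: ler_sum => d _.
  by apply: prod_norm_le1 => p; exact: chiX_norm.
have h1 := @twisted_sum_estimate R f z L L2 zL f3.
have h2 := @osf_count_estimate R z L L2 zL.
rewrite -/S -/M -/W in h1; set A := z%:R * (2^-1 * sqfree_density R L) in h2.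
rewrite mulrA -/A in h1.
have h3 : `|S - osf_count R z * M| <= 2 * sieve_const R * z%:R `^ (1 - 8^-1) * W.
  rewrite (_ : S - _ = (S - A * M) - (osf_count R z - A) * M); last by ring.
  apply: (le_trans (ler_normB _ _)).
  have : `|(osf_count R z - A) * M| <= sieve_const R * z%:R `^ (1 - 8^-1) * W.
    rewrite normrM; apply: ler_pM => //; exact: le_trans W1.
  by move: h1; lra.
have e : (osf_count R z)^-1 * S - M = (osf_count R z)^-1 * (S - osf_count R z * M).
  by rewrite mulrBr mulrA mulVf ?gt_eqF// mul1r.
have iN : (osf_count R z)^-1 <= 8 / z%:R.
  by rewrite -invf_div lef_pV2 ?posrE ?divr_gt0.
rewrite -powR_prod; last by move=> p; apply: le_trans (w1 p _).
rewrite -powRM ?mulr_ge0 ?powR_ge0//; last by apply: le_trans W1.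
apply: le2_powR => //.
  apply: (le_trans (ler_normB _ _)); have -> : 2 = 1 + 1 :> R by lra.
  apply: lerD => //; rewrite normrM normfV (ger0_norm (ltW N0)).
  by rewrite mulrC ler_pdivrMr// mul1r.
rewrite e normrM ger0_norm ?invr_ge0 ?(ltW N0)//.
apply: (@le_trans _ _ (8 / z%:R * (2 * sieve_const R * z%:R `^ (1 - 8^-1) * W))).
  by apply: ler_pM => //; rewrite invr_ge0 ltW.
have -> : z%:R `^ (- 8^-1) = z%:R^-1 * z%:R `^ (1 - 8^-1) :> R.
  rewrite -[z%:R^-1]powR_inv1 ?(ltW zR)// -powRD; last by apply/implyP => _; rewrite gt_eqF.
  by congr (_ `^ _); lra.
by rewrite -/W le_eqVlt; apply/orP; left; apply/eqP; ring.
Qed.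

(** The product is expanded into one monomial per choice of exponents. Because the error for a
    monomial is multiplicative in p, the sum of all errors factors back into a product. *)
Lemma osf_mean_product (R : realType) (c : nat -> nat -> R) (z L : nat) (s : R) :
  0 <= s <= 1 -> (2 < L)%N -> (0 < z <= L)%N -> 8 * sieve_const R <= z%:R `^ 8^-1 ->
  `|(osf_count R z)^-1 * (\sum_(0 <= d < z | odd_squarefree d)
       \prod_(p < L) \sum_(j < 3) c p j * chiX R p j d) -
    \prod_(p < L) \sum_(j < 3) c p j * mcoef R p j| <=
  2 * (16 * sieve_const R * z%:R `^ (- 8^-1)) `^ s *
    \prod_(p < L) \sum_(j < 3) `|c p j| * cond_wt R p j `^ s.
Proof.
move=> s01 L2 zL hz.
have E (g : nat -> nat -> R) : \prod_(p < L) \sum_(j < 3) c p j * g p j =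
   \sum_(f : {ffun 'I_L -> 'I_3}) (\prod_(p < L) c p (f p)) * \prod_(p < L) g p (ext_ord ord0 f p).
  rewrite bigA_distr_bigA; apply: eq_bigr => f _; rewrite big_split /=; congr (_ * _).
  by apply: eq_bigr => p _; rewrite ext_ordE.
have E' : \prod_(p < L) \sum_(j < 3) `|c p j| * cond_wt R p j `^ s =
   \sum_(f : {ffun 'I_L -> 'I_3}) `|\prod_(p < L) c p (f p)| * \prod_(p < L) cond_wt R p (ext_ord ord0 f p) `^ s.
  rewrite bigA_distr_bigA; apply: eq_bigr => f _; rewrite big_split /= normr_prod; congr (_ * _).
  by apply: eq_bigr => p _; rewrite ext_ordE.
rewrite (eq_bigr _ (fun d _ => E (fun p j => chiX R p j d))) (E (mcoef R)) E'.
rewrite exchange_big /= big_distrr /= -sumrB big_distrr /=.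
apply: (le_trans (ler_norm_sum _ _ _)); apply: ler_sum => f _.
rewrite -big_distrr /= mulrCA -mulrBr normrM.
have := @twisted_mean_estimate R (fun p => ext_ord ord0 f p : nat) z L s s01 L2 zL hz (fun p => ltn_ord _).
move=> h; rewrite [leRHS]mulrCA ler_wpM2l//.
by rewrite mulrA in h.
Qed.

(** * The Euler product P_X *)

(* The exponent of the Euler factor at p of P_X, for chi(p) = e and X of integer part n. *)
Definition log_factor (R : realType) (n p : nat) (e : R) : R :=
  \sum_(1 <= j < n.+1 | (p ^ j <= n)%N) e ^+ j / (j%:R * Num.sqrt p%:R ^+ j).

(** Each prime power arises from a unique pair (p, j); the range j <= n loses nothing because j <
    p^j. *)
Lemma sum_prime_powers (R : nmodType) (F : nat -> R) (n : nat) :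
  (forall m, size (primes m) != 1%N -> F m = 0) ->
  \sum_(2 <= m < n.+1) F m =
  \sum_(1 <= p < n.+1 | prime p) \sum_(1 <= j < n.+1 | (p ^ j <= n)%N) F (p ^ j)%N.
Proof.
move=> hF.
have E1 p j : prime p -> (0 < j)%N ->
   (if (p ^ j <= n)%N then F (p ^ j)%N else 0) = \sum_(2 <= m < n.+1) (if m == (p ^ j)%N then F m else 0).
  move=> pp j0; case: ifP => pj; last first.
    rewrite big_nat big1// => m /andP[_ mn]; rewrite ifF//.
    by apply: contraFF pj => /eqP<-.
  rewrite (bigD1_seq (p ^ j)%N) ?iota_uniq//=; last first.
    by rewrite mem_index_iota ltnS pj andbT (leq_trans (prime_gt1 pp))// -{1}[p]expn1 leq_exp2l ?prime_gt1.
  by rewrite eqxx big1 ?addr0// => i /negbTE->.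
transitivity (\sum_(1 <= p < n.+1 | prime p) \sum_(1 <= j < n.+1)
    \sum_(2 <= m < n.+1) (if m == (p ^ j)%N then F m else 0)); last first.
  apply: eq_bigr => p pp; rewrite [RHS]big_mkcond /= big_nat [RHS]big_nat.
  by apply: eq_bigr => j /andP[j1 _]; rewrite E1.
rewrite [RHS](eq_bigr (fun p => \sum_(2 <= m < n.+1) \sum_(1 <= j < n.+1)
    (if m == (p ^ j)%N then F m else 0))); last by move=> p _; exact: exchange_big.
rewrite [RHS]exchange_big /=; apply: eq_big_nat => m /andP[m2 mn].
have m0 : (0 < m)%N by exact: ltnW.
have [s1|s1] := eqVneq (size (primes m)) 1%N; last first.
  rewrite hF// big1// => p _; rewrite big1// => j _; by rewrite if_same.
have [q qm] : exists q, primes m = [:: q] by case: (primes m) s1 => [|q []]// _; exists q.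
have qp : prime q /\ (q %| m)%N.
  have : q \in primes m by rewrite qm mem_head.
  by rewrite mem_primes => /and3P[].
case: qp => qp qdm.
have mE : m = (q ^ logn q m)%N.
  by have := prod_prime_decomp m0; rewrite prime_decompE qm /= big_seq1.
have l0 : (0 < logn q m)%N by rewrite logn_gt0 qm mem_head.
have lm : (logn q m < n.+1)%N.
  by rewrite ltnS (leq_trans _ (leq_trans (leqnn m) _))// {2}mE ltnW// ltn_expl// prime_gt1.
rewrite big_mkcond (bigD1_seq q) ?iota_uniq//=; last first.
  by rewrite mem_index_iota prime_gt0//= (leq_ltn_trans _ mn)// dvdn_leq.
rewrite qp (bigD1_seq (logn q m)) ?iota_uniq//=; last by rewrite mem_index_iota l0 lm.
rewrite -mE eqxx big_nat_cond big1 ?addr0; last first.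
  move=> j /andP[_ jl]; rewrite ifF//; apply/negbTE; apply: contra jl => /eqP ->.
  by rewrite pfactorK.
rewrite big_nat_cond big1 ?addr0// => p /andP[/andP[p1 _] pq]; case: ifP => // pp.
rewrite big_nat big1// => j /andP[j1 _]; rewrite ifF//; apply/negbTE; apply: contra pq => /eqP me.
have : p \in primes m by rewrite me primesX// primes_prime// mem_head.
by rewrite qm inE.
Qed.

Lemma sqrtrX (R : realType) (x : R) (j : nat) : 0 <= x -> Num.sqrt (x ^+ j) = Num.sqrt x ^+ j.
Proof.
move=> x0; elim: j => [|j IH]; first by rewrite !expr0 sqrtr1.
by rewrite !exprS sqrtrM// IH.
Qed.

(** At p^j the weight Lambda / ln equals 1/j. *)
Lemma PX_factorization (R : realType) (X : R) (d : nat) :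
  PX X (chi_8d d) = expR (\sum_(1 <= p < (Num.truncn X).+1 | prime p)
     log_factor (Num.truncn X) p (legendre (8 * d) p)%:~R).
Proof.
rewrite /PX; congr expR; move: (Num.truncn X) => n.
rewrite sum_prime_powers; last first.
  move=> m; rewrite /vonMangoldt; case: (primes m) => [|q [|q' s]]//= _; by rewrite !mul0r.
apply: eq_bigr => p pp; rewrite /log_factor big_nat_cond [RHS]big_nat_cond.
apply: eq_bigr => j /andP[/andP[j1 _] _].
have lp : ln (p%:R : R) != 0 by rewrite gt_eqF// ln_gt0// ltr1n prime_gt1.
have sp : Num.sqrt (p%:R : R) ^+ j != 0.
  by rewrite expf_neq0// gt_eqF// sqrtr_gt0 ltr0n prime_gt0.
have j0 : (j%:R : R) != 0 by rewrite pnatr_eq0 -lt0n.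
rewrite /vonMangoldt primesX// primes_prime// chi_8d_primeX// rmorphXn natrX sqrtrX//.
rewrite lnXn ?ltr0n ?prime_gt0// -[ln _ *+ j]mulr_natl.
by field; rewrite lp sp j0.
Qed.

Lemma legendre_values (u p : nat) : prime p -> odd p ->
  [\/ legendre u p = 0, legendre u p = 1 | legendre u p = -1].
Proof.
move=> pp op; rewrite legendreE//; case: ifP => _; first by constructor 1.
by case: ifP => _; [constructor 2 | constructor 3].
Qed.

Lemma log_factor0 (R : realType) (n p : nat) : log_factor n p 0 = 0 :> R.
Proof.
rewrite /log_factor big_nat_cond big1// => -[|j] /andP[/andP[]]// _ _ _.
by rewrite exprS !mul0r.
Qed.

(* Interpolation of exp (k * log_factor n p e) on e = 0, 1, -1 by a polynomial of degree 2. *)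
Definition pcoef (R : realType) (k : R) (n p j : nat) : R :=
  let gp := expR (k * log_factor n p 1) in
  let gm := expR (k * log_factor n p (-1)) in
  if j == 0%N then 1
  else if oddprime p && (p <= n)%N then
    if j == 1%N then (gp - gm) / 2 else (gp + gm) / 2 - 1
  else 0.

Lemma PX_powR (R : realType) (k X : R) (d L : nat) : (Num.truncn X < L)%N ->
  PX X (chi_8d d) `^ k =
  \prod_(p < L) \sum_(j < 3) pcoef k (Num.truncn X) p j * chiX R p j d.
Proof.
rewrite PX_factorization; move: (Num.truncn X) => n nL.
rewrite -expRM mulrC big_distrr /= expR_sum.
rewrite -(big_mkord xpredT (fun p => \sum_(j < 3) pcoef k n p j * chiX R p j d)).
case: L nL => // L nL.
rewrite [RHS]big_ltn//= (@big_cat_nat _ _ _ n.+1 1 L.+1)//=.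
have one (p : nat) : ~~ (oddprime p && (p <= n)%N) -> \sum_(j < 3) pcoef k n p j * chiX R p j d = 1.
  move=> h; rewrite !big_ord_recl big_ord0 /pcoef /= (negbTE h) !mul0r !addr0 mul1r.
  by rewrite /chiX expr0 if_same.
rewrite one// mul1r [X in _ = _ * X]big_nat [X in _ = _ * X]big1 ?mulr1; last first.
  by move=> p /andP[np _]; apply: one; rewrite negb_and -ltnNge np orbT.
rewrite big_mkcond; apply: eq_big_nat => p /andP[p1 pn]; rewrite ltnS in pn.
case: ifP => pp; last by rewrite one// /oddprime pp.
have [op|op] := boolP (odd p); last first.
  rewrite one; last by rewrite /oddprime (negbTE op) andbF.
  have -> : p = 2%N by apply/(prime_oddPn pp).
  by rewrite legendre2 log_factor0 mulr0 expR0.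
rewrite !big_ord_recl big_ord0 /pcoef /chiX /oddprime pp op pn /= /bump /= expr0 expr1 addr0.
case: (legendre_values (8 * d) pp op) => ->.
- by rewrite log_factor0 mulr0 expR0 expr0n /= !mulr0 !addr0 mulr1.
- by rewrite expr1n !mulr1; lra.
- by rewrite rmorphN /= sqrrN expr1n !mulr1; lra.
Qed.

Lemma momentE (R : realType) (k X D : R) (L : nat) : (Num.truncn X < L)%N ->
  moment k X D = (osf_count R (Num.truncn D).+1)^-1 *
    \sum_(0 <= d < (Num.truncn D).+1 | odd_squarefree d)
      \prod_(p < L) \sum_(j < 3) pcoef k (Num.truncn X) p j * chiX R p j d.
Proof.
move=> nL; rewrite /moment; congr (_^-1 * _).
  rewrite /Dstar /osf_count natr_sum [RHS]big_mkcond big_ltn//= add0r -big_mkcond.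
  by [].
rewrite [RHS]big_mkcond big_ltn//= add0r -big_mkcond; apply: eq_bigr => d _.
exact: PX_powR.
Qed.

(** * Local factors *)

(** Here x stands for p^(-1/2), and s is 1/2 or 0 according to whether the square term of the
    logarithm is kept. Averaging over the two signs cancels the terms linear in x, leaving k^2/2 + k
    s. The lower bound 2 on the pair makes the argument of the logarithm at least 1. The constant
    depends on k alone. *)
Lemma euler_factor_taylor (R : realType) (k : R) : 0 <= k -> exists2 C : R, 0 <= C &
  forall x s tp tm : R, 0 <= x <= 1 -> 0 <= s <= 2^-1 ->
  `|tp| <= 5 * x ^+ 3 -> `|tm| <= 5 * x ^+ 3 ->
  2 <= expR (k * (x + s * x ^+ 2 + tp)) + expR (k * (- x + s * x ^+ 2 + tm)) ->
  `|ln ((x ^+ 2 + (expR (k * (x + s * x ^+ 2 + tp)) + expR (k * (- x + s * x ^+ 2 + tm))) / 2) /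
      (1 + x ^+ 2)) - (k ^+ 2 / 2 + k * s) * x ^+ 2| <= C * x ^+ 3.
Proof.
move=> k0.
(* The exponent y satisfies |y| <= 7 k x, whence 343 = 7^3 in the cubic remainder; 24 = 6 + 18
   bounds the error in y^2/2, and 5 k comes from the remainder t. *)
pose E0 := 5 * k + 24 * k ^+ 2 + 343 * k ^+ 3 * expR (7 * k).
have E0p : 0 <= E0 by rewrite !addr_ge0 ?mulr_ge0 ?exprn_ge0 ?expR_ge0.
pose a1 := k ^+ 2 + k.
have a1p : 0 <= a1 by rewrite addr_ge0 ?exprn_ge0.
exists (E0 + a1 + (a1 + E0) ^+ 2); first by apply: addr_ge0; [exact: addr_ge0 | apply: exprn_ge0; exact: addr_ge0].
move=> x s tp tm /andP[x0 x1] /andP[s0 s1] htp htm.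
have x3 : 0 <= x ^+ 3 by exact: exprn_ge0.
have x2 : 0 <= x ^+ 2 by exact: exprn_ge0.
have x32 : x ^+ 3 <= x ^+ 2 by rewrite [x ^+ 3]exprS ler_piMl.
have x21 : x ^+ 2 <= x by rewrite expr2 ler_piMl.
have x43 : x ^+ 4 <= x ^+ 3 by rewrite [x ^+ 4]exprS ler_piMl.
have tay (e t : R) : `|e| = x -> e ^+ 2 = x ^+ 2 -> `|t| <= 5 * x ^+ 3 ->
    `|expR (k * (e + s * x ^+ 2 + t)) - (1 + k * e + (k * s + k ^+ 2 / 2) * x ^+ 2)| <= E0 * x ^+ 3.
  move=> ex e2 ht; set u := s * x ^+ 2 + t.
  have ub : `|u| <= 6 * x ^+ 2.
    apply: (le_trans (ler_normD _ _)); rewrite ger0_norm ?mulr_ge0//.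
    have := ler_wpM2r x2 s1; lra.
  set y := k * (e + s * x ^+ 2 + t).
  have yE : y = k * e + k * u by rewrite /y /u; ring.
  have yb : `|y| <= 7 * k * x.
    rewrite yE; apply: (le_trans (ler_normD _ _)); rewrite !normrM (ger0_norm k0) ex.
    have := ler_wpM2l k0 ub; have := ler_wpM2l k0 x21; lra.
  have y7 : `|y| <= 7 * k.
    apply: (le_trans yb); rewrite ler_piMr// mulr_ge0//.
  have T := expR_taylor2 y.
  have T2 : `|y| ^+ 3 * expR `|y| <= 343 * k ^+ 3 * expR (7 * k) * x ^+ 3.
    have -> : 343 * k ^+ 3 * expR (7 * k) * x ^+ 3 = (7 * k * x) ^+ 3 * expR (7 * k) by ring.
    apply: ler_pM; rewrite ?exprn_ge0 ?expR_ge0 ?ler_expR//.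
    by apply: lerXn2r; rewrite ?nnegrE ?mulr_ge0.
  have S1 : `|y ^+ 2 / 2 - k ^+ 2 / 2 * x ^+ 2| <= 24 * k ^+ 2 * x ^+ 3.
    have -> : y ^+ 2 / 2 - k ^+ 2 / 2 * x ^+ 2 = k ^+ 2 * (e * u + u ^+ 2 / 2).
      by rewrite yE -e2; field.
    rewrite normrM (ger0_norm (exprn_ge0 2 k0)) -mulrA mulrCA [24 * _]mulrC mulrA.
    rewrite -mulrA ler_wpM2l ?exprn_ge0//.
    apply: (le_trans (ler_normD _ _)); rewrite (normrM e) (normrM (u ^+ 2)) ex normrX (@ger0_norm _ 2^-1)//.
    have h1 : x * `|u| <= x * (6 * x ^+ 2) by apply: ler_wpM2l.
    have h2 : `|u| ^+ 2 <= (6 * x ^+ 2) ^+ 2 by apply: lerXn2r; rewrite ?nnegrE ?mulr_ge0.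
    have e1 : x * (6 * x ^+ 2) = 6 * x ^+ 3 by ring.
    have e3 : (6 * x ^+ 2) ^+ 2 = 36 * x ^+ 4 by ring.
    rewrite e1 in h1; rewrite e3 in h2; lra.
  have S2 : `|k * t| <= 5 * k * x ^+ 3.
    by rewrite normrM (ger0_norm k0); have := ler_wpM2l k0 ht; lra.
  have -> : expR y - (1 + k * e + (k * s + k ^+ 2 / 2) * x ^+ 2) =
    (expR y - (1 + y + y ^+ 2 / 2)) + (y ^+ 2 / 2 - k ^+ 2 / 2 * x ^+ 2) + k * t.
    by rewrite [in LHS]/y [in RHS](_ : 1 + y + _ = 1 + (k * e + k * s * x ^+ 2 + k * t) + y ^+ 2 / 2); [ring | rewrite yE /u; ring].
  apply: (le_trans (ler_normD _ _)); apply: (le_trans (lerD (ler_normD _ _) (lexx _))).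
  by rewrite /E0; move: T T2 S1 S2; lra.
have ax : `|x| = x by rewrite ger0_norm.
have anx : `|- x| = x by rewrite normrN ger0_norm.
have := tay _ _ ax erefl htp; have := tay _ _ anx (sqrrN x) htm.
set gm := expR (k * (- x + _ + _)); set gp := expR (k * (x + _ + _)).
move=> hm hp G2.
pose al := k ^+ 2 / 2 + k * s.
have al0 : 0 <= al by rewrite addr_ge0 ?mulr_ge0 ?exprn_ge0.
have ala : al <= a1.
  have := ler_wpM2l k0 s1; have := exprn_ge0 2 k0; rewrite /al /a1; lra.
pose E := (gp + gm) / 2 - 1 - al * x ^+ 2.
have Eb : `|E| <= E0 * x ^+ 3.
  move: hm hp; rewrite /E /al !ler_norml => /andP[? ?] /andP[? ?]; apply/andP; split; lra.
pose v := (al * x ^+ 2 + E) / (1 + x ^+ 2).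
have p1 : 0 < 1 + x ^+ 2 by rewrite addrC ltr_wpDl.
have vE : (x ^+ 2 + (gp + gm) / 2) / (1 + x ^+ 2) = 1 + v.
  rewrite /v (_ : al * x ^+ 2 + E = (gp + gm) / 2 - 1); last by rewrite /E; ring.
  by field; rewrite gt_eqF.
have num0 : 0 <= al * x ^+ 2 + E.
  rewrite (_ : al * x ^+ 2 + E = (gp + gm) / 2 - 1); last by rewrite /E; ring.
  lra.
have v0 : 0 <= v by rewrite divr_ge0// ltW.
have vle : v <= (a1 + E0) * x ^+ 2.
  rewrite /v ler_pdivrMr//; have hE := ler_norm E.
  have h1 : al * x ^+ 2 <= a1 * x ^+ 2 by apply: ler_wpM2r.
  have h2 : E0 * x ^+ 3 <= E0 * x ^+ 2 by apply: ler_wpM2l.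
  have h3 : 0 <= (a1 + E0) * x ^+ 2 * x ^+ 2 by rewrite !mulr_ge0// addr_ge0.
  rewrite mulrDr mulr1; lra.
have vd : `|v - al * x ^+ 2| <= (E0 + a1) * x ^+ 3.
  have -> : v - al * x ^+ 2 = (E - al * x ^+ 4) / (1 + x ^+ 2).
    by rewrite /v; field; rewrite gt_eqF.
  rewrite normrM normfV (ger0_norm (ltW p1)) ler_pdivrMr//.
  apply: (le_trans (ler_normB _ _)); rewrite normrM (ger0_norm al0) (ger0_norm (exprn_ge0 4 x0)).
  have h1 : al * x ^+ 4 <= a1 * x ^+ 3 by apply: ler_pM => //; exact: exprn_ge0.
  have h3 : 0 <= (E0 + a1) * x ^+ 3 * x ^+ 2 by rewrite !mulr_ge0// addr_ge0.
  rewrite mulrDr mulr1; lra.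
have v1 : 0 < 1 + v by rewrite addrC ltr_wpDl.
have l1 : ln (1 + v) <= v by have := ln_le_subr1 v1; lra.
have l2 : v - v ^+ 2 <= ln (1 + v).
  apply: le_trans (ln_ge_1subV v1).
  have -> : 1 - (1 + v)^-1 = v / (1 + v) by field; rewrite gt_eqF.
  rewrite ler_pdivlMr//; have : 0 <= v ^+ 3 by exact: exprn_ge0.
  by rewrite (_ : (v - v ^+ 2) * (1 + v) = v - v ^+ 3); [lra | ring].
have vv : v ^+ 2 <= (a1 + E0) ^+ 2 * x ^+ 3.
  apply: (@le_trans _ _ (((a1 + E0) * x ^+ 2) ^+ 2)).
    by apply: lerXn2r; rewrite ?nnegrE// mulr_ge0// addr_ge0.
  rewrite exprMn -exprM ler_wpM2l// exprn_ge0// addr_ge0//.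
rewrite vE -/al; move: vd vv l1 l2; rewrite !ler_norml => /andP[? ?] ? ? ?.
by apply/andP; split; lra.
Qed.

Definition rootV (R : realType) (p : nat) : R := (Num.sqrt p%:R)^-1.

(** A rational bound for 1 / sqrt 3; the value 3/5 gives 1 / (1 - x) <= 5/2 in the remainders
    below. *)
Lemma rootV_bounds (R : realType) (p : nat) : (2 < p)%N -> 0 < rootV R p <= 3 / 5.
Proof.
move=> p3; have s0 : 0 < Num.sqrt (p%:R : R) by rewrite sqrtr_gt0 ltr0n; lia.
rewrite /rootV invr_gt0 s0 /= -[3 / 5]invrK lef_pV2 ?posrE// invf_div.
have : (5 / 3 : R) ^+ 2 <= Num.sqrt (p%:R : R) ^+ 2.
  rewrite sqr_sqrtr//; apply: (@le_trans _ _ 3%:R); last by rewrite ler_nat.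
  by rewrite exprMn; lra.
by rewrite ler_pXn2r// nnegrE ?sqrtr_ge0//; lra.
Qed.

Lemma rootV_sqr (R : realType) (p : nat) : rootV R p ^+ 2 = p%:R^-1.
Proof. by rewrite /rootV exprVn sqr_sqrtr. Qed.

Lemma rootV_cube (R : realType) (p : nat) : (0 < p)%N -> rootV R p ^+ 3 = p%:R `^ (- (3 / 2)).
Proof.
move=> p0; rewrite /rootV -powR12_sqrt// -[(p%:R `^ 2^-1)^-1]powR_inv1 ?powR_ge0// -powRrM -powR_mulrn ?powR_ge0//.
by rewrite -powRrM; congr (_ `^ _); lra.
Qed.

Lemma log_factorE (R : realType) (n p : nat) (e : R) : prime p -> (0 < n)%N ->
  log_factor n p e = \sum_(1 <= j < (trunc_log p n).+1) (e * rootV R p) ^+ j / j%:R.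
Proof.
move=> pp n0; have p1 := prime_gt1 pp; set J := trunc_log p n.
have Jn : (J.+1 <= n.+1)%N.
  by rewrite ltnS ltnW// (leq_trans (ltn_expl J p1))// trunc_logP.
rewrite /log_factor (@big_cat_nat _ _ _ J.+1)//= [X in _ + X]big_nat_cond [X in _ + X]big1 ?addr0; last first.
  by move=> j /andP[/andP[Jj _] /(trunc_log_max p1)]; rewrite leqNgt Jj.
rewrite big_mkcond; apply: eq_big_nat => j /andP[j1 jJ].
rewrite ifT; last by rewrite (leq_trans _ (trunc_logP p1 n0))// leq_exp2l.
by rewrite exprMn /rootV exprVn invfM; ring.
Qed.

Lemma log_factor_ln (R : realType) (n p : nat) (e : R) : prime p -> odd p -> (0 < n)%N ->
  `|e| = 1 -> `|- ln (1 - e * rootV R p) - log_factor n p e| <=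
     5 / 2 * rootV R p ^+ (trunc_log p n).+1.
Proof.
move=> pp op n0 e1; have /andP[x0 x1] := @rootV_bounds R p (odd_prime_gt2 op pp).
have ex : `|e * rootV R p| = rootV R p by rewrite normrM e1 mul1r ger0_norm// ltW.
rewrite log_factorE//; apply: (le_trans (ln_series _ _)); rewrite ex; first by lra.
rewrite mulrC ler_wpM2r ?(exprn_ge0 _ (ltW x0))//.
have -> : 5 / 2 = (2 / 5)^-1 :> R by rewrite invf_div.
by rewrite lef_pV2 ?posrE; lra.
Qed.

(** The truncation at n = p^2 keeps exactly the first two terms of the series. *)
Lemma ln_order2 (R : realType) (p : nat) (e : R) : prime p -> odd p ->
  `|e| = 1 -> `|- ln (1 - e * rootV R p) - (e * rootV R p + 2^-1 * rootV R p ^+ 2)| <=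
     5 / 2 * rootV R p ^+ 3.
Proof.
move=> pp op e1; have p1 := prime_gt1 pp.
have := @log_factor_ln R (p ^ 2) p e pp op; rewrite trunc_expnK//.
rewrite log_factorE ?expn_gt0 ?prime_gt0// trunc_expnK// => /(_ isT e1).
have e2 : e ^+ 2 = 1 by rewrite -real_normK ?num_real// e1 expr1n.
by rewrite big_nat_recr//= big_nat1 expr1 divr1 exprMn e2 mul1r [rootV R p ^+ 2 / 2]mulrC.
Qed.

(** This is where the truncation at prime powers shows: for p^2 > n only the linear term is present.
    Otherwise both the truncated series and its second-order part are within 5/2 x^3 of the
    logarithm. *)
Lemma log_factor_order2 (R : realType) (n p : nat) (e : R) : prime p -> odd p -> (p <= n)%N ->
  `|e| = 1 -> `|log_factor n p e -
    (e * rootV R p + (if (p ^ 2 <= n)%N then 2^-1 else 0) * rootV R p ^+ 2)| <= 5 * rootV R p ^+ 3.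
Proof.
move=> pp op pn e1; have p1 := prime_gt1 pp; have p0 := prime_gt0 pp.
have n0 : (0 < n)%N by exact: leq_trans pn.
have /andP[x0 x1] := @rootV_bounds R p (odd_prime_gt2 op pp).
have x3 : 0 <= rootV R p ^+ 3 by rewrite exprn_ge0 ?ltW.
case: ifP => p2.
  have J2 : (2 <= trunc_log p n)%N by exact: trunc_log_max.
  have h1 := log_factor_ln pp op n0 e1; have h2 := ln_order2 pp op e1.
  have h3 : rootV R p ^+ (trunc_log p n).+1 <= rootV R p ^+ 3.
    by apply: ler_wiXn2l => //; [exact: ltW | lra].
  move: h1 h2; rewrite !ler_norml => /andP[? ?] /andP[? ?]; apply/andP; split; lra.
have -> : log_factor n p e = e * rootV R p.
  have J1 : trunc_log p n = 1%N.
    apply/eqP; rewrite eqn_leq trunc_log_max ?expn1// andbT leqNgt; apply/negP => J2.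
    have := trunc_logP p1 n0; move: p2; rewrite leqNgt => /negbFE nlt.
    by rewrite leqNgt (leq_trans nlt)// leq_exp2l.
  by rewrite log_factorE// J1 big_nat1 expr1 divr1.
by rewrite mul0r addr0 subrr normr0 mulr_ge0.
Qed.

Lemma cvgn_expR (R : realType) (u : nat -> R) (l : R) :
  u @ \oo --> l -> (fun n => expR (u n)) @ \oo --> expR l.
Proof. by move=> ul; apply: (cvg_comp u expR ul); exact: continuous_expR. Qed.

Lemma cvgn_ln (R : realType) (u : nat -> R) (l : R) : 0 < l ->
  u @ \oo --> l -> (fun n => ln (u n)) @ \oo --> ln l.
Proof. by move=> l0 ul; apply: (cvg_comp u (@ln R) ul); exact: continuous_ln. Qed.

(** The mean of the k-th power of the factor at p: over odd squarefree d the character takes the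
    value 0 with density 1/(p+1) and each of 1 and -1 with density p / (2(p+1)). *)
Definition local_factor (R : realType) (k : R) (n p : nat) : R :=
  (p%:R^-1 + (expR (k * log_factor n p 1) + expR (k * log_factor n p (-1))) / 2) / (1 + p%:R^-1).

Definition limit_factor (R : realType) (k : R) (p : nat) : R :=
  (p%:R^-1 + ((1 - rootV R p) `^ (- k) + (1 + rootV R p) `^ (- k)) / 2) / (1 + p%:R^-1).

Lemma log_factor_even_ge0 (R : realType) (n p : nat) :
  0 <= log_factor n p 1 + log_factor n p (-1) :> R.
Proof.
rewrite /log_factor -big_split /=; apply: sumr_ge0 => j _; rewrite -mulrDl.
apply: mulr_ge0; last by rewrite invr_ge0 mulr_ge0// exprn_ge0// sqrtr_ge0.
by rewrite expr1n -signr_odd; case: odd; rewrite ?expr1 ?expr0 ?subrr.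
Qed.

Lemma expR_pair_ge2 (R : realType) (a b : R) : 0 <= a + b -> 2 <= expR a + expR b.
Proof. by move=> ab; have := expR_ge1Dx a; have := expR_ge1Dx b; lra. Qed.

Lemma local_pair_ge2 (R : realType) (k : R) (n p : nat) : 0 <= k ->
  2 <= expR (k * log_factor n p 1) + expR (k * log_factor n p (-1)).
Proof.
move=> k0; apply: expR_pair_ge2; rewrite -mulrDr mulr_ge0//; exact: log_factor_even_ge0.
Qed.

Lemma local_factor_ge1 (R : realType) (k : R) (n p : nat) : 0 <= k -> (0 < p)%N ->
  1 <= local_factor k n p.
Proof.
move=> k0 p0; have := @local_pair_ge2 R k n p k0.
have i0 : 0 <= (p%:R : R)^-1 by rewrite invr_ge0.
rewrite /local_factor ler_pdivlMr ?mul1r; last by rewrite addrC ltr_wpDl.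
move: (p%:R^-1) => u; lra.
Qed.

Lemma powR_rootV (R : realType) (k e : R) (p : nat) : oddprime p -> `|e| = 1 ->
  (1 - e * rootV R p) `^ (- k) = expR (k * - ln (1 - e * rootV R p)).
Proof.
move=> /andP[pp op] e1; have /andP[x0 x1] := @rootV_bounds R p (odd_prime_gt2 op pp).
have h : `|e * rootV R p| = rootV R p by rewrite normrM e1 mul1r ger0_norm// ltW.
have := ler_norm (e * rootV R p); rewrite h => h2.
rewrite /powR gt_eqF; last by lra.
by congr expR; ring.
Qed.

Lemma limit_factorE (R : realType) (k : R) (p : nat) : oddprime p -> limit_factor k p =
  (p%:R^-1 + (expR (k * - ln (1 - 1 * rootV R p)) + expR (k * - ln (1 - (-1) * rootV R p))) / 2) /
   (1 + p%:R^-1).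
Proof.
move=> opp; rewrite -!powR_rootV ?normrN ?normr1// /limit_factor mul1r.
by rewrite mulN1r opprK.
Qed.

Lemma factor_ln_bound (R : realType) (k : R) : 0 <= k -> exists2 C : R, 0 <= C &
  forall p, oddprime p ->
   (forall n, (p <= n)%N -> `|ln (local_factor k n p) -
     (k ^+ 2 / 2 + k * (if (p ^ 2 <= n)%N then 2^-1 else 0)) * p%:R^-1| <= C * p%:R `^ (- (3 / 2))) /\
   `|ln (limit_factor k p) - (k ^+ 2 / 2 + k * 2^-1) * p%:R^-1| <= C * p%:R `^ (- (3 / 2)).
Proof.
move=> k0; have [C C0 HC] := euler_factor_taylor k0; exists C => // p opp.
have /andP[pp op] := opp; have p0 := prime_gt0 pp.
have /andP[x0 x1] := @rootV_bounds R p (odd_prime_gt2 op pp).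
have n1 : `|1| = 1 :> R by rewrite normr1.
have nm1 : `|-1| = 1 :> R by rewrite normrN normr1.
have x01 : 0 <= rootV R p <= 1 by rewrite ltW//=; lra.
rewrite -rootV_cube// -(rootV_sqr R p); split=> [n pn|].
  set s := if _ then _ else _.
  have s01 : 0 <= s <= 2^-1 by rewrite /s; case: ifP => _; lra.
  have h1 := log_factor_order2 pp op pn n1; have h2 := log_factor_order2 pp op pn nm1.
  rewrite -/s mul1r in h1; rewrite -/s mulN1r in h2.
  have := HC _ s _ _ x01 s01 h1 h2.
  rewrite ![rootV R p + s * _ + _]addrC subrK ![- rootV R p + s * _ + _]addrC subrK.
  by move/(_ (local_pair_ge2 n p k0)); rewrite /local_factor -(rootV_sqr R p).
have s01 : 0 <= (2^-1 : R) <= 2^-1 by lra.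
have h1 := @ln_order2 R p 1 pp op n1; have h2 := @ln_order2 R p (-1) pp op nm1.
rewrite mul1r in h1; rewrite mulN1r in h2.
have x3 : 0 <= rootV R p ^+ 3 by rewrite exprn_ge0// ltW.
have c52 : 5 / 2 * rootV R p ^+ 3 <= 5 * rootV R p ^+ 3 by lra.
have := HC _ _ _ _ x01 s01 (le_trans h1 c52) (le_trans h2 c52).
rewrite ![rootV R p + 2^-1 * _ + _]addrC subrK ![- rootV R p + 2^-1 * _ + _]addrC subrK.
rewrite limit_factorE// -(rootV_sqr R p) mul1r mulN1r; apply.
apply: expR_pair_ge2; rewrite -mulrDr mulr_ge0// -opprD -lnM ?posrE; [|lra|lra].
rewrite oppr_ge0 ln_le0// (_ : _ * _ = 1 - rootV R p ^+ 2); last by ring.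
by rewrite lerBlDr lerDl exprn_ge0// ltW.
Qed.

Lemma log_factor_cvg (R : realType) (p : nat) (e : R) : oddprime p -> `|e| = 1 ->
  (fun n => log_factor n p e) @ \oo --> - ln (1 - e * rootV R p).
Proof.
move=> /andP[pp op] e1; have p1 := prime_gt1 pp.
have /andP[x0 x1] := @rootV_bounds R p (odd_prime_gt2 op pp).
have ax : `|rootV R p| < 1 by rewrite ger0_norm; [lra | exact: ltW].
have g : (fun n => rootV R p ^+ n) @ \oo --> 0 by exact: cvg_expr.
apply/cvgrPdist_le => ep ep0.
have ep1 : 0 < ep * (2 / 5) by rewrite mulr_gt0.
have /cvgrPdist_le/(_ _ ep1)[N _ HN] := g.
exists (p ^ N)%N => // n /= pn.
have n0 : (0 < n)%N by rewrite (leq_trans _ pn)// expn_gt0 prime_gt0.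
apply: (le_trans (log_factor_ln pp op n0 e1)).
have JN : (N <= (trunc_log p n).+1)%N by rewrite leqW// trunc_log_max.
have := HN _ JN; rewrite /= sub0r normrN ger0_norm ?exprn_ge0 ?(ltW x0)//.
by lra.
Qed.

Lemma local_factor_cvg (R : realType) (k : R) (p : nat) : oddprime p ->
  (fun n => local_factor k n p) @ \oo --> limit_factor k p.
Proof.
move=> opp; rewrite limit_factorE//.
have n1 : `|1| = 1 :> R by rewrite normr1.
have nm1 : `|-1| = 1 :> R by rewrite normrN normr1.
have E (e : R) : `|e| = 1 ->
    (fun n => expR (k * log_factor n p e)) @ \oo --> expR (k * - ln (1 - e * rootV R p)).
  move=> e1; apply: cvgn_expR.
  by apply: cvgMr; exact: log_factor_cvg.
apply: cvgMl; apply: cvgD; first exact: cvg_cst.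
by apply: cvgMl; apply: cvgD; exact: E.
Qed.

Lemma limit_factor_ge1 (R : realType) (k : R) (p : nat) : 0 <= k -> oddprime p ->
  1 <= limit_factor k p.
Proof.
move=> k0 opp; have h n : (0 <= n)%N -> 1 <= local_factor k n p.
  by move=> _; apply: local_factor_ge1 => //; apply: prime_gt0; case/andP: opp.
have c := @local_factor_cvg R k p opp.
refine (@cvgn_ge_lb R _ _ _ _ c h).
Qed.

Lemma a_Sp_factorE (R : realType) (k : R) (p : nat) : 0 <= k -> oddprime p ->
  a_Sp_factor k p = expR (ln (limit_factor k p) + k * (k + 1) / 2 * ln (1 - p%:R^-1)).
Proof.
move=> k0 opp; have L1 := limit_factor_ge1 k0 opp; have /andP[pp _] := opp.
have /andP[y0 y1] := prime_inv_bounds R pp.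
rewrite expRD lnK ?posrE; last by lra.
rewrite /a_Sp_factor /limit_factor /rootV.
have -> : (1 - p%:R^-1) `^ (k * (k + 1) / 2) = expR (k * (k + 1) / 2 * ln (1 - p%:R^-1)) :> R.
  by rewrite /powR gt_eqF//; lra.
ring.
Qed.

Section LocalProduct.
Context (R : realType) (k : R) (k0 : 0 <= k).

Let K : R := k * (k + 1) / 2.

(** The exponent of 1 - 1/p cancels the term of order 1/p: it is K = k^2/2 + k/2 when p^2 <= n, and
    k^2/2 when the square term is missing. What remains is O(p^(-3/2)) uniformly in n >= p. *)
Let r (n p : nat) : R := if oddprime p then
  ln (local_factor k n p) + (K - (if (p ^ 2 <= n)%N then 0 else k / 2)) * ln (1 - p%:R^-1) else 0.

Let ell (p : nat) : R := if oddprime p then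
  ln (limit_factor k p) + K * ln (1 - p%:R^-1) else 0.

Let r_bound : exists2 C : R, 0 <= C & forall p, (0 < p)%N ->
  (forall n, (p <= n)%N -> `|r n p| <= C * p%:R `^ (- (3 / 2))) /\
  `|ell p| <= C * p%:R `^ (- (3 / 2)).
Proof.
have [C C0 HC] := factor_ln_bound k0.
have K0 : 0 <= K by rewrite /K divr_ge0// mulr_ge0// addr_ge0.
exists (C + 2 * K) => [|p p0]; first by rewrite addr_ge0// mulr_ge0.
rewrite /r /ell; case: ifP => opp; last first.
  have nn : 0 <= (C + 2 * K) * p%:R `^ (- (3 / 2)).
    by apply: mulr_ge0; [apply: addr_ge0 => //; exact: mulr_ge0 | exact: powR_ge0].
  by rewrite normr0; split.
have [H1 H2] := HC p opp; have /andP[pp _] := opp.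
have /andP[a1 a2] := Nln_1sub_bounds (prime_inv_bounds R pp).
have a3 := @sqrV_le_powR32 R p p0.
set y := p%:R^-1 in H1 H2 a1 a2 a3 *; set P := _ `^ _ in H1 H2 a3 *.
have main (A c : R) : 0 <= c -> c <= K -> `|A - c * y| <= C * P ->
    `|A + c * ln (1 - y)| <= (C + 2 * K) * P.
  move=> c0 cK hA.
  have h : `|c * (- ln (1 - y) - y)| <= K * (2 * P).
    rewrite normrM (ger0_norm c0) (ger0_norm a1); apply: ler_pM => //.
    by apply: (le_trans a2); rewrite ler_wpM2l.
  have -> : A + c * ln (1 - y) = (A - c * y) - c * (- ln (1 - y) - y) by ring.
  apply: (le_trans (ler_normB _ _)); lra.
split=> [n pn|].
  have := H1 n pn; case: ifP => _ h.
    rewrite subr0; apply: main => //.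
    by rewrite (_ : K = k ^+ 2 / 2 + k * 2^-1)//; rewrite /K; field.
  apply: main.
  - by rewrite (_ : K - k / 2 = k ^+ 2 / 2); [rewrite divr_ge0// exprn_ge0 | rewrite /K; field].
  - by rewrite lerBlDr lerDl divr_ge0.
  - by rewrite (_ : K - k / 2 = k ^+ 2 / 2 + k * 0)//; rewrite /K; field.
apply: main => //.
by rewrite (_ : K = k ^+ 2 / 2 + k * 2^-1)//; rewrite /K; field.
Qed.

Let r_cvg p : (0 < p)%N -> (fun n => r n p) @ \oo --> ell p.
Proof.
move=> p0; rewrite /r /ell; case: ifP => opp; last exact: cvg_cst.
have c : (fun n => ln (local_factor k n p) + K * ln (1 - p%:R^-1)) @ \oo -->
     ln (limit_factor k p) + K * ln (1 - p%:R^-1).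
  apply: cvgD; last exact: cvg_cst.
  apply: cvgn_ln; last exact: local_factor_cvg.
  by apply: lt_le_trans (limit_factor_ge1 k0 opp).
(* For fixed p the correction k/2 disappears as soon as n >= p^2, so [ell] carries the full exponent
   K. *)
apply: cvg_trans c; apply: near_eq_cvg; exists (p ^ 2)%N => // n /= pn.
by rewrite pn subr0.
Qed.

Let Lam : R := limn (fun n => \sum_(1 <= m < n) ell m).

(** The logarithms of the factors form an absolutely convergent series, so the [limn] in [a_Sp] is a
    genuine limit and the constant is positive. *)
Lemma a_Sp_value : a_Sp k = expR (- (k * (k + 2) / 2) * ln 2 + Lam).
Proof.
rewrite expRD /a_Sp /powR (gt_eqF (ltr0n R 2)); congr (_ * _).
have [C C0 HC] := r_bound.
have c : cvgn (fun n => \sum_(1 <= m < n) ell m).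
  by apply: (@cvg_sum_powR32 _ _ C) => m m1; have [] := HC m m1.
have -> : (fun N => \prod_(3 <= p < N | prime p) a_Sp_factor k p) =
   (fun N => expR (\sum_(1 <= m < N) ell m)).
  apply/funext => N; rewrite expR_sum.
  case: N => [|[|[|N]]]; try by rewrite !big_geq.
    by rewrite big_geq// big_nat1 /ell /= expR0.
  rewrite [RHS]big_ltn// [X in _ = _ * X]big_ltn// /ell /= !expR0 !mul1r.
  rewrite big_mkcond; apply: eq_big_nat => p /andP[p3 _].
  rewrite /oddprime; case: ifP => pp /=; last by rewrite expR0.
  have op : odd p.
    by apply/negPn; apply/negP => /(prime_oddPn pp) p2; rewrite p2 in p3.
  by rewrite op a_Sp_factorE// /oddprime pp.
by apply: cvg_lim => //; apply: cvgn_expR; exact: c.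
Qed.

Lemma local_factor_sum : (fun n => \sum_(1 <= p < n.+1 | oddprime p) ln (local_factor k n p) +
   \sum_(1 <= p < n.+1 | oddprime p) (K - (if (p ^ 2 <= n)%N then 0 else k / 2)) * ln (1 - p%:R^-1))
   @ \oo --> Lam.
Proof.
have [C C0 HC] := r_bound.
have := @tannery R r ell C.
have -> : (fun n => \sum_(1 <= m < n.+1) r n m) = (fun n => \sum_(1 <= p < n.+1 | oddprime p) ln (local_factor k n p) +
   \sum_(1 <= p < n.+1 | oddprime p) (K - (if (p ^ 2 <= n)%N then 0 else k / 2)) * ln (1 - p%:R^-1)).
  by apply/funext => n; rewrite -big_split [RHS]big_mkcond.
apply => [n m /andP[m1 mn]|m m1]; last exact: r_cvg.
by have [h _] := HC m m1; exact: h.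
Qed.

End LocalProduct.

(** * The product of the local factors *)

Lemma cvgn_comp_infty (R : realType) (u : nat -> R) (phi : nat -> nat) (l : R) :
  (forall N, exists M, forall n, (M <= n)%N -> (N <= phi n)%N) ->
  u @ \oo --> l -> (fun n => u (phi n)) @ \oo --> l.
Proof.
move=> hphi /cvgrPdist_le ul; apply/cvgrPdist_le => e e0.
have [N _ HN] := ul e e0; have [M HM] := hphi N; exists M => // n /= Mn.
by apply: HN => /=; exact: HM.
Qed.

Section SqrtTruncation.
Context (R : realType).

Let m (n : nat) : nat := Num.truncn (Num.sqrt (n%:R : R)).

Let le_m (p n : nat) : (p <= m n)%N = (p ^ 2 <= n)%N.
Proof.
rewrite /m truncn_ge_nat ?sqrtr_ge0// -(ler_nat R (p ^ 2)%N) natrX.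
by rewrite -[X in _ = (_ <= X)](sqr_sqrtr (ler0n R n)) ler_pXn2r ?nnegrE ?sqrtr_ge0.
Qed.

Let ln_ratio_cvg : (fun n => ln (m n)%:R / ln n%:R) @ \oo --> (2^-1 : R).
Proof.
apply/cvgrPdist_le => e e0.
have /cvgrPdist_le/(_ _ e0)[N _ HN] := @cvg_inv_ln R.
exists (maxn N 4) => // n /=; rewrite geq_max => /andP[Nn n4].
have n0 : 0 < n%:R :> R by rewrite ltr0n; lia.
have ln0' : 0 < ln (n%:R : R) by rewrite ln_gt0// ltr1n; lia.
have m2 : (2 <= m n)%N by rewrite le_m.
have mR : 0 < (m n)%:R :> R by rewrite ltr0n; lia.
have sR : 0 < Num.sqrt (n%:R : R) by rewrite sqrtr_gt0.
have e1 : ln (n%:R : R) = 2 * ln (Num.sqrt n%:R).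
  by rewrite -[in LHS](sqr_sqrtr (ltW n0)) lnXn// mulr2n; ring.
have up : ln (m n)%:R <= ln (Num.sqrt (n%:R : R)).
  by rewrite ler_ln ?posrE// -truncn_ge_nat// ltW.
have lo : ln (Num.sqrt (n%:R : R)) - ln 2 <= ln (m n)%:R.
  rewrite -ln_div ?posrE// ler_ln ?posrE ?divr_gt0// ler_pdivrMr//.
  apply: ltW; apply: (lt_le_trans (truncnS_gt _)); rewrite -natrM ler_nat -/(m n); lia.
have hN := HN n Nn; rewrite /= sub0r normrN ger0_norm ?invr_ge0 ?(ltW ln0')// in hN.
have l2 := ln2_le1 R.
rewrite -(ler_pM2r ln0') -[X in _ * X <= _](ger0_norm (ltW ln0')) -normrM mulrBl divfK ?gt_eqF//.
have h : 1 <= e * ln (n%:R : R) by rewrite -ler_pdivrMr// mul1r.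
rewrite ler_norml; apply/andP; split; lra.
Qed.

Let lnln_sqrt_cvg : (fun n => ln (ln n%:R) - ln (ln (m n)%:R)) @ \oo --> ln (2 : R).
Proof.
have h : (fun n => - ln (ln (m n)%:R / ln n%:R)) @ \oo --> - ln (2^-1 : R).
  by apply: cvgN; apply: cvgn_ln => //; exact: ln_ratio_cvg.
rewrite lnV ?posrE// opprK in h; apply: cvg_trans h; apply: near_eq_cvg.
exists 4%N => // n /= n4.
have m2 : (2 <= m n)%N by rewrite le_m.
by rewrite ln_div ?posrE ?ln_gt0 ?ltr1n ?opprB//; lia.
Qed.

(** Mertens' third theorem at n and at the integer part of sqrt n: the constants gamma cancel and ln
    ln n - ln ln sqrt n tends to ln 2. *)
Lemma mertens_sum_sqrt : (fun n => mertens_sum R n - mertens_sum R (m n)) @ \oo --> ln (2 : R).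
Proof.
have h1 := @mertens3 R.
have h2 : (fun n => mertens_sum R (m n) - ln (ln (m n)%:R)) @ \oo --> euler_gamma R.
  apply: (cvgn_comp_infty (phi := m) _ h1) => N; exists (N ^ 2)%N => n hn.
  by rewrite le_m.
have h3 : (fun n => (mertens_sum R n - ln (ln n%:R)) - (mertens_sum R (m n) - ln (ln (m n)%:R)) +
    (ln (ln n%:R) - ln (ln (m n)%:R))) @ \oo --> euler_gamma R - euler_gamma R + ln (2 : R).
  by apply: cvgD; [exact: cvgB | exact: lnln_sqrt_cvg].
rewrite subrr add0r in h3; apply: cvg_trans h3; apply: near_eq_cvg.
by exists 0%N => // n _ /=; ring.
Qed.

Lemma mertens_sum_above_sqrt (n : nat) :
  \sum_(1 <= p < n.+1 | prime p) (if (p ^ 2 <= n)%N then 0 else - ln (1 - p%:R^-1)) =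
  mertens_sum R n - mertens_sum R (m n).
Proof.
have mn : ((m n).+1 <= n.+1)%N.
  rewrite ltnS; have : (m n <= m n)%N by []; rewrite {2}/m -/(m n) le_m => h.
  by apply: leq_trans h; rewrite -mulnn; case: (m n) => // k; rewrite leq_pmulr.
rewrite /mertens_sum (@big_cat_nat _ _ _ (m n).+1)//=.
rewrite [X in _ = X - _](@big_cat_nat _ _ _ (m n).+1)//= [RHS]addrAC subrr add0r.
rewrite [X in X + _]big_nat_cond [X in X + _]big1 ?add0r; last first.
  by move=> p /andP[/andP[_ pm] _]; rewrite ifT// -le_m -ltnS.
rewrite big_nat_cond [RHS]big_nat_cond; apply: eq_bigr => p /andP[/andP[mp _] _].
by rewrite ifF// -le_m leqNgt mp.
Qed.

End SqrtTruncation.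

Lemma prime_sum_split2 (R : nmodType) (F : nat -> R) (n : nat) : (2 <= n)%N ->
  \sum_(1 <= p < n.+1 | prime p) F p = F 2%N + \sum_(1 <= p < n.+1 | oddprime p) F p.
Proof.
move=> n2; rewrite (bigID odd) /= addrC; congr (_ + _).
rewrite big_mkcond (bigD1_seq 2%N) ?iota_uniq//=; last by rewrite mem_index_iota ltnS.
rewrite big1 ?addr0// => p p2; case: ifP => // /andP[pp op].
by case/eqP: p2; apply/(prime_oddPn pp).
Qed.

Definition local_product (R : realType) (k : R) (n : nat) : R :=
  \prod_(1 <= p < n.+1 | oddprime p) local_factor k n p.

Lemma local_product_ge1 (R : realType) (k : R) (n : nat) : 0 <= k -> 1 <= local_product k n.
Proof.
move=> k0; rewrite /local_product big_nat_cond.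
elim/big_ind: _ => [|x y hx hy|p /andP[/andP[p1 _] _]] //; last exact: local_factor_ge1.
by rewrite -[1]mulr1; apply: ler_pM.
Qed.

(** The power of 2 in the constant has two sources. Mertens' product contains the prime 2, whose
    removal gives 2^(-K) with K = k(k+1)/2; the primes above sqrt n give 2^(-k/2). Together they
    make 2^(-k(k+2)/2). *)
Lemma local_product_asymptotic (R : realType) (k : R) : 0 <= k ->
  (fun n => ln (local_product k n) -
    ln (a_Sp k * (expR (euler_gamma R) * ln n%:R) `^ (k * (k + 1) / 2))) @ \oo --> 0.
Proof.
move=> k0; set K := k * (k + 1) / 2.
have hL := local_factor_sum k0; have hA := @mertens3 R; have hS := @mertens_sum_sqrt R.
have aE := a_Sp_value k0.
move: hL aE; rewrite -/K; set Lam := limn _ => hL aE.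
set Sq := fun n => mertens_sum R n - mertens_sum R _ in hS.
set T := fun n => _ + _ in hL.
have lim : (fun n => (T n - Lam) + K * (mertens_sum R n - ln (ln n%:R) - euler_gamma R) -
     k / 2 * (Sq n - ln 2)) @ \oo -->
    ((Lam - Lam) + K * (euler_gamma R - euler_gamma R) - k / 2 * (ln 2 - ln 2)).
  apply: cvgB; last by apply: cvgMr; apply: cvgB; [exact: hS | exact: cvg_cst].
  apply: cvgD; first by apply: cvgB; [exact: hL | exact: cvg_cst].
  by apply: cvgMr; apply: cvgB; [exact: hA | exact: cvg_cst].
rewrite !subrr !mulr0 addr0 subrr in lim.
apply: cvg_trans lim; apply: near_eq_cvg; exists 4%N => // n /= n4.
have n2 : (2 <= n)%N by lia.
have l0 : 0 < ln (n%:R : R) by rewrite ln_gt0// ltr1n; lia.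
rewrite aE lnM ?posrE ?expR_gt0 ?powR_gt0 ?mulr_gt0 ?expR_gt0// expRK ln_powR.
rewrite lnM ?posrE ?expR_gt0// expRK.
have lprod : ln (local_product k n) = \sum_(1 <= p < n.+1 | oddprime p) ln (local_factor k n p).
  rewrite /local_product; elim: (index_iota 1 n.+1) => [|p s IH]; first by rewrite !big_nil ln1.
  rewrite !big_cons; case: ifP => // /andP[pp _].
  have pos q : prime q -> 0 < local_factor k n q.
    by move=> /prime_gt0 q0; apply: lt_le_trans (local_factor_ge1 n k0 q0).
  rewrite lnM ?posrE ?IH ?pos//.
  by elim/big_ind: _ => // [x y hx hy|q /andP[/pos]//]; rewrite mulr_gt0.
have oddsum : \sum_(1 <= p < n.+1 | oddprime p) (K - (if (p ^ 2 <= n)%N then 0 else k / 2)) * ln (1 - p%:R^-1)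
   = - (K * (mertens_sum R n - ln 2)) + k / 2 * Sq n.
  have -> : Sq n = \sum_(1 <= p < n.+1 | oddprime p) (if (p ^ 2 <= n)%N then 0 else - ln (1 - p%:R^-1)).
    by rewrite /Sq -mertens_sum_above_sqrt prime_sum_split2// ifT// add0r.
  have -> : mertens_sum R n - ln 2 = \sum_(1 <= p < n.+1 | oddprime p) - ln (1 - p%:R^-1).
    rewrite /mertens_sum prime_sum_split2// (_ : 1 - 2^-1 = 2^-1 :> R); last by lra.
    by rewrite lnV ?posrE// opprK addrAC subrr add0r.
  rewrite !big_distrr /= -sumrN -big_split /=; apply: eq_bigr => p _.
  by case: ifP => _; ring.
by rewrite lprod /T oddsum /K; field.
Qed.

(** * Comparison of the moment with the product of the local factors *)

Lemma sum_sqrtV_le (R : realType) (n : nat) :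
  \sum_(1 <= m < n.+1) rootV R m <= 2 * Num.sqrt n%:R.
Proof.
elim: n => [|n IH]; first by rewrite big_geq// mulr_ge0// sqrtr_ge0.
rewrite big_nat_recr//= /rootV.
have s1 : 0 < Num.sqrt (n.+1%:R : R) by rewrite sqrtr_gt0 ltr0n.
have s0 : 0 <= Num.sqrt (n%:R : R) by rewrite sqrtr_ge0.
have q1 : Num.sqrt (n.+1%:R : R) ^+ 2 = n%:R + 1 by rewrite sqr_sqrtr// natr1.
have q0 : Num.sqrt (n%:R : R) ^+ 2 = n%:R by rewrite sqr_sqrtr.
have h : (Num.sqrt n.+1%:R)^-1 <= 2 * (Num.sqrt n.+1%:R - Num.sqrt n%:R) :> R.
  rewrite -[leLHS]mul1r ler_pdivrMr//.
  set a := Num.sqrt n.+1%:R in q1 s1 *; set b := Num.sqrt n%:R in q0 s0 *.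
  have := sqr_ge0 (a - b); rewrite sqrrB; move: q1; rewrite -q0 !expr2 => q1; lra.
by move: IH; rewrite /rootV; lra.
Qed.

Lemma expR_sub1_le (R : realType) (y : R) : `|expR y - 1| <= `|y| * expR `|y|.
Proof.
have h1 := expR_ge1Dx y; have h2 := expR_ge1Dx (- `|y|).
have e1 : expR (- `|y|) * expR `|y| = 1 by rewrite mulrC expRxMexpNx_1.
have h3 := ler_wpM2r (expR_ge0 `|y|) h2; rewrite e1 in h3.
have h4 : expR y <= expR `|y| by rewrite ler_expR ler_norm.
have h5 : `|y| <= `|y| * expR `|y|.
  by rewrite ler_peMr//; have := expR_ge1Dx `|y|; have := normr_ge0 y; lra.
have h6 := ler_norm (- y); rewrite normrN in h6.
by rewrite ler_norml; apply/andP; split; lra.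
Qed.

(** From |exp y - 1| <= |y| exp |y| with |y| <= 7 k p^(-1/2). *)
Definition pcoef_const (R : realType) (k : R) : R := 7 * k * expR (7 * k).

Lemma pcoef_bound (R : realType) (k : R) (n p : nat) : 0 <= k -> oddprime p -> (p <= n)%N ->
  `|pcoef k n p 1| <= pcoef_const k * rootV R p /\ `|pcoef k n p 2| <= pcoef_const k * rootV R p.
Proof.
move=> k0 opp pn; have /andP[pp op] := opp.
have /andP[x0 x1] := @rootV_bounds R p (odd_prime_gt2 op pp).
have x2 : rootV R p ^+ 2 <= rootV R p by rewrite expr2 ler_piMr ?(ltW x0)//; lra.
have x3 : rootV R p ^+ 3 <= rootV R p by rewrite exprS ler_piMr ?(ltW x0)//; lra.
have H (e : R) : `|e| = 1 -> `|expR (k * log_factor n p e) - 1| <= pcoef_const k * rootV R p.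
  move=> e1; have h := log_factor_order2 pp op pn e1.
  set s := if _ then _ else _ in h.
  have s01 : 0 <= s <= 2^-1 by rewrite /s; case: ifP => _; lra.
  have lb : `|log_factor n p e| <= 7 * rootV R p.
    rewrite -[log_factor n p e](subrK (e * rootV R p + s * rootV R p ^+ 2)).
    apply: (le_trans (ler_normD _ _)).
    have h2 : `|e * rootV R p + s * rootV R p ^+ 2| <= 3 / 2 * rootV R p.
      apply: (le_trans (ler_normD _ _)); rewrite normrM e1 mul1r (ger0_norm (ltW x0)).
      have /andP[s0 s1] := s01.
      rewrite ger0_norm; last by rewrite mulr_ge0// exprn_ge0// ltW.
      have := ler_wpM2r (exprn_ge0 2 (ltW x0)) s1; lra.
    lra.
  have yb : `|k * log_factor n p e| <= 7 * k * rootV R p.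
    by rewrite normrM (ger0_norm k0); have := ler_wpM2l k0 lb; lra.
  have y7 : `|k * log_factor n p e| <= 7 * k.
    apply: (le_trans yb); rewrite ler_piMr ?mulr_ge0//; lra.
  apply: (le_trans (expR_sub1_le _)).
  rewrite /pcoef_const mulrAC; apply: ler_pM => //; rewrite ?expR_ge0 ?ler_expR//.
have Hp := H 1 (normr1 _); have Hm : `|expR (k * log_factor n p (-1)) - 1| <= pcoef_const k * rootV R p.
  by apply: H; rewrite normrN normr1.
rewrite /pcoef /= opp pn /=; move: Hp Hm; rewrite !ler_norml => /andP[? ?] /andP[? ?].
by split; apply/andP; split; lra.
Qed.

Lemma pcoef_mean_prod (R : realType) (k : R) (n L : nat) : (n < L)%N ->
  \prod_(p < L) \sum_(j < 3) pcoef k n p j * mcoef R p j = local_product k n.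
Proof.
move=> nL; rewrite -(big_mkord xpredT (fun p => \sum_(j < 3) pcoef k n p j * mcoef R p j)).
case: L nL => // L nL; rewrite big_ltn//= (@big_cat_nat _ _ _ n.+1 1 L.+1)//=.
have one (p : nat) : ~~ (oddprime p && (p <= n)%N) -> \sum_(j < 3) pcoef k n p j * mcoef R p j = 1.
  move=> h; rewrite !big_ord_recl big_ord0 /pcoef /= (negbTE h) !mul0r !addr0 mul1r.
  by rewrite /mcoef /= if_same.
rewrite one// mul1r [X in _ * X]big_nat [X in _ * X]big1 ?mulr1; last first.
  by move=> p /andP[np _]; apply: one; rewrite negb_and -ltnNge np orbT.
rewrite /local_product [RHS]big_mkcond; apply: eq_big_nat => p /andP[p1 pn]; rewrite ltnS in pn.
case: ifP => opp; last by rewrite one// opp.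
rewrite !big_ord_recl big_ord0 /pcoef /mcoef opp pn /= /local_factor mulr0 addr0 add0r mulr1.
have pR : 0 < p%:R :> R by rewrite ltr0n.
by field; rewrite !gt_eqF// ltr_wpDl// ltW.
Qed.

(** Each odd prime p <= n contributes at most 1 + 2 c p^(-1/2) n^s, where c is [pcoef_const k].
    Extending the sum of p^(-1/2) to all integers costs only a logarithm, which the exponent 2 -
    delta can afford. *)
Lemma pcoef_norm_prod (R : realType) (k s : R) (n L : nat) : 0 <= k -> 0 <= s -> (n < L)%N ->
  \prod_(p < L) \sum_(j < 3) `|pcoef k n p j| * cond_wt R p j `^ s <=
  expR (4 * pcoef_const k * n%:R `^ (2^-1 + s)).
Proof.
move=> k0 s0 nL.
have K0 : 0 <= pcoef_const k by rewrite /pcoef_const !mulr_ge0// expR_ge0.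
have x0 p : 0 <= rootV R p by rewrite invr_ge0 sqrtr_ge0.
pose a (p : nat) : R := if (0 < p <= n)%N then 2 * pcoef_const k * (rootV R p * n%:R `^ s) else 0.
have a0 p : 0 <= a p by rewrite /a; case: ifP => // _; rewrite !mulr_ge0 ?powR_ge0.
apply: (@le_trans _ _ (\prod_(p < L) (1 + a p))).
  apply: ler_prod => p _; apply/andP; split.
    by apply: sumr_ge0 => j _; rewrite mulr_ge0 ?powR_ge0.
  rewrite !big_ord_recl big_ord0 /= addr0 /bump /= /cond_wt /= andbF powR1 mulr1.
  rewrite /pcoef [in leLHS]/= normr1; have [/andP[opp pn]|h] := boolP (oddprime p && (p <= n)%N); last first.
    by rewrite !normr0 !mul0r !addr0 lerDl.
  have [b1 b2] := pcoef_bound k0 opp pn; rewrite /pcoef /= opp pn /= in b1 b2.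
  rewrite opp /= lerD2l /a; have /andP[/prime_gt0 p0 _] := opp; rewrite p0 pn /=.
  have ps : (p%:R : R) `^ s <= n%:R `^ s by apply: ge0_ler_powR; rewrite ?nnegrE ?ler_nat.
  have c1 := ler_pM (normr_ge0 _) (powR_ge0 p%:R s) b1 ps.
  have c2 := ler_pM (normr_ge0 _) (powR_ge0 p%:R s) b2 ps.
  move: c1 c2; rewrite -mulrA; lra.
apply: (le_trans (prod1D_le_expR _ _)) => //; rewrite ler_expR.
rewrite -(big_mkord xpredT a) (@big_cat_nat _ _ _ n.+1)//= [X in _ + X]big_nat [X in _ + X]big1 ?addr0; last first.
  by move=> p /andP[np _]; rewrite /a [(p <= n)%N]leqNgt np andbF.
rewrite big_ltn//= {1}/a /= add0r.
have -> : \sum_(1 <= p < n.+1) a p = 2 * pcoef_const k * n%:R `^ s * \sum_(1 <= p < n.+1) rootV R p.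
  rewrite big_distrr /=; apply: eq_big_nat => p /andP[p1 pn]; rewrite ltnS in pn.
  by rewrite /a p1 pn /=; ring.
have -> : 4 * pcoef_const k * n%:R `^ (2^-1 + s) = 2 * pcoef_const k * n%:R `^ s * (2 * Num.sqrt n%:R).
  rewrite powRD; last first.
    by apply/implyP => /eqP; lra.
  by rewrite powR12_sqrt//; ring.
by apply: ler_wpM2l; [rewrite !mulr_ge0 ?powR_ge0 | exact: sum_sqrtV_le].
Qed.

Lemma moment_local_product (R : realType) (k s X D : R) : 0 <= k -> 0 <= s <= 1 ->
  8 * sieve_const R <= (Num.truncn D).+1%:R `^ 8^-1 ->
  `|moment k X D - local_product k (Num.truncn X)| <=
  2 * (16 * sieve_const R * (Num.truncn D).+1%:R `^ (- 8^-1)) `^ s *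
    expR (4 * pcoef_const k * (Num.truncn X)%:R `^ (2^-1 + s)).
Proof.
move=> k0 s01 hz; set n := Num.truncn X; set z := (Num.truncn D).+1.
pose L := maxn 3 (maxn n.+1 z).
have L2 : (2 < L)%N by rewrite /L leq_max.
have nL : (n < L)%N by rewrite /L !leq_max leqnn /= orbT.
have zL : (0 < z <= L)%N by rewrite /L !leq_max leqnn !orbT.
rewrite (@momentE _ _ _ _ L)// -(pcoef_mean_prod k nL).
apply: (le_trans (osf_mean_product _ s01 L2 zL hz)); apply: ler_wpM2l.
  by rewrite mulr_ge0 ?powR_ge0.
by apply: pcoef_norm_prod => //; case/andP: s01.
Qed.

Lemma moment_error_small (R : realType) (k delta C e : R) : 0 <= k -> 0 < delta <= 1 ->
  0 <= C -> 0 < e -> exists l0 : R, forall X D : R, 0 <= X -> l0 <= ln D ->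
  X <= C * ln D `^ (2 - delta) -> `|moment k X D - local_product k (Num.truncn X)| <= e.
Proof.
move=> k0 /andP[d0 d1] C0 e0.
(* With this s, (2 - delta)(1/2 + s) <= 1 - eta, so the exponent in the product bound is O((ln D)^(1
   - eta)). *)
pose s := delta / 8; pose eta := delta / 4.
have s0 : 0 < s by rewrite divr_gt0.
have s1 : s <= 1 by rewrite /s; lra.
have s01 : 0 <= s <= 1 by rewrite (ltW s0).
have eta0 : 0 < eta by rewrite divr_gt0.
have K0 : 0 < sieve_const R by rewrite mulr_gt0// expR_gt0.
have P0 : 0 <= pcoef_const k by rewrite /pcoef_const !mulr_ge0// expR_ge0.
pose C2 := 4 * pcoef_const k * C `^ (2^-1 + s).
have C20 : 0 <= C2 by rewrite !mulr_ge0 ?powR_ge0.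
pose A := 2 * (16 * sieve_const R) `^ s.
have A0 : 0 < A by rewrite mulr_gt0// powR_gt0// mulr_gt0.
(* Three thresholds for ln D: [l1] makes the count of d at least z/8, [l2] makes the product bound
   at most exp((s/16) ln D), half of the saving exp(-(s/8) ln D) in the exponent, and [l3] makes the
   remaining half beat the constant. *)
pose l1 := 8 * ln (8 * sieve_const R).
pose l2 := (16 * (C2 + 1) / s) `^ (eta^-1).
pose l3 := - (ln (e / A)) * (16 / s).
exists (Num.max 1 (Num.max l1 (Num.max l2 l3))) => X D X0.
rewrite !ge_max => /and4P[hl0 hl1 hl2 hl3] hX; set l := ln D in hl0 hl1 hl2 hl3 hX.
have D0 : 0 < D.
  rewrite ltNge; apply/negP => D0; move: hl0; rewrite /l ln0//; lra.
have lp : 0 < l by lra.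
set z := (Num.truncn D).+1%:R : R.
have z0 : 0 < z by rewrite ltr0n.
have lz : l <= ln z.
  by rewrite ler_ln ?posrE//; apply: ltW; exact: truncnS_gt.
have hz : 8 * sieve_const R <= z `^ 8^-1.
  have p8 : 0 < 8 * sieve_const R by rewrite mulr_gt0.
  rewrite -(lnK p8) /powR gt_eqF// ler_expR.
  by move: hl1 lz; rewrite /l1; lra.
apply: (le_trans (moment_local_product X k0 s01 hz)); rewrite -/z.
have h16 : 0 <= 16 * sieve_const R by rewrite mulr_ge0// ltW.
rewrite powRM ?powR_ge0// mulrA -/A -powRrM -mulrA.
have n1 : (Num.truncn X)%:R <= X by rewrite truncn_le.
have nb : 4 * pcoef_const k * (Num.truncn X)%:R `^ (2^-1 + s) <= C2 * l `^ (1 - eta).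
  rewrite /C2 -[leRHS]mulrA; apply: ler_wpM2l; first by rewrite mulr_ge0.
  have q0 : 0 <= 2^-1 + s by lra.
  apply: (@le_trans _ _ ((C * l `^ (2 - delta)) `^ (2^-1 + s))).
    by apply: ge0_ler_powR; rewrite ?nnegrE ?mulr_ge0 ?powR_ge0//; exact: le_trans hX.
  rewrite powRM ?powR_ge0// ler_wpM2l ?powR_ge0// -powRrM; apply: ler_powR => //.
  by rewrite /s /eta; nra.
have lb : C2 * l `^ (1 - eta) <= s / 16 * l.
  have e1 : l = l `^ (1 - eta) * l `^ eta.
    by rewrite -powRD; [rewrite subrK powRr1// ltW | apply/implyP => _; rewrite gt_eqF].
  rewrite [X in _ <= _ * X]e1 mulrCA [leRHS]mulrC mulrC [leRHS]mulrC.
  rewrite [leLHS]mulrC ; rewrite ![_ * l `^ (1 - eta)]mulrC ler_wpM2l ?powR_ge0//.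
  have : 16 * (C2 + 1) / s <= l `^ eta.
    have b0 : 0 <= 16 * (C2 + 1) / s by rewrite divr_ge0 ?mulr_ge0 ?addr_ge0// ltW.
    have -> : 16 * (C2 + 1) / s = l2 `^ eta.
      by rewrite /l2 -powRrM mulVf ?gt_eqF// powRr1.
    by apply: ge0_ler_powR; rewrite ?nnegrE ?powR_ge0 ?(ltW eta0) ?(ltW lp).
  rewrite ler_pdivrMr// => h; move: h; lra.
have zs : z `^ (- 8^-1 * s) <= expR (- (s / 8) * l).
  rewrite /powR gt_eqF// ler_expR; have := ler_wpM2l (ltW s0) lz; lra.
apply: (@le_trans _ _ (A * (expR (- (s / 8) * l) * expR (s / 16 * l)))).
  apply: ler_wpM2l; first exact: ltW.
  apply: ler_pM; rewrite ?powR_ge0 ?expR_ge0// ler_expR.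
  exact: le_trans nb lb.
rewrite -expRD mulrC -ler_pdivlMr//.
have ea : 0 < e / A by rewrite divr_gt0.
rewrite -(lnK ea) ler_expR.
have : l3 * (s / 16) <= l * (s / 16) by apply: ler_wpM2r => //; rewrite divr_ge0// ltW.
have -> : l3 * (s / 16) = - ln (e / A) by rewrite /l3; field; rewrite gt_eqF.
lra.
Qed.

(** * Passage to real X and the asymptotic equivalence *)

(** The local product only sees the integer part n of X, while the main term contains ln X; the gap
    ln ln X - ln ln n is at most 2/n. *)
Lemma local_product_main_term (R : realType) (k e : R) : 0 <= k -> 0 < e ->
  exists N : R, forall X : R, N <= X ->
  `|ln (local_product k (Num.truncn X)) -
    ln (a_Sp k * (expR (euler_gamma R) * ln X) `^ (k * (k + 1) / 2))| <= e.
Proof.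
move=> k0 e0; set K := k * (k + 1) / 2.
have K0 : 0 <= K by rewrite divr_ge0// mulr_ge0// addr_ge0.
have e2 : 0 < e / 2 by rewrite divr_gt0.
have /cvgrPdist_le/(_ _ e2)[N _ HN] := local_product_asymptotic k0.
pose M := 2 * K * (2 / e).
exists (Num.max (N.+3%:R) (M + 1)) => X; rewrite ge_max => /andP[NX MX].
have X0 : 0 <= X by apply: le_trans NX.
set n := Num.truncn X.
have nN : (N.+3 <= n)%N by rewrite truncn_ge_nat.
have n0 : 0 < n%:R :> R by rewrite ltr0n; lia.
have nX : n%:R <= X by rewrite truncn_le.
have Xn : X < n%:R + 1 by rewrite natr1 truncnS_gt.
have lnn : 2^-1 <= ln (n%:R : R).
  by apply: (le_trans (ln2_ge R)); rewrite ler_ln ?posrE// (ler_nat R 2); lia.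
have Xp : 0 < X by lra.
have lX : ln n%:R <= ln X by rewrite ler_ln ?posrE.
have a0 : 0 < a_Sp k by rewrite a_Sp_value// expR_gt0.
have lE (u : R) : 0 < u -> ln (a_Sp k * (expR (euler_gamma R) * u) `^ K) =
    ln (a_Sp k) + K * (euler_gamma R + ln u).
  move=> u0; have gu : 0 < expR (euler_gamma R) * u by rewrite mulr_gt0// expR_gt0.
  rewrite lnM ?posrE ?powR_gt0// ln_powR lnM ?posrE ?expR_gt0//.
  by rewrite expRK.
have h1 := HN n (leq_trans (leqW (leqW (leqnSn N))) nN).
rewrite /= sub0r normrN lE in h1; last by lra.
rewrite lE; last by lra.
have d1 : ln (ln X) - ln (ln n%:R) <= 2 * n%:R^-1.
  rewrite -ln_div ?posrE; [|lra|lra].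
  apply: (le_trans (ln_le_subr1 _)); first by rewrite divr_gt0//; lra.
  have -> : ln X / ln n%:R - 1 = (ln X - ln n%:R) / ln n%:R by field; rewrite gt_eqF//; lra.
  have t1 : ln X - ln n%:R <= n%:R^-1.
    rewrite -ln_div ?posrE//; apply: (le_trans (ln_le_subr1 _)); first by rewrite divr_gt0.
    rewrite lerBlDr ler_pdivrMr// mulrDl mulVf ?gt_eqF// mul1r addrC; exact: ltW.
  have t2 : (ln n%:R)^-1 <= 2 :> R.
    by rewrite -[2]invrK lef_pV2 ?posrE ?invr_gt0//; lra.
  rewrite mulrC; apply: ler_pM => //; [by rewrite invr_ge0; lra | by rewrite subr_ge0].
have d0 : 0 <= ln (ln X) - ln (ln n%:R).
  by rewrite subr_ge0 ler_ln ?posrE; lra.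
have d2 : K * (ln (ln X) - ln (ln n%:R)) <= e / 2.
  apply: (@le_trans _ _ (K * (2 * n%:R^-1))); first exact: ler_wpM2l.
  rewrite mulrA ler_pdivrMr//.
  have : M <= n%:R by lra.
  rewrite /M mulrA ler_pdivrMr//; lra.
have d3 : 0 <= K * (ln (ln X) - ln (ln n%:R)) by rewrite mulr_ge0.
move: h1; rewrite !ler_norml => /andP[? ?]; apply/andP; split; lra.
Qed.

(** Since the local product is at least 1, g is at least 1/2, and an absolute error is also a
    relative one. *)
Lemma relative_error (R : realType) (m lp g e : R) : 0 < e <= 1 -> 0 < g -> 1 <= lp ->
  `|m - lp| <= e / 8 -> `|ln lp - ln g| <= e / 8 -> `|m - g| <= e * g.
Proof.
move=> /andP[e0 e1] g0 lp1 h1 h2.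
have lp0 : 0 < lp by lra.
have E : lp = g * expR (ln lp - ln g).
  by rewrite expRB !lnK ?posrE// mulrCA divff ?mulr1// gt_eqF.
have := expR_sub1_le (ln lp - ln g).
set u := ln lp - ln g in E h2 *; move=> h3.
have x2 : expR `|u| <= 2.
  have h4 : expR `|u| * expR (- `|u|) = 1 by rewrite expRxMexpNx_1.
  have h5 := expR_ge1Dx (- `|u|); have h6 := expR_gt0 `|u|; nra.
have h4 : `|expR u - 1| <= e / 4.
  have := ler_pM (normr_ge0 u) (expR_ge0 `|u|) h2 x2; lra.
have d : `|lp - g| <= e / 4 * g.
  rewrite E -{2}[g]mulr1 -mulrBr normrM (gtr0_norm g0) mulrC; apply: ler_wpM2r => //; exact: ltW.
have g2 : 1 <= 2 * g.
  move: d; rewrite ler_norml => /andP[? ?]; nra.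
have -> : m - g = (m - lp) + (lp - g) by ring.
apply: (le_trans (ler_normD _ _)); nra.
Qed.

(* "X, D -> oo with X << (log D)^(2 - delta)": X and D are real functions on an
   arbitrary filtered parameter space. *)
Theorem theoremS2 (R : realType) (delta k : R) (hdelta : 0 < delta) (hk : 0 <= k)
  (T : Type) (F : filter_on T) (X D : T -> R)
  (hX : X @ F --> +oo) (hD : D @ F --> +oo)
  (hXD : X =O_F (fun t => (ln (D t)) `^ (2 - delta))) :
  (fun t => moment k (X t) (D t)) ~_F
  (fun t => a_Sp k * (expR (euler_gamma R) * ln (X t)) `^ (k * (k + 1) / 2)).
Proof.
apply/eqaddoP => eps eps0.
pose e := Num.min 1 eps.
have e0 : 0 < e by rewrite lt_min ltr01.
have e01 : 0 < e <= 1 by rewrite e0 ge_min lexx.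
have ee : e <= eps by rewrite ge_min lexx orbT.
have e8 : 0 < e / 8 by rewrite divr_gt0.
have /eqO_exP[C C0 HC] := hXD.
(* Once ln D >= 1, lowering delta only weakens the growth condition on X, so it is enough to treat
   delta in (0, 1]. *)
pose dl := Num.min delta 1.
have dl01 : 0 < dl <= 1 by rewrite lt_min hdelta ltr01 ge_min lexx orbT.
have dld : dl <= delta by rewrite ge_min lexx.
have [l0 Hl] := moment_error_small hk dl01 (ltW C0) e8.
have [N HN] := local_product_main_term hk e8.
have hX1 : \forall t \near F, Num.max N 2 <= X t by move/cvgryPge : hX; apply.
have hD1 : \forall t \near F, expR (Num.max l0 1) <= D t by move/cvgryPge : hD; apply.
near=> t.
have Xt : Num.max N 2 <= X t by near: t.
have Dt : expR (Num.max l0 1) <= D t by near: t.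
have Ct : `|X t| <= C * `|ln (D t) `^ (2 - delta)| by near: t.
move: Xt; rewrite ge_max => /andP[NX X2].
have lD : Num.max l0 1 <= ln (D t).
  by rewrite -[leLHS]expRK ler_ln ?posrE ?expR_gt0// (lt_le_trans (expR_gt0 _) Dt).
move: lD; rewrite ge_max => /andP[lD0 lD1].
have X0 : 0 <= X t by lra.
have XC : X t <= C * ln (D t) `^ (2 - dl).
  move: Ct; rewrite (ger0_norm X0) (ger0_norm (powR_ge0 _ _)) => h; apply: (le_trans h).
  by rewrite ler_wpM2l ?(ltW C0)//; apply: ler_powR => //; lra.
set g := a_Sp k * _.
have lX : 0 < ln (X t) by rewrite ln_gt0//; lra.
have g0 : 0 < g.
  apply: mulr_gt0; first by rewrite a_Sp_value// expR_gt0.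
  by rewrite powR_gt0// mulr_gt0// expR_gt0.
have h1 := Hl (X t) (D t) X0 lD0 XC.
have h2 := HN (X t) NX.
have := relative_error e01 g0 (local_product_ge1 _ hk) h1 h2.
rewrite -[(_ - _) t]/(moment k (X t) (D t) - g) => h; apply: (le_trans h).
by rewrite -/g (gtr0_norm g0) ler_wpM2r// ltW.
Unshelve. all: by end_near. Qed.
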